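(* Consider the controlled branching process of the context and assume conditions (AD0) and (AD-C) stated there, with common critical index $\sigma\in(0,\infty)$. Define $$b_n^{\mathrm{cr}}(r):=\begin{cases}n^{-\sigma},&r>\sigma,\\ n^{-\sigma}\log n,&r=\sigma,\\ n^{-r},&0<r<\sigma.\end{cases}$$ Then for $Y_n=X_n$ and for $Y_n=N_n$, and every $r>0$, $$0<\liminf_{n\to\infty}\frac{\mathbf E[Y_n^{-r};Y_n>0]}{b_n^{\mathrm{cr}}(r)}\le\limsup_{n\to\infty}\frac{\mathbf E[Y_n^{-r};Y_n>0]}{b_n^{\mathrm{cr}}(r)}<\infty .$$ If, for some $p\ge2$ and $q:=p/2$, $\mathbf E|\xi-m|^p<\infty$ and $\sup_{k\ge1}k^{-p/2}\mathbf E|\phi(k)-\tau k|^p<\infty$, then for every $\varepsilon>0$ and $j=1,2,3$ $$\limsup_{n\to\infty}\frac{J_{n,j}(\varepsilon)}{b_n^{\mathrm{cr}}(q)}<\infty .$$ If condition (AD-E) of the context holds, then $\limsup_{n\to\infty}n^{\sigma}J_{n,j}(\varepsilon)<\infty$ for every $\varepsilon>0$ and $j=1,2,3$.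
   Context: Notation: $\mathbf E[Y;B]=\mathbf E[Y\mathbf 1_B]$; p.g.f. = probability generating function. Model. $\xi_{n,j}$ are i.i.d. copies of a nonnegative integer-valued $\xi$ with mean $m\in(0,\infty)$ and p.g.f. $f$. The random control functions $\phi_n:\{0,1,2,\dots\}\to\{0,1,2,\dots\}$ are i.i.d. copies of $\phi$, independent of the offspring array and of $X_0$. $N_n:=\phi_n(X_n)$, $X_{n+1}:=\sum_{j=1}^{N_n}\xi_{n,j}$, $h_k(s):=\mathbf E[s^{\phi(k)}]$. (AD0): there are p.g.f.s $l_L,l_U,d_L,d_U$ with $d_e(1)=l_e(1)=1$ ($e\in\{L,U\}$) such that $d_L(s)l_L(s)^k\le h_k(s)\le d_U(s)l_U(s)^k$ for all $k\in\{0,1,2,\dots\}$, $0\le s\le1$; $l_L'(1)=l_U'(1)=:\tau\in(0,\infty)$; and $l_L''(1)+l_U''(1)<\infty$ (the last is required whenever harmonic moments of $N_n$ are asserted). Put $u_e:=l_e\circ f$, $R_e:=d_e\circ f$, $a:=m\tau$. (AD-C): $a=1$ and, for each $e\in\{L,U\}$, there are $\gamma_e,\beta_e\in(0,\infty)$ and $\eta_e\in(0,1]$ such that, as $x\downarrow0$, $u_e(1-x)=1-x+\gamma_ex^2+O(x^{2+\eta_e})$ and $\log R_e(1-x)=-\beta_ex+O(x^2)$, with $u_e(1)=u_e'(1)=R_e(1)=1$; moreover $\beta_L/\gamma_L=\beta_U/\gamma_U=:\sigma\in(0,\infty)$. (AD-E): $\xi$ has a moment generating function finite in a neighborhood of zero;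 $\Lambda_\phi(\eta):=\lim_{k\to\infty}k^{-1}\log\mathbf E[e^{\eta\phi(k)}]$ exists on an open interval containing $0$, is differentiable there, and $\Lambda_\phi'(0)=\tau$; and $\inf_{|x-\tau|\ge\varepsilon}\Lambda_\phi^*(x)>0$ for every $\varepsilon>0$, where $\Lambda_\phi^*(x):=\sup_\eta\{\eta x-\Lambda_\phi(\eta)\}$. Ratio-deviation probabilities: $J_{n,1}(\varepsilon):=\mathbf P(N_n>0,\ |X_{n+1}/N_n-m|>\varepsilon)$; $J_{n,2}(\varepsilon):=\mathbf P(X_n>0,\ |N_n/X_n-\tau|>\varepsilon)$; $J_{n,3}(\varepsilon):=\mathbf P(X_n>0,\ |X_{n+1}/X_n-a|>\varepsilon)$. *)

(* Defs.v *)
From HB Require Import structures.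
From mathcomp Require Import all_boot all_order all_algebra.
From mathcomp Require Import all_classical all_reals all_analysis.

Set Implicit Arguments.
Unset Strict Implicit.
Unset Printing Implicit Defensive.

Import Order.TTheory GRing.Theory Num.Theory.
Import numFieldNormedType.Exports.

Local Open Scope classical_set_scope.
Local Open Scope ring_scope.

(** ** Probability generating functions *)

(* Only the values on [0, 1] are constrained; [g 1 = 1] says that the
   coefficients sum to one. *)
Definition is_pgf (R : realType) (g : R -> R) : Prop :=
  exists p : nat -> R,
    [/\ forall k, 0 <= p k,
        forall s, 0 <= s <= 1 -> series (fun k => p k * s ^+ k) @ \oo --> g s
      & g 1 = 1].

(* The n-th derivative of a p.g.f. at 1 is the left limit of its n-th
   derivative, and [c] is its (finite) value. *)
Definition deriv_at1 (R : realType) (g : R -> R) (n : nat) (c : R) : Prop :=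
  derive1n n g s @[s --> 1^'-] --> c.

Definition pgf_of (R : realType) (d : measure_display) (T : measurableType d)
    (P : probability T R) (Y : T -> nat) (s : R) : R :=
  fine 'E_P[fun w => (s ^+ Y w)%R].

(** ** Independence *)

Definition mutually_independent (R : realType) (d : measure_display)
    (T : measurableType d) (P : probability T R) (I : eqType)
    (G : I -> set (set T)) : Prop :=
  forall (r : seq I) (E : I -> set T), uniq r ->
    (forall i, i \in r -> G i (E i)) ->
    P (\bigcap_(i in [set` r]) E i) = (\prod_(i <- r) P (E i))%E.

(* The product sigma-algebra on functions nat -> nat: a control function is a
   random element of this space. *)
Definition cylinder_sigma : set (set (nat -> nat)) :=
  <<s \bigcup_k preimage_set_system setT (fun g : nat -> nat => g k) setT >>.

(** ** Controlled branching processes *)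

Section Process.
Context {T : Type}.
Variables (X0 : T -> nat) (Xi Phi : nat -> nat -> T -> nat).

(* [Xi n j], j = 0, 1, ..., are the offspring numbers of generation n and
   [fun k => Phi n k w] is the n-th control function. *)
Fixpoint popX (n : nat) (w : T) : nat :=
  if n is n'.+1 then \sum_(j < Phi n' (popX n' w) w) Xi n' j w else X0 w.

Definition popN (n : nat) (w : T) : nat := Phi n (popX n w) w.

End Process.

(* The independent sources of randomness: X_0, each offspring variable, and
   each control function. *)
Definition source : Type := option (nat * nat + nat)%type.

Definition source_sigma (T : Type) (X0 : T -> nat)
    (Xi Phi : nat -> nat -> T -> nat) (i : source) : set (set T) :=
  match i with
  | None => preimage_set_system setT X0 setT
  | Some (inl nj) => preimage_set_system setT (Xi nj.1 nj.2) setT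
  | Some (inr n) =>
      preimage_set_system setT (fun w k => Phi n k w) cylinder_sigma
  end.

(* [xi] and [phi] are generic: only their laws matter. *)
Record cbp_model (R : realType) (d : measure_display) (T : measurableType d)
    (P : probability T R) (m : R) (xi : {RV P >-> nat})
    (phi : nat -> {RV P >-> nat}) (X0 : {RV P >-> nat})
    (Xi Phi : nat -> nat -> {RV P >-> nat}) : Prop := CbpModel {
  cbp_mean_gt0 : 0 < m ;
  cbp_mean : ('E_P[fun w => (xi w)%:R%R] = m%:E)%E ;
  cbp_offspring_law : forall n j (B : set nat),
    P (Xi n j @^-1` B) = P (xi @^-1` B) ;
  cbp_control_law : forall n (B : set (nat -> nat)), cylinder_sigma B ->
    P [set w | B (fun k => Phi n k w)] = P [set w | B (fun k => phi k w)] ;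
  cbp_indep : mutually_independent P
    (source_sigma X0 (fun n j => Xi n j) (fun n k => Phi n k)) }.

(** ** Conditions *)

Variant edge := Lower | Upper.

Record AD0 (R : realType) (d : measure_display) (T : measurableType d)
    (P : probability T R) (phi : nat -> {RV P >-> nat}) (tau : R)
    (l dl : edge -> R -> R) : Prop := MkAD0 {
  AD0_pgf_l : forall e, is_pgf (l e) ;
  AD0_pgf_d : forall e, is_pgf (dl e) ;
  AD0_bounds : forall (k : nat) (s : R), 0 <= s <= 1 ->
    dl Lower s * l Lower s ^+ k <= pgf_of P (phi k) s
      <= dl Upper s * l Upper s ^+ k ;
  AD0_tau_gt0 : 0 < tau ;
  AD0_tau : forall e, deriv_at1 (l e) 1 tau ;
  AD0_second : forall e, exists c, deriv_at1 (l e) 2 c }.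

Record ADC (R : realType) (d : measure_display) (T : measurableType d)
    (P : probability T R) (m tau : R) (xi : {RV P >-> nat})
    (l dl : edge -> R -> R) (sigma : R) : Prop := MkADC {
  ADC_critical : m * tau = 1 ;
  ADC_sigma_gt0 : 0 < sigma ;
  ADC_expansion : exists gamma beta eta : edge -> R, forall e,
    let u := l e \o pgf_of P xi in
    let Q := dl e \o pgf_of P xi in
    [/\ [/\ 0 < gamma e, 0 < beta e & 0 < eta e <= 1],
        (fun x => u (1 - x) - (1 - x + gamma e * x ^+ 2))
          =O_ (0^'+) (fun x => x `^ (2 + eta e)),
        (fun x => ln (Q (1 - x)) - (- beta e * x))
          =O_ (0^'+) (fun x => x ^+ 2),
        [/\ u 1 = 1, deriv_at1 u 1 1 & Q 1 = 1]
      & beta e / gamma e = sigma] }.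

(* The limit is taken in the extended reals; the term of index 0 is junk. *)
Definition scaled_cgf (R : realType) (d : measure_display)
    (T : measurableType d) (P : probability T R) (phi : nat -> {RV P >-> nat})
    (eta : R) (k : nat) : \bar R :=
  (k%:R^-1%:E * lne ('M_P (fun w => (phi k w)%:R) eta))%E.

Definition Lambda (R : realType) (d : measure_display)
    (T : measurableType d) (P : probability T R) (phi : nat -> {RV P >-> nat})
    (eta : R) : \bar R :=
  limn (scaled_cgf phi eta).

(* The supremum runs over the points where the limit defining [Lambda]
   exists; those where it is +oo do not contribute. *)
Definition Lambda_star (R : realType) (d : measure_display)
    (T : measurableType d) (P : probability T R) (phi : nat -> {RV P >-> nat})
    (x : R) : \bar R :=
  ereal_sup [set ((eta * x)%:E - Lambda phi eta)%E |
             eta in [set eta | cvgn (scaled_cgf phi eta)]].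

Record ADE (R : realType) (d : measure_display) (T : measurableType d)
    (P : probability T R) (tau : R) (xi : {RV P >-> nat})
    (phi : nat -> {RV P >-> nat}) : Prop := MkADE {
  ADE_mgf : \forall t \near (0 : R),
    ('M_P (fun w => (xi w)%:R) t < +oo)%E ;
  ADE_cgf : exists lo hi : R, [/\ lo < 0, 0 < hi &
    forall eta, lo < eta < hi ->
      [/\ cvgn (scaled_cgf phi eta), Lambda phi eta \is a fin_num &
          derivable (fun t => fine (Lambda phi t)) eta 1]] ;
  ADE_tau : derive1 (fun t => fine (Lambda phi t)) 0 = tau ;
  ADE_rate : forall eps : R, 0 < eps ->
    (0 < ereal_inf [set Lambda_star phi x |
                    x in [set x : R | (eps <= `|x - tau|)%R]])%E }.

(** ** Harmonic moments and ratio deviations *)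

Definition b_cr (R : realType) (sigma r : R) (n : nat) : R :=
  if sigma < r then n%:R `^ (- sigma)
  else if r == sigma then n%:R `^ (- sigma) * ln n%:R
  else n%:R `^ (- r).

Definition harmonic_moment (R : realType) (d : measure_display)
    (T : measurableType d) (P : probability T R) (r : R) (Y : T -> nat) :
    \bar R :=
  'E_P[fun w => ((Y w)%:R `^ (- r) * \1_[set w | (0 < Y w)%N] w)%R]%E.

(* P(A > 0, |B / A - c| > eps) *)
Definition ratio_dev (R : realType) (d : measure_display)
    (T : measurableType d) (P : probability T R) (c eps : R)
    (A B : T -> nat) : \bar R :=
  P [set w | (0 < A w)%N /\ eps < `|(B w)%:R / (A w)%:R - c|].

Variant deviation := J1 | J2 | J3.

Definition Jdev (R : realType) (d : measure_display)
    (T : measurableType d) (P : probability T R) (m tau : R) (X N : nat -> T -> nat)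
    (j : deviation) (eps : R) (n : nat) : \bar R :=
  match j with
  | J1 => ratio_dev P m eps (N n) (X n.+1)
  | J2 => ratio_dev P tau eps (X n) (N n)
  | J3 => ratio_dev P (m * tau) eps (X n) (X n.+1)
  end.

(* Main.v *)
(* Conditioning on X_n gives F_(n+1)(s) <= Q_U(s) F_n(u_U(s)), and the reverse
   inequality for the lower edge, where F_n is the p.g.f. of X_n and
   Q_e = d_e o f. Along x -> x' = 1 - u_e(1 - x) one has 1/x' = 1/x + O(1) with
   positive increments and Q_e(1 - x) = (x'/x)^sigma up to an error dominated by
   the telescoping quantity x^eta - x'^eta, so F_n(1 - x) is of order
   (1 + n x)^(-sigma), uniformly for small x. Since F_(n+1) is the p.g.f. of N_n
   composed with f, the same holds for N_n. Hence P(Y_n <= K) = O((K/n)^sigma),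
   while P(K < Y_n <= B K) >= (K/n)^sigma for a fixed B; summing over geometric
   scales K gives the harmonic moments.
   Given N_n = k the offspring average deviates with probability O(k^(-p/2)), by
   a Chernoff bound for the truncated offspring, and the control function does
   so by Markov's inequality, respectively by Chernoff's bound and
   Lambda'(0) = tau. The ratio deviations are thus bounded by harmonic moments. *)

(* The Laplace bounds must be uniform in both n and t, because harmonic moments probe Y_n at every
   scale K up to n, with t of order 1/K. Errors of the iteration are therefore measured by the drop
   of a potential and not by a rate in n: along any orbit they add up to at most the initial value
   of the potential. The window bound compares two points of the transform. At t = 1/(aK) it is at
   least a large multiple of (K/n)^sigma; values up to K account for a fixed multiple only, and
   values beyond BK for little, since the transform at t/2 has the same order. For r = sigma all
   scales contribute the same order n^(-sigma), and the logarithm counts them. J_3 compares the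
   offspring total with X_n, while the number N_n of summands may be much smaller. The offspring
   estimate is for this reason stated with a reference size K separate from the number i of
   summands. Under the exponential condition a polynomial deviation rate of exponent sigma + 1 is
   enough, since harmonic moments of any order above sigma decay like n^(-sigma). Both deviation
   statements thus share one argument. *)
Require Import Defs.
From HB Require Import structures.
From mathcomp Require Import all_boot all_order all_algebra.
From mathcomp Require Import all_classical all_reals all_analysis.
From mathcomp Require Import measurable_realfun ring lra zify.

Set Implicit Arguments.
Unset Strict Implicit.
Unset Printing Implicit Defensive.

Import Order.TTheory GRing.Theory Num.Theory.
Import numFieldNormedType.Exports.

Local Open Scope classical_set_scope.
Local Open Scope ring_scope.

(** * Events decoupled from a family of sources *)

Section LevelSets.
Context {R : realType} {d : measure_display} {T : measurableType d}.
Variable P : probability T R.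
Implicit Types (A B E : set T) (Y Z : T -> nat).

Lemma measurable_level Y y : measurable_fun setT Y ->
  measurable (Y @^-1` [set y]).
Proof. by move=> mY; rewrite -[X in measurable X]setTI; exact: mY. Qed.

Lemma measurable_fun_level Y : (forall y, measurable (Y @^-1` [set y])) ->
  measurable_fun setT Y.
Proof.
move=> mY _ B _; rewrite setTI.
have -> : Y @^-1` B = \bigcup_(y in B) Y @^-1` [set y].
  by apply/seteqP; split=> [w Bw|w [y By /= ->//]]; exists (Y w).
exact: bigcup_measurable.
Qed.

Lemma bigcup_level A Z : \bigcup_z (A `&` Z @^-1` [set z]) = A.
Proof.
apply/seteqP; split=> [w [z _ []//]|w Aw].
by exists (Z w).
Qed.

Lemma trivIset_level A Z : trivIset setT (fun z => A `&` Z @^-1` [set z]).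
Proof. by move=> i j _ _ [w [[_ /= <-] [_ /= <-]]]. Qed.

Lemma ge0_integral_level A Z (f : T -> \bar R) :
  (forall z, measurable (A `&` Z @^-1` [set z])) -> measurable_fun setT f ->
  (forall w, (0 <= f w)%E) ->
  (\int[P]_(w in A) f w =
   \sum_(0 <= z <oo) \int[P]_(w in A `&` Z @^-1` [set z]) f w)%E.
Proof.
move=> mAZ mf f0.
have mA : measurable A by rewrite -(bigcup_level A Z); exact: bigcup_measurable.
rewrite -{1}(bigcup_level A Z) ge0_integral_bigcup//; last first.
  exact: trivIset_level.
by rewrite bigcup_level; exact: measurable_funTS.
Qed.

Lemma measure_level A Z :
  (forall z, measurable (A `&` Z @^-1` [set z])) ->
  (P A = \sum_(0 <= z <oo) P (A `&` Z @^-1` [set z]))%E.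
Proof.
move=> mAZ; rewrite -{1}(bigcup_level A Z).
rewrite measure_bigcup//; last exact: trivIset_level.
by apply: eq_eseriesl => z; rewrite in_setT.
Qed.

(** The inequality is required only at attained values of [Z], as the other level sets are empty; a
    caller can name the level by a sample point. *)
Lemma ge0_le_integral_level Z (f g : T -> \bar R) :
  measurable_fun setT Z -> measurable_fun setT f -> measurable_fun setT g ->
  (forall w, (0 <= f w)%E) -> (forall w, (0 <= g w)%E) ->
  (forall w0, (\int[P]_(w in Z @^-1` [set Z w0]) f w <=
               \int[P]_(w in Z @^-1` [set Z w0]) g w)%E) ->
  (\int[P]_w f w <= \int[P]_w g w)%E.
Proof.
move=> mZ mf mg f0 g0 fg.
have mTZ z : measurable (setT `&` Z @^-1` [set z]).
  by rewrite setTI; exact: measurable_level.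
rewrite (ge0_integral_level mTZ mf f0) (ge0_integral_level mTZ mg g0).
apply: lee_nneseries => [z _ _|z _]; rewrite setTI.
  by apply: integral_ge0 => w _; exact: f0.
have [[w0 <-]|nz] := pselect (exists w, Z w = z); first exact: fg.
have -> : Z @^-1` [set z] = set0.
  by apply/seteqP; split=> // w zw; case: nz; exists w.
by rewrite !integral_set0.
Qed.

(** The integrand is constant on each level set of [Y], so factorization of the level sets suffices
    and [Y] can be exchanged for any variable carrying its law. *)
Lemma integral_decoupled_rv A Y Y' (g : nat -> R) :
  measurable A -> measurable_fun setT Y -> measurable_fun setT Y' ->
  (forall y, 0 <= g y) ->
  (forall y, P (A `&` Y @^-1` [set y]) = P A * P (Y' @^-1` [set y]))%E ->
  (\int[P]_(w in A) (g (Y w))%:E = P A * \int[P]_w (g (Y' w))%:E)%E.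
Proof.
move=> mA mY mY' g0 indep.
have mg Y0 : measurable_fun setT Y0 ->
    measurable_fun setT (fun w => (g (Y0 w))%:E : \bar R).
  by move=> mY0; apply/measurable_EFinP; apply: measurableT_comp.
have mAY y : measurable (A `&` Y @^-1` [set y]).
  by apply: measurableI => //; exact: measurable_level.
have mTY' y : measurable (setT `&` Y' @^-1` [set y]).
  by rewrite setTI; exact: measurable_level.
rewrite (ge0_integral_level mAY (mg _ mY)); last by move=> w; rewrite lee_fin.
rewrite (ge0_integral_level mTY' (mg _ mY')); last by move=> w; rewrite lee_fin.
rewrite -(fineK (fin_num_measure P A mA)) -nneseriesZl//; last first.
  by move=> y _; apply: integral_ge0 => w _; rewrite lee_fin.
apply: eq_eseriesr => y _.
have cint B Y0 : measurable B -> (forall w, B w -> Y0 w = y) ->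
    (\int[P]_(w in B) (g (Y0 w))%:E = (g y)%:E * P B)%E.
  move=> mB BY; rewrite -integral_cst//; apply: eq_integral => w /set_mem Bw.
  by rewrite (BY _ Bw).
rewrite (cint _ Y)//; last by move=> w [].
rewrite (cint _ Y')//; last by move=> w [].
by rewrite setTI indep fineK ?fin_num_measure// muleCA.
Qed.

End LevelSets.

Section Decoupling.
Context {R : realType} {d : measure_display} {T : measurableType d}.
Variables (P : probability T R) (I : choiceType) (G : I -> set (set T)).
Hypothesis Gm : forall i E, G i E -> measurable E.
Hypothesis Gind : mutually_independent P G.
Implicit Types (A B E : set T) (Z : pred I).

(* Independence of [A] from [(G i)_(i in Z)] is only tested on finite
   intersections: this passes through countable partitions, so the events of
   the process are handled recursively, without generated sigma-algebras. *)
Definition decoupled Z A : Prop :=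
  measurable A /\ forall (r : seq I) (E : I -> set T), uniq r ->
    (forall i, i \in r -> Z i /\ G i (E i)) ->
    (P (A `&` \bigcap_(i in [set` r]) E i) = P A * \prod_(i <- r) P (E i))%E.

Lemma decoupled_measurable Z A : decoupled Z A -> measurable A.
Proof. by case. Qed.

Lemma decoupledT Z : decoupled Z setT.
Proof.
split=> // r E ur rE; rewrite setTI probability_setT mul1e.
by apply: Gind => // i /rE[].
Qed.

Lemma decoupled0 Z : decoupled Z set0.
Proof. by split=> // r E _ _; rewrite set0I measure0 mul0e. Qed.

Lemma decoupledW Z Z' A : {subset Z' <= Z} -> decoupled Z A -> decoupled Z' A.
Proof.
move=> ZZ' [mA dA]; split=> // r E ur rE; apply: dA => // i ir.
by have [Zi Ei] := rE i ir; split=> //; exact: ZZ'.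
Qed.

Lemma decoupledM Z A i E : decoupled Z A -> Z i -> G i E ->
  (P (A `&` E) = P A * P E)%E.
Proof.
move=> [_ dA] Zi GE.
have := dA [:: i] (fun=> E); rewrite big_seq1 => <- //.
  by congr (P (A `&` _)); rewrite set_cons1 bigcap_set1.
by move=> j; rewrite inE => /eqP ->.
Qed.

(** Intersecting with an event of source [i] spends that source: a test family avoiding [i] extends
    to [i :: r] with [E] at [i], and the factor [P E] then splits off. *)
Lemma decoupledI Z A i E : decoupled Z A -> Z i -> G i E ->
  decoupled [pred j | Z j && (j != i)] (A `&` E).
Proof.
move=> dA Zi GE; split.
  by apply: measurableI; [exact: decoupled_measurable dA|exact: Gm GE].
move=> r F ur rF.
have ir : i \notin r by apply/negP => /rF[/=]; rewrite eqxx andbF.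
pose F' j := if j == i then E else F j.
have F'F j : j \in r -> F' j = F j.
  by move=> jr; rewrite /F'; case: eqP => // ji; move: ir; rewrite -ji jr.
have dAE : (P (A `&` (E `&` \bigcap_(j in [set` r]) F j)) =
    P A * (P E * \prod_(j <- r) P (F j)))%E.
  have F'i : F' i = E by rewrite /F' eqxx.
  have [_ /(_ (i :: r) F')] := dA.
  rewrite bigcap_seq !big_cons F'i -bigcap_seq => dAE.
  rewrite (eq_big_seq (fun j => P (F' j))); last by move=> j /F'F ->.
  rewrite -dAE; last 2 first.
  - by rewrite /= ir ur.
  - move=> j; rewrite inE => /orP[/eqP ->|jr]; first by rewrite F'i.
    have [/andP[Zj _] GF] := rF j jr.
    by rewrite F'F.
  by congr (P (_ `&` (_ `&` _))); apply: eq_bigcapr => j /= /F'F ->.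
by rewrite (decoupledM dA Zi GE) -muleA -setIA.
Qed.

(** The defining identity is additive in [A], so it may be checked on the pieces of a countable
    partition. This is how random indices are frozen to constants. *)
Lemma decoupled_level Z A (Y : T -> nat) :
  (forall y, decoupled Z (A `&` Y @^-1` [set y])) -> decoupled Z A.
Proof.
move=> dAY.
have mAY y : measurable (A `&` Y @^-1` [set y]).
  exact: decoupled_measurable (dAY y).
split; first by rewrite -(bigcup_level A Y); exact: bigcup_measurable.
move=> r E ur rE.
have mE : measurable (\bigcap_(i in [set` r]) E i).
  apply: fin_bigcap_measurable; first exact: finite_seq.
  by move=> i /rE[_]; exact: Gm.
have prod_ge0 : (0 <= \prod_(i <- r) P (E i))%E.
  by apply: prode_ge0 => i _; exact: measure_ge0.
rewrite (@measure_level _ _ _ P _ Y); last first.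
  by move=> y; rewrite setIAC; exact: measurableI.
have -> : (\prod_(i <- r) P (E i) = (fine (\prod_(i <- r) P (E i)))%:E)%E.
  rewrite fineK// big_seq; apply: prode_fin_num => i /rE[_ /Gm mEi].
  exact: fin_num_measure.
rewrite (@measure_level _ _ _ P A Y)// muleC -nneseriesZl//.
apply: eq_eseriesr => y _; rewrite setIAC.
have [_ ->//] := dAY y; rewrite muleC fineK// big_seq.
by apply: prode_fin_num => i /rE[_ /Gm mEi]; exact: fin_num_measure.
Qed.

End Decoupling.

(** * Conditioning on the population and control sizes *)

Section Process.
Context {R : realType} {d : measure_display} {T : measurableType d}.
Variables (P : probability T R) (m : R) (xi : {RV P >-> nat})
  (phi : nat -> {RV P >-> nat}) (X0 : {RV P >-> nat})
  (Xi Phi : nat -> nat -> {RV P >-> nat}).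
Hypothesis model : cbp_model m xi phi X0 Xi Phi.

Let X := popX X0 (fun n j => Xi n j) (fun n k => Phi n k).
Let N := popN X0 (fun n j => Xi n j) (fun n k => Phi n k).
Let G := source_sigma X0 (fun n j => Xi n j) (fun n k => Phi n k).
Let S n i w := (\sum_(j < i) Xi n j w)%N.
Let offspring n j : source := Some (inl (n, j)).
Let control n : source := Some (inr n).

Lemma preimage_in_system {U : Type} (f : T -> U) (GU : set (set U)) B :
  GU B -> preimage_set_system setT f GU (f @^-1` B).
Proof. by move=> GB; exists B => //; rewrite setTI. Qed.

Lemma cylinder_coord k (B : set nat) :
  cylinder_sigma [set g : nat -> nat | B (g k)].
Proof.
apply: sub_sigma_algebra; exists k => //.
by exists B; rewrite ?setTI.
Qed.

Lemma source_sigma_measurable i E : G i E -> measurable E.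
Proof.
have mRV (Y : {RV P >-> nat}) (B : set nat) : measurable (Y @^-1` B).
  by rewrite -[X in measurable X]setTI; exact: measurable_funPT.
case: i => [[[n j]|n]|] /=.
- by move=> [B _ <-]; rewrite setTI.
- move=> [B cB <-]; rewrite setTI.
  pose C := [set B : set (nat -> nat) |
    measurable ((fun w k => Phi n k w) @^-1` B)].
  have : cylinder_sigma `<=` C.
    apply: smallest_sub; last first.
      by move=> _ [k _] [B' _ <-]; rewrite setTI /C/=; exact: (mRV (Phi n k)).
    split; rewrite /C/=.
    + by rewrite preimage_set0.
    + by move=> D mD; rewrite setTD preimage_setC; exact: measurableC.
    + by move=> D mD; rewrite preimage_bigcup; exact: bigcup_measurable.
  exact.
- by move=> [B _ <-]; rewrite setTI.
Qed.

Lemma source_offspring n j B : G (offspring n j) (Xi n j @^-1` B).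
Proof. exact: preimage_in_system. Qed.

Lemma source_control n k B : G (control n) (Phi n k @^-1` B).
Proof.
apply: (@preimage_in_system _ (fun w k => Phi n k w) _ [set g | B (g k)]).
exact: cylinder_coord.
Qed.

Let Dec := decoupled P G.
Let Gm := source_sigma_measurable.
Let Gind := cbp_indep model.

Lemma control_law n k B : P (Phi n k @^-1` B) = P (phi k @^-1` B).
Proof.
have := cbp_control_law model n (cylinder_coord k B).
by [].
Qed.

(** The last summand is peeled off: given that it equals [y], the others must total [x - y]. The
    available sources shrink at each peeling, hence the generalization over [Z] and [A]; [Z'] is
    what survives once all the offspring sources are spent. *)
Lemma decoupled_offspring_sum n i x (Z Z' : pred source) A :
  Dec Z A -> (forall j, (j < i)%N -> Z (offspring n j)) ->
  {subset Z' <= Z} -> (forall j, (j < i)%N -> ~~ Z' (offspring n j)) ->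
  Dec Z' (A `&` S n i @^-1` [set x]).
Proof.
elim: i x Z A => [|i IH] x Z A dA Zi ZZ' Z'i.
  have -> : S n 0 @^-1` [set x] = [set _ | x = 0%N].
    by apply/seteqP; split=> w; rewrite /S /= big_ord0.
  have [->|x0] := eqVneq x 0%N.
    rewrite (_ : [set _ | _] = setT) ?setIT; last by apply/seteqP; split.
    exact: decoupledW dA.
  rewrite (_ : [set _ | _] = set0) ?setI0; first exact: decoupled0.
  by apply/seteqP; split=> // w /= /eqP; rewrite (negbTE x0).
apply: (decoupled_level Gm (Y := Xi n i)) => y.
(* Subtraction truncates, so the values [y > x], for which the event is empty, are treated apart. *)
have [yx|xy] := leqP y x; last first.
  rewrite (_ : _ `&` _ = set0); first exact: decoupled0.
  apply/seteqP; split=> // w [[_ /=]]; rewrite /S big_ord_recr/= => sx ys.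
  by move: xy; rewrite -sx -ys ltnNge leq_addl.
rewrite (_ : _ `&` _ =
    (A `&` Xi n i @^-1` [set y]) `&` S n i @^-1` [set (x - y)%N]); last first.
  apply/seteqP; split=> w /=; rewrite /S big_ord_recr/=.
    by move=> [[Aw <-] <-]; rewrite addnK.
  move=> [[Aw yE] ->]; rewrite yE subnK//.
apply: (IH _ [pred s | Z s && (s != offspring n i)]).
- apply: (decoupledI Gm dA (Zi _ (ltnSn i))); exact: source_offspring.
- move=> j ji /=; rewrite Zi ?(ltnW ji)//=; last exact: ltnW.
  by apply/eqP => -[ji']; move: ji; rewrite ji' ltnn.
- move=> s Z's; rewrite !inE; apply/andP; split; first exact: ZZ'.
  by apply/eqP => se; move: Z's; rewrite se; apply/negP; exact: Z'i.
- by move=> j ji; apply: Z'i; exact: ltnW.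
Qed.

(** The sources that X_n has not consumed. X_0 is never among them, since every X_n is built from
    it. *)
Definition from_generation n : pred source := fun s =>
  match s with
  | None => false
  | Some (inl (n', _)) => (n <= n')%N
  | Some (inr n') => (n <= n')%N
  end.

(** On a cell the control function is read at the fixed argument [k] and the random sum has the
    fixed length [i], so both random indices disappear. *)
Definition cell n k i : set T := X n @^-1` [set k] `&` N n @^-1` [set i].

Lemma cellE n k i :
  cell n k i = X n @^-1` [set k] `&` Phi n k @^-1` [set i].
Proof. by apply/seteqP; split=> w [/= <- <-]. Qed.

Lemma decoupled_X n k : Dec (from_generation n) (X n @^-1` [set k]).
Proof.
elim: n k => [|n IH] k.
  rewrite -[X in Dec _ X]setTI.
  apply: (@decoupledW _ _ _ _ _ _ [pred s | true && (s != None)]).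
    by move=> [s|].
  apply: (decoupledI Gm (decoupledT Gind predT)) => //.
  exact: preimage_in_system.
apply: (decoupled_level Gm (Y := X n)) => k'.
apply: (decoupled_level Gm (Y := N n)) => i.
rewrite (_ : _ `&` _ =
    (X n @^-1` [set k'] `&` Phi n k' @^-1` [set i]) `&` S n i @^-1` [set k]).
  apply: (@decoupled_offspring_sum n i k [pred s | from_generation n s &&
    (s != control n)]).
  - apply: (decoupledI Gm (IH k')); [exact: leqnn|exact: source_control].
  - by move=> j _ /=; rewrite leqnn.
  - move=> [[[n' j]|n']|]//; rewrite !inE/=; first by move=> /ltnW ->.
    move=> nn'; rewrite (ltnW nn')/=; apply/eqP => -[nE].
    by move: (nn' : (n < n')%N); rewrite nE ltnn.
  - by move=> j _; exact: negbT (ltnn n).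
rewrite -cellE; apply/seteqP; split=> w.
  by move=> [[<- <-] <-].
by move=> [[<- <-] <-].
Qed.

Lemma decoupled_cell n k i :
  Dec [pred s | from_generation n s && (s != control n)] (cell n k i).
Proof.
rewrite cellE; apply: (decoupledI Gm (decoupled_X n k)); first exact: leqnn.
exact: source_control.
Qed.

Lemma measurable_X n : measurable_fun setT (X n).
Proof.
by apply: measurable_fun_level => k; exact: decoupled_measurable (decoupled_X n k).
Qed.

Lemma measurable_cell n k i : measurable (cell n k i).
Proof. exact: decoupled_measurable (decoupled_cell n k i). Qed.

Lemma measurable_N n : measurable_fun setT (N n).
Proof.
apply: measurable_fun_level => i.
rewrite -(bigcup_level (N n @^-1` [set i]) (X n)).
by apply: bigcup_measurable => k _; rewrite setIC; exact: measurable_cell.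
Qed.

Lemma measure_X_control n k B :
  (P (X n @^-1` [set k] `&` Phi n k @^-1` B) =
   P (X n @^-1` [set k]) * P (phi k @^-1` B))%E.
Proof.
rewrite -(control_law n k B).
apply: (decoupledM (decoupled_X n k) (i := control n)); first exact: leqnn.
exact: source_control.
Qed.

Lemma measure_cell_offspring n k i j B :
  (P (cell n k i `&` Xi n j @^-1` B) = P (cell n k i) * P (xi @^-1` B))%E.
Proof.
rewrite -(cbp_offspring_law model n j B).
apply: (decoupledM (decoupled_cell n k i) (i := offspring n j)); last first.
  exact: source_offspring.
by rewrite /= leqnn.
Qed.

Lemma integral_X_control n k (g : nat -> R) : (forall y, 0 <= g y) ->
  (\int[P]_(w in X n @^-1` [set k]) (g (N n w))%:E =
   P (X n @^-1` [set k]) * \int[P]_w (g (phi k w))%:E)%E.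
Proof.
move=> g0; rewrite -(integral_decoupled_rv (Y := Phi n k))//.
- by apply: eq_integral => w /set_mem /= <-.
- exact: measurable_level (measurable_X n).
- by move=> y; rewrite measure_X_control.
Qed.

(** No product measure is involved: splitting [A] along the value of the last factor makes that
    factor constant, and the induction hypothesis applies to each smaller piece, which is decoupled
    from one source fewer. *)
Lemma integral_offspring_prod n i (g : nat -> R) (c : R) (Z : pred source) A :
  (forall y, 0 <= g y) -> (\int[P]_w (g (xi w))%:E = c%:E)%E ->
  Dec Z A -> (forall j, (j < i)%N -> Z (offspring n j)) ->
  (\int[P]_(w in A) (\prod_(j < i) g (Xi n j w))%:E = P A * (c ^+ i)%:E)%E.
Proof.
move=> g0 gc.
have mprod i' : measurable_fun setT
    (fun w => (\prod_(j < i') g (Xi n j w))%:E : \bar R).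
  apply/measurable_EFinP; apply: measurable_prod => j _.
  exact: measurableT_comp.
have prod0 i' w : 0 <= \prod_(j < i') g (Xi n j w) by apply: prodr_ge0.
have c0 : 0 <= c by rewrite -lee_fin -gc; apply: integral_ge0 => w _; rewrite lee_fin.
elim: i Z A => [|i IH] Z A dA Zi.
  under eq_integral do rewrite big_ord0.
  by rewrite integral_cst ?mul1e ?expr0 ?mule1//; exact: decoupled_measurable dA.
have mA := decoupled_measurable dA.
have mAi y : measurable (A `&` Xi n i @^-1` [set y]).
  by apply: measurableI => //; exact: measurable_level.
rewrite (ge0_integral_level P mAi (mprod _)); last by move=> w; rewrite lee_fin.
(* The last factor is evaluated on its own with the law of [xi]; what remains is compared term by
   term over the values of [Xi n i]. *)
transitivity ((c ^+ i)%:E * \int[P]_(w in A) (g (Xi n i w))%:E)%E; last first.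
  rewrite (integral_decoupled_rv (Y' := xi))// ?gc.
    by rewrite muleCA -EFinM exprSr.
  move=> y; rewrite -(cbp_offspring_law model n i).
  by apply: (decoupledM dA (Zi _ (ltnSn i))); exact: source_offspring.
have mgi : measurable_fun setT (fun w => (g (Xi n i w))%:E : \bar R).
  by apply/measurable_EFinP; exact: measurableT_comp.
rewrite (ge0_integral_level P mAi mgi); last by move=> w; rewrite lee_fin.
rewrite -nneseriesZl; last first.
  by move=> y _; apply: integral_ge0 => w _; rewrite lee_fin.
apply: eq_eseriesr => y _.
transitivity (\int[P]_(w in A `&` Xi n i @^-1` [set y])
    ((g y)%:E * (\prod_(j < i) g (Xi n j w))%:E))%E.
  apply: eq_integral => w /set_mem[_ /= <-].
  by rewrite -EFinM big_ord_recr/= mulrC.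
rewrite ge0_integralZl//; last 3 first.
- exact: measurable_funTS (mprod i).
- by move=> w _; rewrite lee_fin.
- by rewrite lee_fin.
rewrite (IH [pred s | Z s && (s != offspring n i)]); first last.
- move=> j ji /=; rewrite Zi ?(ltnW ji)//=; last exact: ltnW.
  by apply/eqP => -[ji']; move: ji; rewrite ji' ltnn.
- apply: (decoupledI Gm dA (Zi _ (ltnSn i))); exact: source_offspring.
transitivity ((c ^+ i)%:E * ((g y)%:E * P (A `&` Xi n i @^-1` [set y])))%E.
  by rewrite muleA muleC.
congr mule; rewrite -integral_cst//.
by apply: eq_integral => w /set_mem[_ /= <-].
Qed.

Lemma integral_cell_prod n k i (g : nat -> R) (c : R) :
  (forall y, 0 <= g y) -> (\int[P]_w (g (xi w))%:E = c%:E)%E ->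
  (\int[P]_(w in cell n k i) (\prod_(j < i) g (Xi n j w))%:E =
   P (cell n k i) * (c ^+ i)%:E)%E.
Proof.
move=> g0 gc; apply: integral_offspring_prod (decoupled_cell n k i) _ => //.
by move=> j _ /=; rewrite leqnn.
Qed.

(** [pickle] codes the pair (X_n, N_n) as one natural number, which reduces the partition into cells
    to the levels of a single variable. *)
Lemma ge0_le_integral_cell n (f g : T -> \bar R) :
  measurable_fun setT f -> measurable_fun setT g ->
  (forall w, (0 <= f w)%E) -> (forall w, (0 <= g w)%E) ->
  (forall k i, (\int[P]_(w in cell n k i) f w <=
                \int[P]_(w in cell n k i) g w)%E) ->
  (\int[P]_w f w <= \int[P]_w g w)%E.
Proof.
move=> mf mg f0 g0 fg.
have zE w0 : (fun w => pickle (X n w, N n w)) @^-1` [set pickle (X n w0, N n w0)]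
    = cell n (X n w0) (N n w0).
  apply/seteqP; split=> w /=; last by move=> [/= -> ->].
  by move=> /(pcan_inj pickleK)[Xw Nw]; split.
apply: (@ge0_le_integral_level _ _ _ _ (fun w => pickle (X n w, N n w))) => //.
  apply: measurable_fun_level => z.
  have [[w0 <-]|nz] := pselect (exists w, pickle (X n w, N n w) = z).
    by rewrite zE; exact: measurable_cell.
  rewrite (_ : _ @^-1` _ = set0)//.
  by apply/seteqP; split=> // w zw; case: nz; exists w.
by move=> w0; rewrite zE.
Qed.

End Process.

(** * Real powers *)

Section PowR.
Context {R : realType}.
Implicit Types (x y r : R).

Lemma powRV x r : 0 <= x -> (x^-1) `^ r = (x `^ r)^-1.
Proof.
rewrite le_eqVlt => /predU1P[<-|x0].
  have [->|r0] := eqVneq r 0; first by rewrite !powRr0 invr1.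
  by rewrite invr0 powR0// invr0.
apply: (mulIf (lt0r_neq0 (powR_gt0 r x0))).
rewrite -powRM ?invr_ge0 ?ltW// mulVf ?lt0r_neq0// powR1 mulVf//.
by rewrite lt0r_neq0// powR_gt0.
Qed.

Lemma powR_div x y r : 0 <= x -> 0 <= y -> (x / y) `^ r = x `^ r / y `^ r.
Proof. by move=> x0 y0; rewrite powRM ?invr_ge0// powRV. Qed.

Lemma le_powR2 x y r : 0 <= r -> 0 <= x -> x <= y -> x `^ r <= y `^ r.
Proof.
move=> r0 x0 xy; apply: ge0_ler_powR => //; rewrite nnegrE//.
exact: le_trans xy.
Qed.

Lemma le_powRN2 x y r : 0 <= r -> 0 < x -> x <= y -> y `^ (- r) <= x `^ (- r).
Proof.
move=> r0 x0 xy; rewrite !powRN lef_pV2 ?posrE ?powR_gt0//.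
  by apply: le_powR2 => //; exact: ltW.
exact: lt_le_trans xy.
Qed.

Lemma powR_le1 x r : 1 <= x -> 0 <= r -> x `^ (- r) <= 1.
Proof.
by move=> x1 r0; have := le_powRN2 r0 ltr01 x1; rewrite powR1.
Qed.

Lemma powRD_gt0 x r s : 0 < x -> x `^ (r + s) = x `^ r * x `^ s.
Proof. by move=> x0; rewrite powRD// (lt0r_neq0 x0) implybT. Qed.

End PowR.

(** * Real-valued means and integrability *)

Section Mean.
Context {R : realType} {d : measure_display} {T : measurableType d}.
Variable P : probability T R.
Implicit Types (f g : T -> R).

Definition mean f : R := fine ('E_P[f])%E.
Definition L1 f : Prop := P.-integrable setT (EFin \o f).

Lemma meanE f : L1 f -> ('E_P[f] = (mean f)%:E)%E.
Proof.
move=> f1; rewrite /mean fineK//.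
by rewrite expectation.unlock; exact: integrable_fin_num.
Qed.

Lemma mean_Rintegral f : mean f = \int[P]_w f w.
Proof. by rewrite /mean expectation.unlock. Qed.

Lemma L1_bounded f M : measurable_fun setT f -> (forall w, `|f w| <= M) -> L1 f.
Proof.
move=> mf fM; apply: measurable_bounded_integrable => //.
  by rewrite (le_lt_trans (probability_le1 P _))// ltry.
by exists M; split; [exact: num_real|move=> x Mx w _; exact: le_trans (fM w) (ltW Mx)].
Qed.

Lemma L1D f g : L1 f -> L1 g -> L1 (f \+ g).
Proof. by move=> f1 g1; exact: (integrableD measurableT f1 g1). Qed.

Lemma L1Z (c : R) f : L1 f -> L1 (fun w => c * f w).
Proof. by move=> f1; exact: (integrableZl measurableT c f1). Qed.

Lemma L1_cst (c : R) : L1 (fun=> c).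
Proof. exact: (@L1_bounded _ `|c|). Qed.

Lemma L1_sum (I : Type) (s : seq I) (F : I -> T -> R) :
  (forall i, L1 (F i)) -> L1 (fun w => \sum_(i <- s) F i w).
Proof.
move=> F1; elim: s => [|i s IH].
  by under [X in L1 X]eq_fun do rewrite big_nil; exact: L1_cst.
by under [X in L1 X]eq_fun do rewrite big_cons; exact: L1D.
Qed.

Lemma meanD f g : L1 f -> L1 g -> mean (fun w => f w + g w) = mean f + mean g.
Proof. by move=> f1 g1; rewrite !mean_Rintegral RintegralD. Qed.

Lemma meanZ (c : R) f : L1 f -> mean (fun w => c * f w) = c * mean f.
Proof. by move=> f1; rewrite !mean_Rintegral RintegralZl. Qed.

Lemma mean_cst (c : R) : mean (fun=> c) = c.
Proof. by rewrite /mean (expectation_cst P). Qed.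

Lemma le_mean f g : L1 f -> L1 g -> (forall w, f w <= g w) -> mean f <= mean g.
Proof. by move=> f1 g1 fg; rewrite !mean_Rintegral; exact: le_Rintegral. Qed.

Lemma mean_sum (I : Type) (s : seq I) (F : I -> T -> R) :
  (forall i, L1 (F i)) ->
  mean (fun w => \sum_(i <- s) F i w) = \sum_(i <- s) mean (F i).
Proof.
move=> F1; elim: s => [|i s IH].
  under [X in mean X]eq_fun do rewrite big_nil.
  by rewrite big_nil mean_cst.
under [X in mean X]eq_fun do rewrite big_cons.
by rewrite meanD ?big_cons ?IH//; exact: L1_sum.
Qed.

Lemma L1_nat (Y : T -> nat) (g : nat -> R) M : measurable_fun setT Y ->
  (forall k, `|g k| <= M) -> L1 (fun w => g (Y w)).
Proof.
move=> mY gM; apply: (@L1_bounded _ M) => //.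
exact: (measurableT_comp (f := g)).
Qed.

Lemma L1_indic (Y : T -> nat) (p : pred nat) : measurable_fun setT Y ->
  L1 (fun w => (p (Y w))%:R).
Proof.
move=> mY; apply: (@L1_nat _ (fun k => (p k)%:R) 1) => // k.
by case: (p k); rewrite ?normr1// normr0.
Qed.

Lemma L1_pgf (Y : T -> nat) s : measurable_fun setT Y -> 0 <= s <= 1 ->
  L1 (fun w => s ^+ Y w).
Proof.
move=> mY /andP[s0 s1]; apply: (@L1_nat _ (fun k => s ^+ k) 1) => // k.
by rewrite ger0_norm ?exprn_ge0// exprn_ile1.
Qed.

Lemma L1_hm (Y : T -> nat) r : 0 < r -> measurable_fun setT Y ->
  L1 (fun w => (Y w)%:R `^ (- r) * (0 < Y w)%N%:R).
Proof.
move=> r0 mY.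
apply: (@L1_nat _ (fun k => k%:R `^ (- r) * (0 < k)%N%:R) 1) => // -[|k].
  by rewrite mulr0 normr0.
by rewrite mulr1 ger0_norm ?powR_ge0// powR_le1 ?ler1n// ltW.
Qed.

Lemma harmonic_momentE (Y : T -> nat) r : 0 < r -> measurable_fun setT Y ->
  harmonic_moment P r Y =
  (mean (fun w => (Y w)%:R `^ (- r) * (0 < Y w)%N%:R))%:E.
Proof.
move=> r0 mY; rewrite /harmonic_moment -meanE; last exact: L1_hm.
congr ('E_P[ _ ])%E; apply/funext => w; congr (_ * _).
rewrite indicE; have [Y0|Y0] := boolP (0 < Y w)%N; first by rewrite mem_set.
by rewrite memNset//=; exact/negP.
Qed.

End Mean.

(** * Harmonic moments from Laplace transforms *)

Section HarmonicMoments.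
Context {R : realType} {d : measure_display} {T : measurableType d}.
Variables (P : probability T R) (sigma : R) (Y : nat -> T -> nat).
Hypothesis sigma0 : 0 < sigma.
Hypothesis mY : forall n, measurable_fun setT (Y n).

(** The constants depend on neither [n] nor [t], so [t] can be adapted to any scale. The lower bound
    needs 1 + n t: the transform is at most 1, whereas (n t)^(-sigma) is unbounded as n t tends to
    0. *)
Definition laplace_bounds : Prop := exists t0 c C : R,
  [/\ 0 < t0 <= 1, 0 < c, 0 < C & forall n t, (0 < n)%N -> 0 < t <= t0 ->
    c * (1 + n%:R * t) `^ (- sigma) <= pgf_of P (Y n) (expR (- t))
      <= C * (n%:R * t) `^ (- sigma)].

Definition tail_bound (C : R) : Prop := forall n K, (0 < n)%N -> (0 < K)%N ->
  mean P (fun w => (Y n w <= K)%N%:R) <= C * (K%:R / n%:R) `^ sigma.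

(** [D] keeps the scale [K] a fixed factor below [n], and [K0] keeps the corresponding [t] in the
    range of the Laplace bounds. The constant 1 on the left is reached by enlarging [B] and [D]. *)
Definition window_bound (B D K0 : nat) : Prop := forall n K, (K0 <= K)%N ->
  (D * K <= n)%N ->
  (K%:R / n%:R) `^ sigma <= mean P (fun w => (K < Y n w <= B * K)%N%:R).

Lemma expR_range (t : R) : 0 <= t -> 0 <= expR (- t) <= 1.
Proof. by move=> t0; rewrite expR_ge0 -expR0 ler_expR oppr_le0. Qed.

(** Markov's inequality for exp(- t Y_n) at t = 1/(K0 K): on Y_n <= K the exponent t Y_n is at most
    1, and [K0] makes t admissible for every K >= 1. *)
Lemma laplace_tail : laplace_bounds -> exists2 C, 0 < C & tail_bound C.
Proof.
move=> [t0 [c [C [/andP[t00 t01] c0 C0 H]]]].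
pose K0 := Num.bound t0^-1.
have K0t : t0^-1 < K0%:R by apply: archi_boundP; rewrite invr_ge0 ltW.
have K0_gt0 : 0 < K0%:R :> R by rewrite (lt_trans _ K0t)// invr_gt0.
exists (expR 1 * C * K0%:R `^ sigma).
  by rewrite !mulr_gt0 ?expR_gt0 ?powR_gt0.
move=> n K n0 K_gt0.
have nR : 0 < n%:R :> R by rewrite ltr0n.
have KR : 0 < K%:R :> R by rewrite ltr0n.
have KR1 : 1 <= K%:R :> R by rewrite ler1n.
pose t : R := (K0%:R * K%:R)^-1.
have t_gt0 : 0 < t by rewrite invr_gt0 mulr_gt0.
have tt0 : t <= t0.
  rewrite -[leRHS]invrK lef_pV2 ?posrE ?invr_gt0 ?mulr_gt0//.
  by rewrite (le_trans (ltW K0t))// ler_peMr// ltW.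
have [_ Lt] := andP (H n t n0 (introT andP (conj t_gt0 tt0))).
have tr := expR_range (ltW t_gt0).
apply: (@le_trans _ _ (expR 1 * pgf_of P (Y n) (expR (- t)))).
  rewrite [X in _ <= _ * X]/pgf_of -/(mean P _) -meanZ; last exact: L1_pgf.
  apply: le_mean.
  - exact: (@L1_indic _ _ _ P (Y n) (fun k => (k <= K)%N)).
  - by apply: L1Z; exact: L1_pgf.
  - move=> w; have [YK|_] := leqP (Y n w) K; last first.
      by rewrite mulr_ge0 ?exprn_ge0 ?expR_ge0.
    rewrite -expRM_natl -expRD -[leLHS]expR0 ler_expR mulrN subr_ge0.
    rewrite /t ler_pdivrMr ?mulr_gt0// mul1r.
    have YK' : (Y n w)%:R <= K%:R :> R by rewrite ler_nat.
    rewrite (le_trans YK')//; apply: ler_peMl; first exact: ltW.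
    by rewrite ler1n -(ltr0n R).
rewrite -!mulrA ler_pM2l ?expR_gt0// (le_trans Lt)//.
rewrite ler_pM2l// -powRM ?divr_ge0// powRN -powRV; last first.
  by rewrite mulr_ge0// ltW.
by rewrite /t invfM invrK mulrC mulrA.
Qed.

(** Write q = (K/n)^sigma. At t = 1/(aK) the lower Laplace bound supplies (C1 + 2) q. The part Y_n
    <= K takes at most C1 q, the part Y_n > BK at most q, and at least q is left for the window. *)
Lemma laplace_window (C1 : R) : 0 < C1 -> laplace_bounds -> tail_bound C1 ->
  exists B D K0, [/\ (1 < B)%N, (0 < D)%N, (0 < K0)%N & window_bound B D K0].
Proof.
move=> C10 [t0 [c [C [/andP[t00 t01] c0 C0 H]]]] tail.
(* Chosen so that c (a/2)^sigma >= C1 + 2; the half comes from 1 + n t <= 2 n t, valid since a K <=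
   n. *)
pose a := (Num.bound (2 * ((C1 + 2) / c) `^ sigma^-1)).+1.
have aR : 0 < a%:R :> R by rewrite ltr0n.
have ca : C1 + 2 <= c * (a%:R / 2) `^ sigma.
  rewrite mulrC -ler_pdivrMr//.
  have q0 : 0 <= (C1 + 2) / c by rewrite divr_ge0 ?addr_ge0 ?ltW.
  have -> : (C1 + 2) / c = (((C1 + 2) / c) `^ sigma^-1) `^ sigma.
    by rewrite -powRrM mulVf ?powRr1// lt0r_neq0.
  apply: le_powR2; [exact: ltW|exact: powR_ge0|].
  rewrite ler_pdivlMr// mulrC; apply: ltW.
  rewrite (lt_trans (archi_boundP _))//; first by rewrite mulr_ge0 ?powR_ge0.
  by rewrite ltr_nat.
(* The transform at t/2 is at most [M] q. Beyond BK one has exp(- t Y) <= exp(- B/(2a)) exp(- t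
   Y/2), so a large [B] beats [M]. *)
pose M : R := C * (2 * a%:R) `^ sigma.
have M0 : 0 < M by rewrite mulr_gt0// powR_gt0// mulr_gt0.
pose B := (Num.bound (2 * a%:R * M)).+2.
have MB : expR (- (B%:R / (2 * a%:R))) * M <= 1.
  rewrite expRN mulrC ler_pdivrMr ?expR_gt0// mul1r.
  rewrite (le_trans _ (expR_ge1Dx _))// (@le_trans _ _ (B%:R / (2 * a%:R)))//.
    rewrite ler_pdivlMr ?mulr_gt0// mulrC; apply: ltW.
    rewrite (lt_trans (archi_boundP _))//; first by rewrite !mulr_ge0// ltW.
    by rewrite ltr_nat leqW.
  by rewrite lerDr.
pose K0 := (Num.bound t0^-1).+1.
have K0t : t0^-1 < K0%:R.
  rewrite (lt_trans (archi_boundP _))//; first by rewrite invr_ge0 ltW.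
  by rewrite ltr_nat.
exists B, a, K0; split=> // n K K0K aKn.
have K_gt0 : (0 < K)%N by exact: leq_trans K0K.
have KR : 0 < K%:R :> R by rewrite ltr0n.
have n_gt0 : (0 < n)%N by rewrite (leq_trans _ aKn)// muln_gt0.
have nR : 0 < n%:R :> R by rewrite ltr0n.
pose t : R := (a%:R * K%:R)^-1.
have t_gt0 : 0 < t by rewrite invr_gt0 mulr_gt0.
have tt0 : t <= t0.
  rewrite -[leRHS]invrK lef_pV2 ?posrE ?invr_gt0 ?mulr_gt0//.
  rewrite (le_trans (ltW K0t))// (@le_trans _ _ K%:R) ?ler_nat//.
  by apply: ler_peMl; [exact: ltW|rewrite ler1n].
have nt1 : 1 <= n%:R * t.
  by rewrite /t ler_pdivlMr ?mulr_gt0// mul1r -natrM ler_nat.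
set q := (K%:R / n%:R) `^ sigma.
have q0 : 0 < q by rewrite powR_gt0// divr_gt0.
have lowL : c * (a%:R / 2) `^ sigma * q <= pgf_of P (Y n) (expR (- t)).
  have /andP[Lt _] := H n t n_gt0 (introT andP (conj t_gt0 tt0)).
  apply: le_trans Lt; rewrite -mulrA ler_pM2l//.
  rewrite -powRM ?divr_ge0//.
  rewrite -[X in X `^ _]invrK powRV ?invr_ge0 ?mulr_ge0 ?divr_ge0// -powRN.
  apply: le_powRN2; [exact: ltW|by rewrite addr_gt0// mulr_gt0|].
  rewrite (_ : _^-1 = 2 * (n%:R * t)); last first.
    by rewrite /t; field; rewrite !lt0r_neq0.
  by move: nt1; set z := n%:R * t; lra.
have t2r : 0 < t / 2 <= t0.
  by rewrite divr_gt0//= (le_trans _ tt0)// ler_pdivrMr// ler_peMr ?ler1n// ltW.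
have uppL : pgf_of P (Y n) (expR (- (t / 2))) <= M * q.
  have /andP[_ Lt] := H n (t / 2) n_gt0 t2r.
  apply: le_trans Lt _; rewrite -mulrA ler_pM2l//.
  rewrite -powRM ?divr_ge0 ?mulr_ge0// powRN -powRV; last first.
    by rewrite !mulr_ge0 ?invr_ge0// ltW.
  rewrite (_ : _^-1 = 2 * a%:R * (K%:R / n%:R))//.
  by rewrite /t; field; rewrite !lt0r_neq0.
pose W := mean P (fun w => (K < Y n w <= B * K)%N%:R).
have split3 : pgf_of P (Y n) (expR (- t)) <= C1 * q + W + q.
  have tr := expR_range (ltW t_gt0).
  have t2r' : 0 <= expR (- (t / 2)) <= 1 by apply: expR_range; rewrite divr_ge0 ?ltW.
  have L1t2 : L1 P (fun w => expR (- (t / 2)) ^+ Y n w) by exact: L1_pgf.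
  have L1Y (p : pred nat) : L1 P (fun w => (p (Y n w))%:R) by exact: L1_indic.
  apply: (@le_trans _ _ (mean P (fun w => (Y n w <= K)%N%:R +
     (K < Y n w <= B * K)%N%:R +
     expR (- (B%:R / (2 * a%:R))) * expR (- (t / 2)) ^+ Y n w))).
    apply: le_mean; first exact: L1_pgf.
      apply: L1D; last exact: L1Z.
      apply: L1D; first exact: (L1Y (fun k => (k <= K)%N)).
      exact: (L1Y (fun k => (K < k <= B * K)%N)).
    move=> w; have E0 : 0 <= expR (- (B%:R / (2 * a%:R))) * expR (- (t / 2)) ^+ Y n w.
      by rewrite mulr_ge0 ?exprn_ge0 ?expR_ge0.
    have [YK|KY] := leqP (Y n w) K.
      rewrite addr0 (@le_trans _ _ 1) ?exprn_ile1 ?expR_ge0//.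
        by case/andP: tr.
      by rewrite lerDl.
    have [YBK|BKY] /= := leqP (Y n w) (B * K).
      rewrite add0r (@le_trans _ _ 1) ?exprn_ile1 ?expR_ge0//.
        by case/andP: tr.
      by rewrite lerDl.
    rewrite !add0r -!expRM_natl -expRD ler_expR.
    have BKY' : B%:R * K%:R <= (Y n w)%:R :> R by rewrite -natrM ler_nat ltnW.
    rewrite (_ : B%:R / (2 * a%:R) = (B%:R * K%:R) * (t / 2)); last first.
      by rewrite /t; field; rewrite !lt0r_neq0.
    have : (B%:R * K%:R) * (t / 2) <= (Y n w)%:R * (t / 2).
      by apply: ler_wpM2r => //; rewrite divr_ge0// ltW.
    by lra.
  have tailK : mean P (fun w => (Y n w <= K)%N%:R) <= C1 * q by exact: tail.
  have M1 : expR (- (B%:R / (2 * a%:R))) *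
      pgf_of P (Y n) (expR (- (t / 2))) <= q.
    apply: (@le_trans _ _ (expR (- (B%:R / (2 * a%:R))) * (M * q))).
      by rewrite ler_pM2l ?expR_gt0.
    by rewrite mulrA ler_piMl// ltW.
  rewrite !meanD//; last 4 first.
  - exact: (L1Y (fun k => (k <= K)%N)).
  - exact: (L1Y (fun k => (K < k <= B * K)%N)).
  - apply: L1D; first exact: (L1Y (fun k => (k <= K)%N)).
    exact: (L1Y (fun k => (K < k <= B * K)%N)).
  - exact: L1Z.
  rewrite meanZ//.
  exact: lerD (lerD tailK (lexx _)) M1.
have : (C1 + 2) * q <= C1 * q + W + q.
  apply: le_trans split3; apply: le_trans lowL.
  by rewrite ler_pM2r.
by rewrite -/W; lra.
Qed.

Local Notation hm r n :=
  (mean P (fun w => (Y n w)%:R `^ (- r) * (0 < Y n w)%N%:R)).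

(** The indicators are those of k <= 2^(i+1) and not of dyadic shells: the overcounting costs only a
    constant, and the tail bound applies to each term directly. *)
Lemma hm_dyadic_le (r : R) (k M : nat) : 0 < r ->
  k%:R `^ (- r) * (0 < k)%N%:R <=
  \sum_(i < M) (2 ^ i)%N%:R `^ (- r) * (k <= 2 ^ i.+1)%N%:R +
  (2 ^ M)%N%:R `^ (- r) :> R.
Proof.
move=> r0; elim: M => [|M IH].
  rewrite big_ord0 add0r expn0 powR1; case: k => [|k]; first by rewrite mulr0.
  by rewrite mulr1; apply: powR_le1; [rewrite ler1n|exact: ltW].
rewrite big_ord_recr /=; have [kM|Mk] := leqP k (2 ^ M.+1).
  by rewrite mulr1 (le_trans IH)// lerDl powR_ge0.
rewrite mulr0 addr0; have k0 : (0 < k)%N by rewrite (leq_trans _ Mk).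
rewrite k0 mulr1 (@le_trans _ _ ((2 ^ M.+1)%N%:R `^ (- r)))//.
  by apply: le_powRN2; [exact: ltW|rewrite ltr0n expn_gt0|rewrite ler_nat ltnW].
by rewrite lerDr sumr_ge0// => i _; rewrite mulr_ge0 ?powR_ge0.
Qed.

Lemma powR_exprn (x r : R) i : 0 <= x -> (x ^+ i) `^ r = (x `^ r) ^+ i.
Proof.
move=> x0; rewrite -powR_mulrn// -powRrM mulrC powRrM powR_mulrn//.
exact: powR_ge0.
Qed.

Lemma hm_upper (C r : R) : 0 < C -> tail_bound C -> 0 < r ->
  exists2 C', 0 < C' & \forall n \near \oo, hm r n <= C' * b_cr sigma r n.
Proof.
move=> C0 tail r0.
(* Scale 2^i contributes (2^i)^(-r) (2^i/n)^sigma up to a constant, that is, n^(-sigma) times the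
   i-th power of this ratio. *)
pose rho : R := 2 `^ (sigma - r).
have rho0 : 0 < rho by rewrite powR_gt0.
pose A : R := C * 2 `^ sigma.
have A0 : 0 < A by rewrite mulr_gt0// powR_gt0.
have two_r0 : 0 < 2 `^ r :> R by rewrite powR_gt0.
have main n : (0 < n)%N -> hm r n <=
    A * n%:R `^ (- sigma) * (\sum_(i < trunc_log 2 n) rho ^+ i) +
    2 `^ r * n%:R `^ (- r).
  move=> n0; set M := trunc_log 2 n.
  have nR : 0 < n%:R :> R by rewrite ltr0n.
  have L1Y (p : pred nat) : L1 P (fun w => (p (Y n w))%:R) by exact: L1_indic.
  have L1i i : L1 P (fun w => (2 ^ i)%N%:R `^ (- r) * (Y n w <= 2 ^ i.+1)%N%:R).
    exact: (L1Z _ (L1Y (fun k => (k <= 2 ^ i.+1)%N))).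
  apply: (@le_trans _ _ (mean P (fun w =>
      \sum_(i < M) (2 ^ i)%N%:R `^ (- r) * (Y n w <= 2 ^ i.+1)%N%:R +
      (2 ^ M)%N%:R `^ (- r)))).
    apply: le_mean; first exact: L1_hm.
      by apply: L1D; [apply: L1_sum => i; exact: L1i|exact: L1_cst].
    by move=> w; exact: hm_dyadic_le.
  rewrite meanD; [|by apply: L1_sum => i; exact: L1i|exact: L1_cst].
  rewrite mean_cst; apply: lerD; last first.
    rewrite (_ : 2 `^ r * _ = (n%:R / 2) `^ (- r)); last first.
      by rewrite powR_div// [2 `^ (- r)]powRN invrK mulrC.
    apply: le_powRN2; [exact: ltW|by rewrite divr_gt0|].
    rewrite ler_pdivrMr// -natrM ler_nat mulnC -expnS ltnW//.
    exact: trunc_log_ltn.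
  rewrite mean_sum// mulr_sumr; apply: ler_sum => i _.
  rewrite meanZ; last exact: (L1Y (fun k => (k <= 2 ^ i.+1)%N)).
  apply: (@le_trans _ _ ((2 ^ i)%N%:R `^ (- r) *
      (C * ((2 ^ i.+1)%N%:R / n%:R) `^ sigma))).
    by rewrite ler_wpM2l ?powR_ge0// tail// expn_gt0.
  rewrite powR_div// expnS natrM powRM// natrX !powR_exprn//.
  rewrite powRN exprVn /A /rho powRD_gt0// !powRN exprMn exprVn.
  by rewrite le_eqVlt; apply/orP; left; apply/eqP; ring.
have near1 : \forall n \near \oo, (1 < n)%N by exists 2%N.
have powR1_ (x : R) : 1 `^ x = 1 :> R by rewrite powR1.
(* If rho < 1 the geometric series converges; if rho > 1 its last term dominates, and 2^M <= n for M
   = [trunc_log 2 n] gives rho^M <= n^(sigma - r); if rho = 1 the sum is the number M of scales. *)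
have [sr|rs|sr] := ltgtP sigma r.
- have rho1 : rho < 1.
    rewrite /rho -opprB powRN invf_lt1 ?powR_gt0// -[ltLHS](powR1_ (r - sigma)).
    by apply: gt0_ltr_powR; rewrite ?nnegrE ?subr_gt0 ?ltr1n.
  exists (A / (1 - rho) + 2 `^ r).
    by rewrite addr_gt0// divr_gt0// subr_gt0.
  near=> n; have n1 : (1 < n)%N by near: n.
  have n0 : (0 < n)%N by exact: ltnW.
  rewrite /b_cr sr (le_trans (main n n0))// mulrDl; apply: lerD.
    rewrite [leRHS](_ : _ = A * n%:R `^ (- sigma) * (1 - rho)^-1); last by ring.
    rewrite ler_pM2l ?mulr_gt0 ?powR_gt0 ?ltr0n// -[leRHS]mul1r ler_pdivlMr ?subr_gt0//.
    have := subrX1 rho (trunc_log 2 n).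
    have : 0 < rho ^+ trunc_log 2 n by rewrite exprn_gt0.
    set u := _ ^+ _; set S := \sum_(i < _) _; nra.
  rewrite ler_pM2l//; apply: ler_powR; first by rewrite ler1n.
  by rewrite lerN2 ltW.
- have rho1 : 1 < rho.
    rewrite /rho -[ltLHS](powR1_ (sigma - r)).
    by apply: gt0_ltr_powR; rewrite ?nnegrE ?subr_gt0 ?ltr1n.
  exists (A / (rho - 1) + 2 `^ r).
    by rewrite addr_gt0// divr_gt0// subr_gt0.
  near=> n; have n1 : (1 < n)%N by near: n.
  have n0 : (0 < n)%N by exact: ltnW.
  have nR : 0 < n%:R :> R by rewrite ltr0n.
  rewrite /b_cr ltNge (ltW rs) /= (lt_eqF rs) (le_trans (main n n0))// mulrDl.
  apply: lerD => //.
  rewrite (_ : - r = - sigma + (sigma - r)); last by ring.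
  rewrite powRD_gt0// [X in _ <= X](_ : _ =
    A * n%:R `^ (- sigma) * (n%:R `^ (sigma - r) / (rho - 1))); last by ring.
  rewrite ler_pM2l ?mulr_gt0 ?powR_gt0// ler_pdivlMr ?subr_gt0//.
  apply: (@le_trans _ _ (rho ^+ trunc_log 2 n)).
    have := subrX1 rho (trunc_log 2 n); set u := _ ^+ _.
    by set S := \sum_(i < _) _; lra.
  rewrite /rho -powR_exprn// -natrX; apply: le_powR2 => //.
    by rewrite subr_ge0 ltW.
  by rewrite ler_nat trunc_logP.
- have ln2 : 0 < ln 2 :> R by rewrite ln_gt0// ltr1n.
  exists ((A + 2 `^ r) / ln 2).
    by rewrite divr_gt0// addr_gt0.
  near=> n; have n1 : (1 < n)%N by near: n.
  have n0 : (0 < n)%N by exact: ltnW.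
  have nR : 0 < n%:R :> R by rewrite ltr0n.
  rewrite /b_cr sr ltxx eqxx (le_trans (main n n0))// sr.
  have lnn : ln 2 <= ln n%:R :> R by rewrite ler_ln ?posrE// ler_nat.
  have -> : \sum_(i < trunc_log 2 n) rho ^+ i = (trunc_log 2 n)%:R.
    rewrite (eq_bigr (fun=> 1)) ?sumr_const ?card_ord// => i _.
    by rewrite /rho ?sr subrr powRr0 expr1n.
  have lnM : (trunc_log 2 n)%:R * ln 2 <= ln n%:R :> R.
    rewrite mulr_natl -lnXn// ler_ln ?posrE ?exprn_gt0//.
    by rewrite -natrX ler_nat trunc_logP.
  rewrite [leRHS](_ : _ = (A + 2 `^ r) * ln n%:R * n%:R `^ (- r) / ln 2); last by ring.
  rewrite mulrAC -mulrDl ler_pdivlMr// mulrAC ler_pM2r ?powR_gt0//.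
  rewrite !mulrDl -mulrA; apply: lerD; first by rewrite ler_pM2l.
  by rewrite ler_pM2l.
Unshelve. all: by end_near.
Qed.

Lemma window_hm (B D K0 : nat) (r : R) n K : 0 < r -> (1 < B)%N -> (0 < K0)%N ->
  window_bound B D K0 -> (K0 <= K)%N -> (D * K <= n)%N ->
  (B * K)%N%:R `^ (- r) * (K%:R / n%:R) `^ sigma <= hm r n.
Proof.
move=> r0 B1 K0_gt0 win K0K DKn.
have K_gt0 : (0 < K)%N by exact: leq_trans K0K.
have L1w : L1 P (fun w => (K < Y n w <= B * K)%N%:R).
  exact: (@L1_indic _ _ _ P (Y n) (fun k => (K < k <= B * K)%N)).
apply: (@le_trans _ _ ((B * K)%N%:R `^ (- r) *
    mean P (fun w => (K < Y n w <= B * K)%N%:R))).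
  by rewrite ler_wpM2l ?powR_ge0// win.
rewrite -meanZ//; apply: le_mean; [exact: L1Z|exact: L1_hm|move=> w].
have [/andP[KY YBK]|_] := boolP (K < Y n w <= B * K)%N; last first.
  by rewrite mulr0 mulr_ge0 ?powR_ge0.
have Y0 : (0 < Y n w)%N by exact: leq_ltn_trans KY.
rewrite Y0 !mulr1; apply: le_powRN2; [exact: ltW|by rewrite ltr0n|].
by rewrite ler_nat.
Qed.

(** The windows are disjoint, so at most one term is nonzero. The cutoff at [B ^ M * K0] on the
    right carries this disjointness through the induction. *)
Lemma hm_windows_le (B K0 M k : nat) (r : R) : 0 < r -> (0 < B)%N -> (0 < K0)%N ->
  \sum_(i < M) (B ^ i.+1 * K0)%N%:R `^ (- r) *
    (B ^ i * K0 < k <= B ^ i.+1 * K0)%N%:R <=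
  k%:R `^ (- r) * (0 < k <= B ^ M * K0)%N%:R :> R.
Proof.
move=> r0 B0 K0_gt0; elim: M => [|M IH].
  by rewrite big_ord0 mulr_ge0 ?powR_ge0.
rewrite big_ord_recr/= (le_trans (lerD IH (lexx _)))//.
have BM : (B ^ M * K0 <= B ^ M.+1 * K0)%N by rewrite leq_mul2r leq_pexp2l ?orbT.
have [kM|Mk] /= := leqP k (B ^ M * K0).
  by rewrite andbT mulr0 addr0 (leq_trans kM BM) andbT.
have k0 : (0 < k)%N by exact: leq_ltn_trans Mk.
rewrite k0 mulr0 add0r /=; have [kM1|] := leqP k (B ^ M.+1 * K0); last first.
  by rewrite !mulr0.
rewrite !mulr1; apply: le_powRN2; [exact: ltW|by rewrite ltr0n|].
by rewrite ler_nat.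
Qed.

(** For r > sigma the fixed window at [K0] has the right order; for r < sigma the largest window, at
    K = n/D, has it; for r = sigma all geometric windows in between contribute equally and their
    number gives the logarithm. *)
Lemma hm_lower (B D K0 : nat) (r : R) : (1 < B)%N -> (0 < D)%N -> (0 < K0)%N ->
  window_bound B D K0 -> 0 < r ->
  exists2 c, 0 < c & \forall n \near \oo, c * b_cr sigma r n <= hm r n.
Proof.
move=> B1 D0 K0_gt0 win r0.
have B0 : (0 < B)%N by exact: ltnW.
have BR : 0 < B%:R :> R by rewrite ltr0n.
have DR : 0 < D%:R :> R by rewrite ltr0n.
have K0R : 0 < K0%:R :> R by rewrite ltr0n.
have [sr|rs|sr] := ltgtP sigma r.
- exists ((B * K0)%N%:R `^ (- r) * K0%:R `^ sigma).
    by rewrite mulr_gt0// powR_gt0// ltr0n muln_gt0 B0.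
  exists (D * K0)%N => // n /= DKn.
  rewrite /b_cr sr; apply: le_trans (window_hm r0 B1 K0_gt0 win (leqnn _) DKn).
  by rewrite powR_div// [n%:R `^ (- sigma)]powRN mulrA.
- exists (B%:R `^ (- r) * ((2 * D%:R)^-1) `^ sigma).
    by rewrite mulr_gt0// powR_gt0// invr_gt0 mulr_gt0.
  exists (D * K0)%N => // n /= DKn.
  have n0 : (0 < n)%N by rewrite (leq_trans _ DKn)// muln_gt0 D0.
  have nR : 0 < n%:R :> R by rewrite ltr0n.
  pose K := (n %/ D)%N.
  have K0K : (K0 <= K)%N by rewrite leq_divRL// mulnC.
  have DK : (D * K <= n)%N by rewrite mulnC leq_divM.
  have nDK : (n <= 2 * D * K)%N.
    have := ltn_ceil n D0; rewrite -/K mulSn.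
    have : (D <= K * D)%N by rewrite leq_pmull// (leq_trans K0_gt0).
    by rewrite -mulnA (mulnC D); lia.
  rewrite /b_cr ltNge (ltW rs) /= (lt_eqF rs).
  apply: le_trans (window_hm r0 B1 K0_gt0 win K0K DK).
  rewrite mulrAC; apply: ler_pM; rewrite ?mulr_ge0 ?powR_ge0//.
    rewrite -powRM//; apply: le_powRN2; [exact: ltW| |].
      by rewrite ltr0n muln_gt0 B0 (leq_trans K0_gt0).
    by rewrite -natrM ler_nat leq_pmul2l// leq_div.
  apply: le_powR2; [exact: ltW|by rewrite invr_ge0 mulr_ge0|].
  rewrite ler_pdivlMr// ler_pdivrMl ?mulr_gt0//.
  by rewrite -!natrM ler_nat.
- pose E := (D * K0)%N.
  have E0 : (0 < E)%N by rewrite muln_gt0 D0.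
  have lnB : 0 < ln B%:R :> R by rewrite ln_gt0// ltr1n.
  exists (B%:R `^ (- sigma) / (2 * ln B%:R)).
    by rewrite divr_gt0 ?powR_gt0// mulr_gt0.
  (* Beyond this threshold ln n >= 2 (ln B + ln E), which absorbs the rounding in [M] and leaves M
     ln B >= (ln n)/2. *)
  exists ((B * E) ^ 2)%N => // n /= BEn.
  have n0 : (0 < n)%N by rewrite (leq_trans _ BEn)// expn_gt0 muln_gt0 B0 E0.
  have nR : 0 < n%:R :> R by rewrite ltr0n.
  have En : (E <= n)%N.
    rewrite (leq_trans _ BEn)// (@leq_trans (B * E))// ?leq_pmull//.
    by rewrite muln_gt0 B0.
  pose q := (n %/ E)%N; have q0 : (0 < q)%N by rewrite divn_gt0.
  (* B^M E <= n, so every window of index at most [M] meets the constraint of [window_bound]. *)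
  pose M := trunc_log B q.
  have win_i (i : 'I_M) : (B%:R `^ (- sigma)) * n%:R `^ (- sigma) <=
      (B ^ i.+1 * K0)%N%:R `^ (- r) *
      mean P (fun w => (B ^ i * K0 < Y n w <= B ^ i.+1 * K0)%N%:R).
    have win' : (K0 <= B ^ i * K0)%N -> (D * (B ^ i * K0) <= n)%N ->
        ((B ^ i * K0)%N%:R / n%:R) `^ sigma <=
        mean P (fun w => (B ^ i * K0 < Y n w <= B ^ i.+1 * K0)%N%:R).
      by rewrite expnS -mulnA; exact: win.
    have BK : 0 < (B ^ i * K0)%N%:R :> R by rewrite ltr0n muln_gt0 expn_gt0 B0.
    apply: (@le_trans _ _ ((B ^ i.+1 * K0)%N%:R `^ (- r) *
        ((B ^ i * K0)%N%:R / n%:R) `^ sigma)).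
      rewrite -sr expnS -mulnA natrM powRM// powR_div// [_ `^ (- sigma)]powRN.
      rewrite [X in _ * X * _]powRN [X in _ * X <= _]powRN.
      rewrite le_eqVlt; apply/orP; left; apply/eqP; field.
      by rewrite !lt0r_neq0 ?powR_gt0.
    rewrite ler_wpM2l ?powR_ge0// win'//; first by rewrite leq_pmull// expn_gt0 B0.
    apply: (@leq_trans (B ^ M * E)).
      by rewrite mulnCA leq_mul2r leq_pexp2l// ?orbT// ltnW.
    apply: (@leq_trans (q * E)); last exact: leq_divM.
    by rewrite leq_mul2r trunc_logP ?orbT.
  have L1w i : L1 P (fun w => (B ^ i * K0 < Y n w <= B ^ i.+1 * K0)%N%:R).
    exact: (@L1_indic _ _ _ P (Y n) (fun k => (B ^ i * K0 < k <= B ^ i.+1 * K0)%N)).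
  have sumM : M%:R * (B%:R `^ (- sigma) * n%:R `^ (- sigma)) <= hm r n.
    apply: (@le_trans _ _ (mean P (fun w => \sum_(i < M)
        (B ^ i.+1 * K0)%N%:R `^ (- r) *
        (B ^ i * K0 < Y n w <= B ^ i.+1 * K0)%N%:R))).
      rewrite mean_sum; last by move=> i; exact: L1Z.
      rewrite mulr_natl -[X in _ *+ X]card_ord -sumr_const.
      by apply: ler_sum => i _; rewrite meanZ.
    apply: le_mean; [by apply: L1_sum => i; exact: L1Z|exact: L1_hm|move=> w].
    rewrite (le_trans (hm_windows_le M (Y n w) r0 B0 K0_gt0))//.
    rewrite ler_wpM2l ?powR_ge0// ler_nat.
    by case: (0 < Y n w)%N => //=; rewrite leq_b1.
  have nBM : (n <= B ^ M.+1 * E)%N.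
    rewrite ltnW// (leq_trans (ltn_ceil n E0))// leq_mul2r -/q.
    by rewrite trunc_log_ltn ?orbT.
  have lnnM : ln n%:R <= M.+1%:R * ln B%:R + ln E%:R :> R.
    rewrite mulr_natl -lnXn// -lnM ?posrE ?exprn_gt0 ?ltr0n//.
    by rewrite ler_ln ?posrE ?mulr_gt0 ?exprn_gt0 ?ltr0n// -natrX -natrM ler_nat.
  have lnn : (ln B%:R + ln E%:R) *+ 2 <= ln n%:R :> R.
    rewrite -lnM ?posrE ?ltr0n// -lnXn ?mulr_gt0 ?ltr0n//.
    by rewrite ler_ln ?posrE ?exprn_gt0 ?mulr_gt0 ?ltr0n// -natrM -natrX ler_nat.
  rewrite /b_cr sr ltxx eqxx; apply: le_trans sumM; rewrite sr.
  rewrite [leLHS](_ : _ = (B%:R `^ (- r) * n%:R `^ (- r)) *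
    (ln n%:R / (2 * ln B%:R))); last by ring.
  rewrite [leRHS]mulrC ler_pM2l ?mulr_gt0 ?powR_gt0//.
  rewrite ler_pdivrMr ?mulr_gt0//.
  by move: lnnM lnn; rewrite -natr1 mulrDl mul1r mulr2n; lra.
Qed.

End HarmonicMoments.

(** * Iteration of critical generating functions *)

Section CriticalIteration.
Context {R : realType}.
Implicit Types (x y : R).

Lemma ln_onem_bounds y : 0 <= y <= 1 / 2 ->
  - y - 2 * y ^+ 2 <= ln (1 - y) <= - y.
Proof.
move=> /andP[y0 y1]; apply/andP; split; last by apply: le_ln1Dx; lra.
have y1_gt0 : 0 < 1 - y by lra.
rewrite -[1 - y]invrK lnV ?posrE ?invr_gt0// lerNr opprB opprK.
have -> : (1 - y)^-1 = 1 + y / (1 - y) by field; lra.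
rewrite (le_trans (le_ln1Dx _))//.
  by rewrite (lt_le_trans (ltrN10 _))// divr_ge0// ltW.
rewrite ler_pdivrMr//; nra.
Qed.

Lemma expRN_le_half y : 0 <= y <= 1 -> expR (- y) <= 1 - y / 2.
Proof.
move=> /andP[y0 y1]; rewrite expRN invf_ple ?posrE ?expR_gt0//; last by lra.
rewrite (le_trans _ (expR_ge1Dx y))// -[leLHS]div1r ler_pdivrMr; last by lra.
nra.
Qed.

(** Everything is read in the relative decrement y = 1 - x'/x, which equals gamma x up to a quarter
    of it. The drift is 1/x' - 1/x = y / (x (1 - y)). In lq - sigma ln (1 - y) the first-order terms
    cancel because beta = sigma gamma, leaving an error of order x^(1 + eta). The drop x^eta -
    x'^eta = x^eta (1 - (1 - y)^eta) is at least of that same order, since y is of order x. *)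
Lemma critical_step_at (gamma beta eta sigma M x x' lq : R) :
  0 < gamma -> 0 < eta <= 1 -> 0 < sigma -> beta / gamma = sigma -> 0 < M ->
  0 < x <= 1 -> gamma * x <= 1 / 4 -> x <= x `^ eta ->
  M * x `^ eta <= gamma / 4 ->
  `|x' - (x - gamma * x ^+ 2)| <= M * (x ^+ 2 * x `^ eta) ->
  `|lq + beta * x| <= M * (x * x `^ eta) ->
  [/\ 0 < x' <= x, x^-1 + gamma / 2 <= x'^-1 <= x^-1 + 2 * gamma &
      `|lq - sigma * ln (x' / x)| <=
        (M + sigma * (4 * gamma ^+ 2 + M)) * (4 / (eta * gamma)) *
        (x `^ eta - x' `^ eta)].
Proof.
move=> g0 /andP[e0 e1] sigma0 bgs M0 /andP[x_gt0 x1] gx.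
have : 0 < x `^ eta by exact: powR_gt0.
have : x `^ eta = x `^ eta by [].
move: {-2}(x `^ eta) => xe xeE xe0 xxe Mxe Hux HQx.
pose y := 1 - x' / x.
have x'y : x' = x * (1 - y) by rewrite /y; field; rewrite lt0r_neq0.
have yE : `|y - gamma * x| <= M * (x * xe).
  rewrite -(ler_pM2l x_gt0) -{1}(gtr0_norm x_gt0) -normrM.
  have -> : x * (y - gamma * x) = - (x' - (x - gamma * x ^+ 2)).
    by rewrite x'y; ring.
  by rewrite normrN (le_trans Hux)// le_eqVlt; apply/orP; left; apply/eqP; ring.
have Mxxe : M * (x * xe) <= gamma / 4 * x.
  by rewrite mulrCA mulrC ler_pM2r.
have [yl yu] : 3 / 4 * gamma * x <= y /\ y <= 5 / 4 * gamma * x.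
  by move: yE; rewrite ler_norml => /andP[]; lra.
have gx0 : 0 < gamma * x by rewrite mulr_gt0.
have y_gt0 : 0 < y by lra.
have yh : y <= 1 / 2 by lra.
have x'0 : 0 < x' by rewrite x'y mulr_gt0//; lra.
have xV : x'^-1 = x^-1 + y / (x * (1 - y)).
  by rewrite x'y; field; rewrite lt0r_neq0//=; lra.
have den0 : 0 < x * (1 - y) by rewrite mulr_gt0//; lra.
split.
- by rewrite x'0 x'y ler_piMr// ?(ltW x_gt0)//; lra.
- rewrite xV !lerD2l ler_pdivlMr// ler_pdivrMr//; apply/andP; split; nra.
have lnx : ln (x' / x) = ln (1 - y) by congr ln; rewrite /y; ring.
rewrite lnx.
have /andP[lnl lnu] : - y - 2 * y ^+ 2 <= ln (1 - y) <= - y.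
  by apply: ln_onem_bounds; rewrite (ltW y_gt0).
have y2 : 2 * y ^+ 2 <= 4 * gamma ^+ 2 * (x * xe).
  have h1 : y ^+ 2 <= (5 / 4 * gamma * x) ^+ 2 by rewrite lerXn2r ?nnegrE//; lra.
  have h2 : x ^+ 2 <= x * xe by rewrite expr2 ler_pM2l.
  have g2 : 0 < gamma ^+ 2 by rewrite exprn_gt0.
  have h3 : gamma ^+ 2 * x ^+ 2 <= gamma ^+ 2 * (x * xe) by rewrite ler_pM2l.
  have h4 : 0 <= gamma ^+ 2 * x ^+ 2 by rewrite mulr_ge0 ?sqr_ge0.
  have h5 : (5 / 4 * gamma * x) ^+ 2 = 25 / 16 * (gamma ^+ 2 * x ^+ 2) by field.
  lra.
have errQ : `|lq - sigma * ln (1 - y)| <=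
    (M + sigma * (4 * gamma ^+ 2 + M)) * (x * xe).
  have -> : lq - sigma * ln (1 - y) = lq + beta * x -
      sigma * ((ln (1 - y) + y) - (y - gamma * x)).
    by rewrite -bgs; field; rewrite lt0r_neq0.
  rewrite (le_trans (ler_normB _ _))// mulrDl lerD// normrM (gtr0_norm sigma0).
  rewrite -mulrA ler_pM2l// (le_trans (ler_normB _ _))// mulrDl lerD//.
  by rewrite ler_norml; apply/andP; split; lra.
apply: le_trans errQ _; rewrite -mulrA; apply: ler_wpM2l.
  by rewrite addr_ge0 ?mulr_ge0 ?addr_ge0 ?mulr_ge0 ?sqr_ge0// ltW.
have eg0 : 0 < eta * gamma by rewrite mulr_gt0.
rewrite mulrAC ler_pdivlMr// x'y powRM; [|exact: ltW|lra].
rewrite -xeE -[xe in xe - _]mulr1 -mulrBr.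
have pw : (1 - y) `^ eta <= 1 - eta * y / 2.
  have ey : 0 <= eta * y <= 1 by apply/andP; split; nra.
  apply: le_trans (expRN_le_half ey).
  rewrite /powR gt_eqF; last by lra.
  by rewrite ler_expR -mulrN ler_pM2l.
have key : eta * y / 2 <= 1 - (1 - y) `^ eta by lra.
apply: (@le_trans _ _ (4 * (xe * (eta * y / 2)))); last first.
  by rewrite ler_pM2l// ler_pM2l.
have : xe * eta * (3 / 4 * gamma * x) <= xe * eta * y by rewrite ler_pM2l ?mulr_gt0.
have : 0 < xe * eta * gamma * x by rewrite !mulr_gt0.
by lra.
Qed.

(* [x'] is the image of [x] under the iteration seen from the fixed point 1;
   the drift of [1/x'] governs the decay, and [K x^eta] is a potential that
   absorbs the error in [Q (1 - x) = (x'/x)^sigma]. *)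
Lemma critical_step (u Q : R -> R) (gamma beta eta sigma : R) :
  0 < gamma -> 0 < beta -> 0 < eta <= 1 -> beta / gamma = sigma ->
  (fun x => u (1 - x) - (1 - x + gamma * x ^+ 2))
    =O_ (0^'+) (fun x => x `^ (2 + eta)) ->
  (fun x => ln (Q (1 - x)) - (- beta * x)) =O_ (0^'+) (fun x => x ^+ 2) ->
  exists x0 c c2 K : R,
    [/\ 0 < x0 <= 1 / 2, 0 < c, 0 < c2, 0 <= K & forall x, 0 < x <= x0 ->
      let x' := 1 - u (1 - x) in
      [/\ 0 < x' <= x, x^-1 + c <= x'^-1 <= x^-1 + c2, 0 < Q (1 - x) &
          `|ln (Q (1 - x)) - sigma * ln (x' / x)|
            <= K * (x `^ eta - x' `^ eta)]].
Proof.
move=> g0 b0 /andP[e0 e1] bgs /eqO_exP[M1 M10 H1] /eqO_exP[M2 M20 H2].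
have sigma0 : 0 < sigma by rewrite -bgs divr_gt0.
pose M := Num.max M1 M2.
have M1M : M1 <= M by rewrite le_max lexx.
have M2M : M2 <= M by rewrite le_max lexx orbT.
have M0 : 0 < M by exact: lt_le_trans M1M.
have near_and : \forall x \near 0^'+,
    `|u (1 - x) - (1 - x + gamma * x ^+ 2)| <= M1 * `|x `^ (2 + eta)| /\
    `|ln (Q (1 - x)) - (- beta * x)| <= M2 * `|x ^+ 2|.
  by near=> x; split; near: x.
have [rho rho0 H] : exists2 rho : R, 0 < rho & forall x, 0 < x < rho ->
    `|u (1 - x) - (1 - x + gamma * x ^+ 2)| <= M1 * `|x `^ (2 + eta)| /\
    `|ln (Q (1 - x)) - (- beta * x)| <= M2 * `|x ^+ 2|.
  move: near_and => [rho /= rho0 Hr]; exists rho => // x /andP[x0 xr].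
  by apply: Hr => //=; rewrite sub0r normrN gtr0_norm.
(* Below this point the remainder M x^(2 + eta) is at most a quarter of gamma x^2. *)
pose e1x := (gamma / (4 * M)) `^ eta^-1.
have e1x0 : 0 < e1x by rewrite powR_gt0// divr_gt0// mulr_gt0.
pose x0 := Num.min (Num.min (rho / 2) (1 / 2))
  (Num.min (Num.min e1x (4 * gamma)^-1) (beta / (2 * M))).
have x00 : 0 < x0.
  rewrite !lt_min e1x0 !divr_gt0 ?mulr_gt0//= invr_gt0 mulr_gt0//=.
have [x0rho x0h x0e x0g x0b] : [/\ x0 <= rho / 2, x0 <= 1 / 2, x0 <= e1x,
    x0 <= (4 * gamma)^-1 & x0 <= beta / (2 * M)].
  by split; rewrite !ge_min lexx ?orbT.
exists x0, (gamma / 2), (2 * gamma),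
  ((M + sigma * (4 * gamma ^+ 2 + M)) * (4 / (eta * gamma))).
split.
- by rewrite x00.
- by rewrite divr_gt0.
- by rewrite mulr_gt0.
- by rewrite mulr_ge0 ?addr_ge0 ?mulr_ge0 ?addr_ge0 ?mulr_ge0 ?invr_ge0 ?mulr_ge0 ?sqr_ge0// ltW.
move=> x /andP[x_gt0 xx0]; cbv zeta; set x' := 1 - u (1 - x).
have xrho : 0 < x < rho by rewrite x_gt0 (le_lt_trans xx0)//; lra.
have [Hu HQ] := H x xrho.
have x1 : x <= 1 by lra.
have gx : gamma * x <= 1 / 4.
  have : x <= (4 * gamma)^-1 by lra.
  rewrite -[(4 * gamma)^-1]div1r ler_pdivlMr ?mulr_gt0//; lra.
set xe := x `^ eta.
have xe0 : 0 < xe by rewrite powR_gt0.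
have xxe : x <= xe.
  rewrite -[leLHS]powRr1; last exact: ltW.
  by apply: ger_powR => //; rewrite x_gt0.
have Mxe : M * xe <= gamma / 4.
  have : xe <= gamma / (4 * M).
    have -> : gamma / (4 * M) = e1x `^ eta.
      rewrite /e1x -powRrM mulVf ?lt0r_neq0// powRr1//.
      by rewrite divr_ge0 ?mulr_ge0// ltW.
    by apply: le_powR2; lra.
  by rewrite ler_pdivlMr ?mulr_gt0//; lra.
have xpow : x `^ (2 + eta) = x ^+ 2 * xe.
  by rewrite powRD_gt0// powR_mulrn// ltW.
have Hux : `|x' - (x - gamma * x ^+ 2)| <= M * (x ^+ 2 * xe).
  have -> : x' - (x - gamma * x ^+ 2) =
      - (u (1 - x) - (1 - x + gamma * x ^+ 2)) by rewrite /x'; ring.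
  have xx2 : 0 <= x ^+ 2 * xe := mulr_ge0 (sqr_ge0 x) (ltW xe0).
  by rewrite normrN (le_trans Hu)// xpow ger0_norm// ler_wpM2r.
have HQx : `|ln (Q (1 - x)) + beta * x| <= M * (x * xe).
  rewrite (_ : _ + _ = ln (Q (1 - x)) - (- beta * x)); last by ring.
  rewrite (le_trans HQ)// ger0_norm ?sqr_ge0//.
  apply: ler_pM => //; [exact: ltW|exact: sqr_ge0|].
  by rewrite expr2 ler_pM2l.
(* [ln] is 0 on nonpositive arguments, so strict negativity is what certifies Q (1 - x) > 0; the
   bound x0 <= beta/(2M) serves this purpose. *)
have HQneg : ln (Q (1 - x)) < 0.
  move: HQ; rewrite [`|x ^+ 2|]ger0_norm ?sqr_ge0// ler_norml => /andP[_].
  have Mx : M * x <= beta / 2.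
    have : x <= beta / (2 * M) by lra.
    by rewrite ler_pdivlMr ?mulr_gt0//; lra.
  have : M2 * x ^+ 2 <= beta / 2 * x.
    by rewrite expr2 mulrA ler_pM2r// (le_trans _ Mx)// ler_pM2r.
  have : 0 < beta * x by rewrite mulr_gt0.
  lra.
have x01 : 0 < x <= 1 by rewrite x_gt0.
have [x'x x'V lnQ] := critical_step_at g0 (introT andP (conj e0 e1)) sigma0 bgs M0
  x01 gx xxe Mxe Hux HQx.
split=> //.
by rewrite ltNge; apply/negP => /ln0 Q0; move: HQneg; rewrite Q0 ltxx.
Unshelve. all: by end_near.
Qed.

Lemma critical_step_powR (x x' q K sigma eta : R) : 0 < x -> 0 < x' -> 0 < q ->
  `|ln q - sigma * ln (x' / x)| <= K * (x `^ eta - x' `^ eta) ->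
  (x' / x) `^ sigma * expR (- (K * x `^ eta)) * expR (K * x' `^ eta) <= q
    <= (x' / x) `^ sigma * expR (K * x `^ eta) * expR (- (K * x' `^ eta)).
Proof.
move=> x0 x'0 q0; rewrite ler_norml => /andP[lo up].
have xx : 0 < x' / x by rewrite divr_gt0.
rewrite -[q]lnK ?posrE// [(x' / x) `^ sigma]/powR gt_eqF// -!expRD !ler_expR.
by apply/andP; split; lra.
Qed.

(** The algebra of the induction step: the drift compares x/x' with 1 + c x, which turns the
    right-hand side into (1 + c (n + 1) x)^(-sigma). *)
Lemma powRN_drift (x x' sigma c : R) (n : nat) : 0 < x -> 0 < x' -> 0 <= c ->
  (x' / x) `^ sigma * (1 + c * n%:R * x') `^ (- sigma) =
  (x / x' + c * n%:R * x) `^ (- sigma).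
Proof.
move=> x0 x'0 c0.
rewrite -[x' / x]invrK powRV ?invr_ge0 ?divr_ge0 ?ltW// -powRN -powRM; last 2 first.
- by rewrite invr_ge0 divr_ge0// ltW.
- by rewrite addr_ge0// !mulr_ge0// ltW.
by congr (_ `^ _); field; rewrite !lt0r_neq0.
Qed.

(** The prefactor exp(K x^eta) closes the induction: the step costs exp(K x^eta - K x'^eta) and the
    induction hypothesis at x' brings exp(K x'^eta), so no constant accumulates with n. *)
Lemma critical_upper (u Q : R -> R) (F : nat -> R -> R)
    (eta sigma x0 c K : R) :
  0 < sigma -> 0 < c -> 0 <= K ->
  (forall x, 0 < x <= x0 -> let x' := 1 - u (1 - x) in
    [/\ 0 < x' <= x, x^-1 + c <= x'^-1, 0 < Q (1 - x) &
        `|ln (Q (1 - x)) - sigma * ln (x' / x)| <= K * (x `^ eta - x' `^ eta)]) ->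
  (forall x, 0 < x <= x0 -> F 0 (1 - x) <= 1) ->
  (forall n x, 0 < x <= x0 -> F n.+1 (1 - x) <= Q (1 - x) * F n (u (1 - x))) ->
  forall n x, 0 < x <= x0 ->
    F n (1 - x) <= expR (K * x `^ eta) * (1 + c * n%:R * x) `^ (- sigma).
Proof.
move=> s0 c0 K0 step F0 FS; elim=> [|n IH] x xx0.
  rewrite mulr0 mul0r addr0 powR1 mulr1 (le_trans (F0 _ xx0))//.
  by rewrite -expR0 ler_expR mulr_ge0 ?powR_ge0.
have /andP[x_gt0 _] := xx0.
have [/andP[x'0 x'x] x'c Q0 lnQ] := step x xx0.
set x' := 1 - u (1 - x) in x'0 x'x x'c lnQ.
have ux : u (1 - x) = 1 - x' by rewrite /x'; ring.
have x'x0 : 0 < x' <= x0.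
  by rewrite x'0 (le_trans x'x)//; case/andP: xx0.
have /andP[_ Qup] := critical_step_powR x_gt0 x'0 Q0 lnQ.
apply: (le_trans (FS _ _ xx0)); rewrite ux.
apply: (@le_trans _ _ (Q (1 - x) *
    (expR (K * x' `^ eta) * (1 + c * n%:R * x') `^ (- sigma)))).
  by rewrite ler_pM2l// IH.
apply: (@le_trans _ _ ((x' / x) `^ sigma * expR (K * x `^ eta) *
    expR (- (K * x' `^ eta)) *
    (expR (K * x' `^ eta) * (1 + c * n%:R * x') `^ (- sigma)))).
  by rewrite ler_wpM2r// mulr_ge0 ?expR_ge0 ?powR_ge0.
have e1 : expR (- (K * x' `^ eta)) * expR (K * x' `^ eta) = 1.
  by rewrite -expRD addNr expR0.
rewrite [leLHS](_ : _ = expR (K * x `^ eta) *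
  ((x' / x) `^ sigma * (1 + c * n%:R * x') `^ (- sigma)) *
  (expR (- (K * x' `^ eta)) * expR (K * x' `^ eta))); last by ring.
rewrite e1 mulr1 ler_pM2l ?expR_gt0// powRN_drift//; last exact: ltW.
apply: le_powRN2; [exact: ltW| |].
  by rewrite ltr_wpDr// ?mulr_ge0 ?ltW.
have : x * (x^-1 + c) <= x / x' by rewrite ler_pM2l.
by rewrite mulrDr mulfV ?lt0r_neq0// -natr1; lra.
Qed.

(** The same telescoping with reversed signs; the lower bound needs a positive starting value
    [c0]. *)
Lemma critical_lower (u Q : R -> R) (F : nat -> R -> R)
    (eta sigma x0 c c0 K : R) :
  0 < sigma -> 0 < c -> 0 <= K -> 0 < c0 ->
  (forall x, 0 < x <= x0 -> let x' := 1 - u (1 - x) in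
    [/\ 0 < x' <= x, x'^-1 <= x^-1 + c, 0 < Q (1 - x) &
        `|ln (Q (1 - x)) - sigma * ln (x' / x)| <= K * (x `^ eta - x' `^ eta)]) ->
  (forall x, 0 < x <= x0 -> c0 <= F 0 (1 - x)) ->
  (forall n x, 0 < x <= x0 -> Q (1 - x) * F n (u (1 - x)) <= F n.+1 (1 - x)) ->
  forall n x, 0 < x <= x0 ->
    c0 * expR (- (K * x `^ eta)) * (1 + c * n%:R * x) `^ (- sigma) <= F n (1 - x).
Proof.
move=> s0 c_gt0 K0 c00 step F0 FS; elim=> [|n IH] x xx0.
  rewrite mulr0 mul0r addr0 powR1 mulr1 (le_trans _ (F0 _ xx0))//.
  rewrite ler_piMr// ?(ltW c00)// -expR0 ler_expR oppr_le0.
  by rewrite mulr_ge0 ?powR_ge0.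
have /andP[x_gt0 _] := xx0.
have [/andP[x'0 x'x] x'c Q0 lnQ] := step x xx0.
set x' := 1 - u (1 - x) in x'0 x'x x'c lnQ.
have ux : u (1 - x) = 1 - x' by rewrite /x'; ring.
have x'x0 : 0 < x' <= x0.
  by rewrite x'0 (le_trans x'x)//; case/andP: xx0.
have /andP[Qlo _] := critical_step_powR x_gt0 x'0 Q0 lnQ.
apply: le_trans (FS _ _ xx0); rewrite ux.
apply: (@le_trans _ _ (Q (1 - x) *
    (c0 * expR (- (K * x' `^ eta)) * (1 + c * n%:R * x') `^ (- sigma)))); last first.
  by rewrite ler_pM2l// IH.
apply: (@le_trans _ _ ((x' / x) `^ sigma * expR (- (K * x `^ eta)) *
    expR (K * x' `^ eta) *
    (c0 * expR (- (K * x' `^ eta)) * (1 + c * n%:R * x') `^ (- sigma)))); last first.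
  by rewrite ler_wpM2r// !mulr_ge0 ?expR_ge0 ?powR_ge0// ltW.
have e1 : expR (- (K * x' `^ eta)) * expR (K * x' `^ eta) = 1.
  by rewrite -expRD addNr expR0.
rewrite [leRHS](_ : _ = c0 * expR (- (K * x `^ eta)) *
  ((x' / x) `^ sigma * (1 + c * n%:R * x') `^ (- sigma)) *
  (expR (- (K * x' `^ eta)) * expR (K * x' `^ eta))); last by ring.
rewrite e1 mulr1 ler_pM2l ?mulr_gt0 ?expR_gt0// powRN_drift//; last exact: ltW.
apply: le_powRN2; [exact: ltW| |].
  by rewrite ltr_wpDr ?divr_gt0// !mulr_ge0// ltW.
have : x / x' <= x * (x^-1 + c) by rewrite ler_pM2l.
by rewrite mulrDr mulfV ?lt0r_neq0// -natr1; lra.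
Qed.

End CriticalIteration.

(** * Positivity of means and elementary bounds on generating functions *)

Section MeanPositivity.
Context {R : realType} {d : measure_display} {T : measurableType d}.
Variable P : probability T R.

(** A nonnegative function of mean 0 vanishes almost everywhere, hence so does [g]. With g = 1 this
    yields strict positivity of means, with g = xi the positivity of P(xi > 0). *)
Lemma mean_eq0 (h g : T -> R) : L1 P h -> measurable_fun setT g ->
  (forall w, 0 <= h w) -> (forall w, h w = 0 -> g w = 0) ->
  mean P h = 0 -> ('E_P[g] = 0)%E.
Proof.
move=> h1 mg h0 hg mh.
have mh' : measurable_fun setT (EFin \o h) by exact: measurable_int h1.
have Eh : ('E_P[h] = 0)%E by rewrite meanE// mh.
rewrite expectation.unlock; transitivity (\int[P]_w (cst 0%E w))%E; last first.
  by rewrite integral_cst// mul0e.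
have hae : ae_eq P setT (EFin \o h) (cst 0%E).
  apply/(ae_eq_integral_abs P measurableT mh').
  rewrite -[RHS]Eh expectation.unlock; apply: eq_integral => w _ /=.
  by rewrite ger0_norm.
apply: ae_eq_integral => //; first exact/measurable_EFinP.
by apply: filterS hae => w /= hw _; rewrite (hg w (EFin_inj (hw I))).
Qed.

Lemma mean_gt0 (h : T -> R) : L1 P h -> (forall w, 0 < h w) -> 0 < mean P h.
Proof.
move=> h1 h0; rewrite lt_neqAle eq_sym; apply/andP; split; last first.
  by rewrite mean_Rintegral; apply: Rintegral_ge0 => w _; exact: ltW.
apply/eqP => mh.
have := @mean_eq0 h (fun=> 1) h1; rewrite expectation_cst => /(_ _ _ _ mh) e.
have /eqP : (1%:E = 0 :> \bar R)%E.
  apply: e => // [w|w hw]; first exact: ltW.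
  by move: (h0 w); rewrite hw ltxx.
by rewrite eqe oner_eq0.
Qed.

Lemma pgf_range (Y : T -> nat) s : measurable_fun setT Y -> 0 <= s <= 1 ->
  0 <= pgf_of P Y s <= 1.
Proof.
move=> mY s01; have /andP[s0 s1] := s01; rewrite /pgf_of -/(mean P _).
apply/andP; split.
  rewrite -[leLHS](mean_cst P); apply: le_mean; [exact: L1_cst|exact: L1_pgf|].
  by move=> w; rewrite exprn_ge0.
rewrite -[leRHS](mean_cst P); apply: le_mean; [exact: L1_pgf|exact: L1_cst|].
by move=> w; rewrite exprn_ile1.
Qed.

Lemma le_pgf (Y : T -> nat) s s' : measurable_fun setT Y ->
  0 <= s -> s <= s' -> s' <= 1 -> pgf_of P Y s <= pgf_of P Y s'.
Proof.
move=> mY s0 ss' s'1; apply: le_mean.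
- by apply: L1_pgf => //; rewrite s0 (le_trans ss').
- by apply: L1_pgf => //; rewrite s'1 (le_trans s0).
- by move=> w; apply: lerXn2r; rewrite // nnegrE// (le_trans s0).
Qed.

Lemma pgf_gt0 (Y : T -> nat) s : measurable_fun setT Y -> 0 < s <= 1 ->
  0 < pgf_of P Y s.
Proof.
move=> mY /andP[s0 s1]; apply: mean_gt0; first by apply: L1_pgf; rewrite ?s1 ?ltW.
by move=> w; rewrite exprn_gt0.
Qed.

End MeanPositivity.

(** * Recursion for the generating functions *)

Section PgfRecursion.
Context {R : realType} {d : measure_display} {T : measurableType d}.
Variables (P : probability T R) (m : R) (xi : {RV P >-> nat})
  (phi : nat -> {RV P >-> nat}) (X0 : {RV P >-> nat})
  (Xi Phi : nat -> nat -> {RV P >-> nat}).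
Hypothesis model : cbp_model m xi phi X0 Xi Phi.

Let X := popX X0 (fun n j => Xi n j) (fun n k => Phi n k).
Let N := popN X0 (fun n j => Xi n j) (fun n k => Phi n k).
Let mX n : measurable_fun setT (X n) := measurable_X model n.
Let mN n : measurable_fun setT (N n) := measurable_N model n.
Let mxi : measurable_fun setT xi := measurable_funPT xi.

Let mpow (Y : T -> nat) (a s : R) : measurable_fun setT Y ->
  measurable_fun setT (fun w => (a * s ^+ Y w)%:E).
Proof.
move=> mY; apply/measurable_EFinP.
exact: (measurableT_comp (f := fun k => a * s ^+ k)).
Qed.

Let pgfE (Y : T -> nat) s : measurable_fun setT Y -> 0 <= s <= 1 ->
  (\int[P]_w (s ^+ Y w)%:E)%E = (pgf_of P Y s)%:E.
Proof.
move=> mY s01; have := meanE (L1_pgf P mY s01).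
by rewrite expectation.unlock.
Qed.

Lemma pgf_X_step n s : 0 <= s <= 1 ->
  pgf_of P (X n.+1) s = pgf_of P (N n) (pgf_of P xi s).
Proof.
move=> s01; have /andP[s0 s1] := s01.
have f01 := pgf_range P mxi s01; have /andP[f0 f1] := f01.
suff cellE k i : (\int[P]_(w in cell X0 Xi Phi n k i) (s ^+ X n.+1 w)%:E =
    \int[P]_(w in cell X0 Xi Phi n k i) (pgf_of P xi s ^+ N n w)%:E)%E.
  apply: EFin_inj; rewrite -!pgfE//.
  have mf (Y : T -> nat) t : measurable_fun setT Y ->
      measurable_fun setT (fun w => (t ^+ Y w)%:E : \bar R).
    by move=> mY; have := mpow 1 t mY; under eq_fun do rewrite mul1r.
  apply/eqP; rewrite eq_le; apply/andP; split;
    apply: (ge0_le_integral_cell model (n := n));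
    rewrite ?cellE//; first [exact: mf|by move=> w; rewrite lee_fin exprn_ge0|
      by move=> k i; rewrite cellE].
have sX (w : T) : cell X0 Xi Phi n k i w ->
    s ^+ X n.+1 w = \prod_(j < i) s ^+ Xi n j w.
  by move=> [_ /= <-]; rewrite prodrXr.
have sN (w : T) : cell X0 Xi Phi n k i w ->
    pgf_of P xi s ^+ N n w = pgf_of P xi s ^+ i by move=> [_ /= <-].
under eq_integral => w /set_mem Cw do rewrite (sX w Cw).
rewrite [RHS](_ : _ = \int[P]_(w in cell X0 Xi Phi n k i)
    cst (pgf_of P xi s ^+ i)%:E w)%E; last first.
  by apply: eq_integral => w /set_mem Cw; rewrite (sN w Cw).
rewrite (@integral_cell_prod _ _ _ _ _ _ _ _ _ _ model n k i (fun y => s ^+ y)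
  (pgf_of P xi s)).
- by rewrite integral_cst; [exact: muleC|exact: (measurable_cell model)].
- by move=> y; rewrite exprn_ge0.
- exact: pgfE.
Qed.

(** On X_n = k the variable N_n has the law of phi(k), so a bound geometric in k integrates to the
    generating function of X_n. At s = f(z), [a] and [l] will be Q_U(z) and u_U(z). *)
Lemma pgf_N_le n s a l : 0 <= s <= 1 -> 0 <= l <= 1 -> 0 <= a ->
  (forall k, pgf_of P (phi k) s <= a * l ^+ k) ->
  pgf_of P (N n) s <= a * pgf_of P (X n) l.
Proof.
move=> s01 l01 a0 hk; have /andP[s0 s1] := s01; have /andP[l0 l1] := l01.
rewrite -lee_fin EFinM -!pgfE// -ge0_integralZl ?lee_fin//; last 2 first.
- by have := mpow 1 l (mX n); under eq_fun do rewrite mul1r.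
- by move=> w _; rewrite lee_fin exprn_ge0.
apply: (ge0_le_integral_level (Z := X n)) => //.
- by have := mpow 1 s (mN n); under eq_fun do rewrite mul1r.
- exact: mpow.
- by move=> w; rewrite lee_fin exprn_ge0.
- by move=> w; rewrite lee_fin mulr_ge0// exprn_ge0.
move=> w0; set k := X n w0.
rewrite (@integral_X_control _ _ _ _ _ _ _ _ _ _ model n k (fun i => s ^+ i)); last first.
  by move=> i; rewrite exprn_ge0.
rewrite pgfE// (_ : (\int[P]_(w in _) _)%E =
    \int[P]_(w in X n @^-1` [set k]) cst (a * l ^+ k)%:E w)%E; last first.
  by apply: eq_integral => w /set_mem /= <-.
rewrite integral_cst; last exact: measurable_level.
by rewrite muleC lee_wpmul2r// lee_fin.
Qed.

Lemma pgf_N_ge n s a l : 0 <= s <= 1 -> 0 <= l <= 1 -> 0 <= a ->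
  (forall k, a * l ^+ k <= pgf_of P (phi k) s) ->
  a * pgf_of P (X n) l <= pgf_of P (N n) s.
Proof.
move=> s01 l01 a0 hk; have /andP[s0 s1] := s01; have /andP[l0 l1] := l01.
rewrite -lee_fin EFinM -!pgfE// -ge0_integralZl ?lee_fin//; last 2 first.
- by have := mpow 1 l (mX n); under eq_fun do rewrite mul1r.
- by move=> w _; rewrite lee_fin exprn_ge0.
apply: (ge0_le_integral_level (Z := X n)) => //.
- exact: mpow.
- by have := mpow 1 s (mN n); under eq_fun do rewrite mul1r.
- by move=> w; rewrite lee_fin mulr_ge0// exprn_ge0.
- by move=> w; rewrite lee_fin exprn_ge0.
move=> w0; set k := X n w0.
rewrite (@integral_X_control _ _ _ _ _ _ _ _ _ _ model n k (fun i => s ^+ i)); last first.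
  by move=> i; rewrite exprn_ge0.
rewrite pgfE// (_ : (\int[P]_(w in _) _)%E =
    \int[P]_(w in X n @^-1` [set k]) cst (a * l ^+ k)%:E w)%E; last first.
  by apply: eq_integral => w /set_mem /= <-.
rewrite integral_cst; last exact: measurable_level.
by rewrite muleC lee_wpmul2l// lee_fin.
Qed.

End PgfRecursion.

(** * Laplace transforms of X_n and N_n *)

Section LaplaceBounds.
Context {R : realType} {d : measure_display} {T : measurableType d}.
Variables (P : probability T R) (m tau sigma : R) (xi : {RV P >-> nat})
  (phi : nat -> {RV P >-> nat}) (X0 : {RV P >-> nat})
  (Xi Phi : nat -> nat -> {RV P >-> nat}) (l dl : edge -> R -> R).
Hypothesis model : cbp_model m xi phi X0 Xi Phi.
Hypothesis ad0 : AD0 phi tau l dl.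
Hypothesis adc : ADC m tau xi l dl sigma.

Let X := popX X0 (fun n j => Xi n j) (fun n k => Phi n k).
Let N := popN X0 (fun n j => Xi n j) (fun n k => Phi n k).
Let mX n : measurable_fun setT (X n) := measurable_X model n.
Let mN n : measurable_fun setT (N n) := measurable_N model n.
Let mxi : measurable_fun setT xi := measurable_funPT xi.
Let f := pgf_of P xi.
Let sigma0 : 0 < sigma := ADC_sigma_gt0 adc.
Let m0 : 0 < m := cbp_mean_gt0 model.

Lemma pgf_X_upper : exists x0 C, [/\ 0 < x0 <= 1 / 2, 0 < C &
  forall n x, (0 < n)%N -> 0 < x <= x0 ->
    pgf_of P (X n) (1 - x) <= C * (n%:R * x) `^ (- sigma)].
Proof.
have [gamma [beta [eta /(_ Upper)]]] := ADC_expansion adc.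
move=> [[g0 b0 e01] Ou OQ _ bgs].
have [x0 [c [c2 [K [x0h c0 _ K0 step]]]]] := critical_step g0 b0 e01 bgs Ou OQ.
have /andP[x00 x0h'] := x0h.
exists x0, (expR K * c `^ (- sigma)); split=> //.
  by rewrite mulr_gt0 ?expR_gt0 ?powR_gt0.
have r01 x : 0 < x <= x0 -> 0 <= 1 - x <= 1.
  by move=> /andP[x_gt0 xx0]; apply/andP; split; lra.
have bnd := @critical_upper R (l Upper \o f) (dl Upper \o f)
  (fun n => pgf_of P (X n)) (eta Upper) sigma x0 c K sigma0 c0 K0.
move=> n x n0 xx0; have /andP[x_gt0 xlex0] := xx0.
apply: (le_trans (bnd _ _ _ n x xx0)).
- by move=> y /step[? /andP[? _] ? ?]; split.
- by move=> y /r01/(pgf_range P (mX 0))/andP[].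
- move=> k y yx0; have y01 := r01 y yx0.
  have [/andP[x'0 x'y] _ Q0 _] := step y yx0.
  rewrite (pgf_X_step model) //; apply: (pgf_N_le model).
  + exact: pgf_range.
  (* That u (1 - y) lies in the unit interval is read off from 0 < x' <= y. *)
  + by move: x'0 x'y y01; rewrite /=; lra.
  + exact: ltW.
  + by move=> j; have /andP[] := AD0_bounds ad0 j (pgf_range P mxi y01).
rewrite -[leRHS]mulrA -powRM//; [|exact: ltW|by rewrite mulr_ge0// ltW].
apply: ler_pM; rewrite ?expR_ge0 ?powR_ge0//.
  rewrite ler_expR ler_piMr// -[leRHS](powRr0 x).
  apply: ger_powR; first by rewrite x_gt0; lra.
  by case/andP: e01 => /ltW.
apply: le_powRN2; [exact: ltW|by rewrite !mulr_gt0// ltr0n|].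
by rewrite mulrA lerDr.
Qed.

Lemma pgf_X_lower : exists x0 c, [/\ 0 < x0 <= 1 / 2, 0 < c &
  forall n x, 0 < x <= x0 ->
    c * (1 + n%:R * x) `^ (- sigma) <= pgf_of P (X n) (1 - x)].
Proof.
have [gamma [beta [eta /(_ Lower)]]] := ADC_expansion adc.
move=> [[g0 b0 e01] Ou OQ _ bgs].
have [x0 [c2 [c [K [x0h _ c0 K0 step]]]]] := critical_step g0 b0 e01 bgs Ou OQ.
have /andP[x00 x0h'] := x0h.
have r01 x : 0 < x <= x0 -> 0 <= 1 - x <= 1.
  by move=> /andP[x_gt0 xx0]; apply/andP; split; lra.
(* By monotonicity this value starts the induction on the whole range of x, and it is positive
   because 1 - x0 > 0. *)
pose c1 := pgf_of P (X 0) (1 - x0).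
have c10 : 0 < c1 by apply: pgf_gt0 => //; apply/andP; split; lra.
exists x0, (c1 * expR (- K) * (1 + c) `^ (- sigma)); split=> //.
  by rewrite !mulr_gt0 ?expR_gt0 ?powR_gt0// addr_gt0.
have bnd := @critical_lower R (l Lower \o f) (dl Lower \o f)
  (fun n => pgf_of P (X n)) (eta Lower) sigma x0 c c1 K sigma0 c0 K0 c10.
move=> n x xx0; have /andP[x_gt0 xlex0] := xx0.
apply: (le_trans _ (bnd _ _ _ n x xx0)).
- rewrite -[leLHS]mulrA -powRM; [|by rewrite addr_ge0// ltW|]; last first.
    by rewrite addr_ge0// mulr_ge0// ltW.
  rewrite -!mulrA ler_pM2l//.
  apply: ler_pM; rewrite ?expR_ge0 ?powR_ge0//.
    rewrite ler_expR lerN2 ler_piMr// -[leRHS](powRr0 x).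
    apply: ger_powR; first by rewrite x_gt0; lra.
    by case/andP: e01 => /ltW.
  have nx : 0 <= n%:R * x by rewrite mulr_ge0// ltW.
  apply: le_powRN2; [exact: ltW|by rewrite ltr_wpDr// mulr_ge0// ltW|].
  by nra.
- by move=> y /step[? /andP[_ ?] ? ?]; split.
- move=> y yx0; have /andP[y_gt0 ylex0] := yx0.
  by apply: le_pgf => //; lra.
- move=> k y yx0; have y01 := r01 y yx0.
  have [/andP[x'0 x'y] _ Q0 _] := step y yx0.
  rewrite (pgf_X_step model) //; apply: (pgf_N_ge model).
  + exact: pgf_range.
  + by move: x'0 x'y y01; rewrite /=; lra.
  + exact: ltW.
  + by move=> j; have /andP[] := AD0_bounds ad0 j (pgf_range P mxi y01).
Qed.

Lemma expR_onem_bounds (t : R) : 0 <= t <= 1 -> t / 2 <= 1 - expR (- t) <= t.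
Proof.
move=> t01; have := expRN_le_half t01; have := expR_ge1Dx (- t).
by move=> h1 h2; apply/andP; split; lra.
Qed.

(** The substitution x = 1 - exp(- t) satisfies t/2 <= x <= t, and the half goes into the upper
    constant. *)
Lemma laplace_X : laplace_bounds P sigma X.
Proof.
have [x1 [C [/andP[x10 x1h] C0 up]]] := pgf_X_upper.
have [x2 [c [/andP[x20 x2h] c0 lo]]] := pgf_X_lower.
exists (Num.min x1 x2), c, (C * 2^-1 `^ (- sigma)); split=> //.
- rewrite lt_min x10 x20 ge_min; apply/orP; left; lra.
- by rewrite mulr_gt0// powR_gt0// invr_gt0.
move=> n t n0; rewrite le_min => /andP[t_gt0 /andP[tx1 tx2]].
have t01 : 0 <= t <= 1 by apply/andP; split; lra.
have /andP[tl tu] := expR_onem_bounds t01.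
set x := 1 - expR (- t) in tl tu.
have -> : expR (- t) = 1 - x by rewrite /x; ring.
have x_gt0 : 0 < x by lra.
have nR : 0 < n%:R :> R by rewrite ltr0n.
apply/andP; split.
  apply: le_trans (lo n x _); last by rewrite x_gt0 (le_trans tu).
  rewrite ler_pM2l//; apply: le_powRN2; [exact: ltW| |].
    by rewrite ltr_wpDr// mulr_ge0// ltW.
  by rewrite lerD2l ler_pM2l.
apply: (le_trans (up n x n0 _)); first by rewrite x_gt0 (le_trans tu).
rewrite -mulrA ler_pM2l// -powRM; [|by rewrite invr_ge0|by rewrite mulr_ge0// ltW].
apply: le_powRN2; [exact: ltW|by rewrite !mulr_gt0// invr_gt0|].
by rewrite mulrCA ler_pM2l// mulrC.
Qed.

Lemma L1_xi : L1 P (fun w => (xi w)%:R).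
Proof.
have mx : measurable_fun setT (fun w => (xi w)%:R : R).
  exact: (measurableT_comp (f := fun k : nat => k%:R : R)).
apply/integrableP; split; first exact/measurable_EFinP.
under eq_integral do rewrite /= normr_nat.
by have := cbp_mean model; rewrite expectation.unlock => ->; rewrite ltry.
Qed.

Lemma mean_xi : mean P (fun w => (xi w)%:R) = m.
Proof. by rewrite /mean (cbp_mean model). Qed.

(** Bernoulli's inequality s^k >= 1 - k (1 - s), integrated. *)
Lemma pgf_xi_ge s : 0 <= s <= 1 -> 1 - m * (1 - s) <= f s.
Proof.
move=> s01; have /andP[s0 s1] := s01.
rewrite -mean_xi /f /pgf_of -/(mean P _) mulrC.
apply: (@le_trans _ _ (mean P (fun w => 1 + - (1 - s) * (xi w)%:R))).
  rewrite meanD; [|exact: L1_cst|exact: L1Z L1_xi].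
  by rewrite mean_cst meanZ ?mulNr//; exact: L1_xi.
apply: le_mean; [|exact: L1_pgf|].
  by apply: L1D; [exact: L1_cst|exact: L1Z L1_xi].
move=> w; elim: (xi w) => [|k IH]; first by rewrite mulr0 addr0 expr0.
rewrite exprS -natr1; have : (1 - s) * 0 <= (1 - s) * k%:R by rewrite ler_wpM2l ?subr_ge0.
have : s * (1 + - (1 - s) * k%:R) <= s * s ^+ k by rewrite ler_wpM2l.
have : 0 <= (1 - s) * (1 - s) * k%:R by rewrite !mulr_ge0 ?subr_ge0.
nra.
Qed.

Let p := mean P (fun w => (0 < xi w)%N%:R).

Lemma prob_xi_gt0 : 0 < p <= 1.
Proof.
have L1p : L1 P (fun w => (0 < xi w)%N%:R).
  exact: (@L1_indic _ _ _ P xi (fun k => (0 < k)%N)).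
apply/andP; split; last first.
  rewrite -[leRHS](mean_cst P); apply: le_mean => //; first exact: L1_cst.
  by move=> w; rewrite lern1 leq_b1.
rewrite lt_neqAle eq_sym; apply/andP; split; last first.
  by rewrite /p mean_Rintegral; apply: Rintegral_ge0.
apply/eqP => p0.
have : ('E_P[fun w => (xi w)%:R] = 0)%E.
  apply: (mean_eq0 L1p) => //; last first.
    by move=> w; case: (xi w) => // k /eqP; rewrite oner_eq0.
  exact: (measurableT_comp (f := fun k : nat => k%:R : R)).
by rewrite (cbp_mean model) => -[mE]; move: m0; rewrite mE ltxx.
Qed.

Lemma pgf_xi_le s : 0 <= s <= 1 -> f s <= 1 - p * (1 - s).
Proof.
move=> s01; have /andP[s0 s1] := s01.
have L1p : L1 P (fun w => (0 < xi w)%N%:R).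
  exact: (@L1_indic _ _ _ P xi (fun k => (0 < k)%N)).
rewrite /f /pgf_of -/(mean P _) mulrC.
apply: (@le_trans _ _ (mean P (fun w => 1 + - (1 - s) * (0 < xi w)%N%:R))).
  apply: le_mean; [exact: L1_pgf|by apply: L1D; [exact: L1_cst|exact: L1Z]|].
  move=> w; case: (xi w) => [|k]; first by rewrite mulr0 addr0.
  rewrite mulr1 opprB addrC subrK exprS ler_piMr// exprn_ile1//.
rewrite meanD; [|exact: L1_cst|exact: L1Z].
by rewrite mean_cst meanZ ?mulNr.
Qed.

(* Since [pgf (N n) (f s) = pgf (X n.+1) s], the bounds for [N] come from those
   for [X] by comparing [f (expR (- v))] with [expR (- t)]. *)
Lemma laplace_N : laplace_bounds P sigma N.
Proof.
have [t0 [c [C [/andP[t00 t01] c0 C0 H]]]] := laplace_X.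
have /andP[p0 p1] := prob_xi_gt0.
have m2 : 0 < 2 * m by rewrite mulr_gt0.
pose t1 := Num.min (2 * m * t0) (p * t0 / 2).
have t1_gt0 : 0 < t1 by rewrite lt_min !mulr_gt0.
exists t1, (c * (1 + 4 / p) `^ (- sigma)), (C * (2 * m)^-1 `^ (- sigma)).
split=> //.
- rewrite t1_gt0 ge_min; apply/orP; right.
  have : p * t0 <= 1 * 1 by apply: ler_pM => //; exact: ltW.
  by lra.
- by rewrite mulr_gt0// powR_gt0// addr_gt0// divr_gt0.
- by rewrite mulr_gt0// powR_gt0// invr_gt0.
move=> n t n0 /andP[t_gt0]; rewrite le_min => /andP[tm tp].
have nR : 0 < n%:R :> R by rewrite ltr0n.
have n1R : 1 <= n%:R :> R by rewrite ler1n.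
have /andP[et0 et1] := expR_range (ltW t_gt0).
have pt0 : p * t0 <= 1 * 1 by apply: ler_pM => //; exact: ltW.
apply/andP; split.
  (* Then 1 - f(exp(- v)) >= p v/2 = t, whence f(exp(- v)) <= 1 - t <= exp(- t). *)
  pose v := 2 * t / p.
  have v_gt0 : 0 < v by rewrite divr_gt0// mulr_gt0.
  have vt0 : v <= t0 by rewrite ler_pdivrMr//; lra.
  have v01 : 0 <= v <= 1 by rewrite (ltW v_gt0) (le_trans vt0).
  have vr := expR_range (ltW v_gt0).
  have /andP[vl _] := expR_onem_bounds v01.
  have fv : f (expR (- v)) <= expR (- t).
    apply: le_trans (pgf_xi_le vr) _; apply: le_trans (expR_ge1Dx _).
    have : p * (v / 2) <= p * (1 - expR (- v)) by rewrite ler_pM2l.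
    have -> : p * (v / 2) = t by rewrite /v; field; rewrite lt0r_neq0.
    lra.
  apply: (@le_trans _ _ (pgf_of P (N n) (f (expR (- v))))); last first.
    by apply: le_pgf => //; have /andP[] := pgf_range P mxi vr.
  rewrite -(pgf_X_step model)//.
  have /andP[+ _] := H n.+1 v isT (introT andP (conj v_gt0 vt0)).
  apply: le_trans; rewrite -mulrA ler_pM2l// -powRM; last 2 first.
  - by rewrite addr_ge0// divr_ge0// ltW.
  - by rewrite addr_ge0// mulr_ge0// ltW.
  apply: le_powRN2; [exact: ltW| |].
    by rewrite ltr_wpDr// mulr_ge0// ltW.
  have -> : v = 2 / p * t by rewrite /v; ring.
  have q0 : 0 < 2 / p by rewrite divr_gt0.
  have -> : 4 / p = 2 * (2 / p) by ring.
  set q := 2 / p in q0 *.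
  have : q * t <= q * (n%:R * t) by rewrite ler_pM2l// ler_peMl// ltW.
  have : 0 < n%:R * t by rewrite mulr_gt0.
  by rewrite -natr1; nra.
(* Here 1 - f(exp(- v)) <= m v = t/2 <= 1 - exp(- t). The two terms of [t1] keep the two choices of
   v below [t0]. *)
pose v := t / (2 * m).
have v_gt0 : 0 < v by rewrite divr_gt0.
have vt0 : v <= t0 by rewrite ler_pdivrMr// mulrC.
have v01 : 0 <= v <= 1 by rewrite (ltW v_gt0) (le_trans vt0).
have vr := expR_range (ltW v_gt0).
have /andP[_ vu] := expR_onem_bounds v01.
have tt1 : 0 <= t <= 1 by apply/andP; split; lra.
have fv : expR (- t) <= f (expR (- v)).
  apply: le_trans (pgf_xi_ge vr).
  have /andP[tl _] := expR_onem_bounds tt1.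
  have : m * (1 - expR (- v)) <= m * v by rewrite ler_pM2l.
  have -> : m * v = t / 2 by rewrite /v; field; rewrite lt0r_neq0.
  lra.
apply: (@le_trans _ _ (pgf_of P (N n) (f (expR (- v))))).
  by apply: le_pgf => //; have /andP[] := pgf_range P mxi vr.
rewrite -(pgf_X_step model)//.
have /andP[_ +] := H n.+1 v isT (introT andP (conj v_gt0 vt0)).
move/le_trans; apply; rewrite -mulrA ler_pM2l// -powRM; last 2 first.
- by rewrite invr_ge0 ltW.
- by rewrite mulr_ge0// ltW.
apply: le_powRN2; [exact: ltW|by rewrite !mulr_gt0// invr_gt0|].
rewrite (_ : _ * (n%:R * t) = n%:R * v); last by rewrite /v; field; rewrite lt0r_neq0.
by rewrite ler_pM2r// ler_nat.
Qed.

End LaplaceBounds.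

(** * Ratio deviations *)

Section ExpBounds.
Context {R : realType}.
Implicit Types (y z : R).

Lemma expR_le_quadratic z : expR z <= 1 + z + z ^+ 2 * expR `|z|.
Proof.
have [z0|z0] := leP 0 z.
  have h : expR z - 1 <= z * expR z.
    have := expR_ge1Dx (- z); rewrite expRN => h.
    have : (1 - z) * expR z <= 1 by rewrite -ler_pdivlMr ?expR_gt0// div1r.
    lra.
  have : z * (expR z - 1) <= z * (z * expR z) by rewrite ler_wpM2l.
  rewrite ger0_norm//; lra.
have e1 : 1 <= expR `|z| by rewrite -expR0 ler_expR.
apply: (@le_trans _ _ (1 + z + z ^+ 2)); last first.
  by rewrite lerD2l ler_peMr// sqr_ge0.
have w0 : 0 < 1 + - z by lra.
rewrite -[z in expR z]opprK expRN.
apply: (@le_trans _ _ (1 - z)^-1); first by rewrite lef_pV2 ?posrE ?expR_gt0// expR_ge1Dx.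
rewrite -[leLHS]div1r ler_pdivrMr//.
have : 0 <= - z * z ^+ 2 by rewrite mulr_ge0 ?sqr_ge0//; lra.
nra.
Qed.

(** Beyond the truncation the left side is 0 while the linear term can be as low as - lam |y|; the
    summand lam / L compensates, since |y| <= y^2 / L there. The linear term is kept untruncated so
    that its mean vanishes exactly for centered y. *)
Lemma truncated_expR_le (theta lam L y : R) : 0 < L -> `|theta| = lam ->
  expR (theta * y) * (`|y| <= L)%R%:R <=
  1 + theta * y + y ^+ 2 * (lam ^+ 2 * expR (lam * L) + lam / L).
Proof.
move=> L0 tl; have lam0 : 0 <= lam by rewrite -tl.
have ly0 : 0 <= lam / L by rewrite divr_ge0// ltW.
have [yL|Ly] := leP `|y| L.
  rewrite mulr1 (le_trans (expR_le_quadratic _))// lerD2l mulrDr.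
  rewrite -[leLHS]addr0 lerD//; last by apply: mulr_ge0 => //; exact: sqr_ge0.
  rewrite exprMn -[theta ^+ 2]real_normK ?num_real// tl.
  rewrite [leRHS](_ : _ = lam ^+ 2 * y ^+ 2 * expR (lam * L)); last by ring.
  apply: ler_wpM2l; first by apply: mulr_ge0; exact: sqr_ge0.
  rewrite ler_expR normrM tl.
  by rewrite ler_wpM2l.
rewrite mulr0; have ty : - (lam * `|y|) <= theta * y.
  by rewrite -tl -normrM lerNl -normrN ler_norm.
have : lam * `|y| <= y ^+ 2 * (lam / L).
  rewrite -[y ^+ 2]real_normK ?num_real// mulrA ler_pdivlMr//.
  have : lam * `|y| * L <= lam * `|y| * `|y| by rewrite ler_wpM2l ?mulr_ge0// ltW.
  by move/le_trans; apply; rewrite le_eqVlt; apply/orP; left; apply/eqP; ring.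
have : 0 <= y ^+ 2 * (lam ^+ 2 * expR (lam * L)).
  apply: mulr_ge0; first exact: sqr_ge0.
  by apply: mulr_ge0; [exact: sqr_ge0|exact: expR_ge0].
rewrite mulrDr; lra.
Qed.

End ExpBounds.

(** * Offspring sums on a cell *)

Section OffspringDeviations.
Context {R : realType} {d : measure_display} {T : measurableType d}.
Variables (P : probability T R) (m : R) (xi : {RV P >-> nat})
  (phi : nat -> {RV P >-> nat}) (X0 : {RV P >-> nat})
  (Xi Phi : nat -> nat -> {RV P >-> nat}).
Hypothesis model : cbp_model m xi phi X0 Xi Phi.

Let X := popX X0 (fun n j => Xi n j) (fun n k => Phi n k).
Let N := popN X0 (fun n j => Xi n j) (fun n k => Phi n k).
Let C n k i := cell X0 Xi Phi n k i.
Let mX n : measurable_fun setT (X n) := measurable_X model n.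
Let V := mean P (fun w => ((xi w)%:R - m) ^+ 2).

Lemma truncated_mgf_le (theta lam L : R) : 0 < L -> `|theta| = lam ->
  L1 P (fun w => ((xi w)%:R - m) ^+ 2) ->
  exists2 c, 0 <= c <= expR (V * (lam ^+ 2 * expR (lam * L) + lam / L)) &
    (\int[P]_w (expR (theta * ((xi w)%:R - m)) *
       (`|(xi w)%:R - m| <= L)%R%:R)%:E = c%:E)%E.
Proof.
move=> L0 tl L1V; pose g x := expR (theta * (x%:R - m)) * (`|x%:R - m| <= L)%R%:R.
have g0 x : 0 <= g x by rewrite mulr_ge0// expR_ge0.
have L1g : L1 P (fun w => g (xi w)).
  apply: (@L1_nat _ _ _ _ _ g (expR (lam * L))) => // x.
  rewrite ger0_norm// /g; case: (leP `|x%:R - m| L) => [xL|_]; last by rewrite mulr0 expR_ge0.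
  rewrite mulr1 ler_expR (le_trans (ler_norm _))// normrM tl.
  by rewrite ler_wpM2l// -tl.
exists (mean P (fun w => g (xi w))); last first.
  by have := meanE L1g; rewrite expectation.unlock.
apply/andP; split; first by rewrite mean_Rintegral; apply: Rintegral_ge0.
set kap := _ + _; apply: le_trans (expR_ge1Dx _).
have L1x : L1 P (fun w => (xi w)%:R - m).
  by apply: (L1D (g := fun=> - m)); [exact: L1_xi model|exact: L1_cst].
have mean0 : mean P (fun w => (xi w)%:R - m) = 0.
  rewrite meanD; [|exact: L1_xi model|exact: L1_cst].
  by rewrite mean_cst (mean_xi model) subrr.
have -> : 1 + V * kap =
    mean P (fun w => 1 + theta * ((xi w)%:R - m) + kap * ((xi w)%:R - m) ^+ 2).
  rewrite meanD; [|by apply: L1D; [exact: L1_cst|exact: L1Z]|exact: L1Z].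
  rewrite meanD; [|exact: L1_cst|exact: L1Z].
  by rewrite mean_cst !meanZ// mean0 mulr0 addr0 mulrC.
apply: le_mean => //.
  by apply: L1D; [apply: L1D; [exact: L1_cst|exact: L1Z]|exact: L1Z].
by move=> w; rewrite (mulrC kap); exact: truncated_expR_le.
Qed.

(** Either some |x_i| exceeds L and the last sum is at least 1, or no factor is cut off and g theta
    = exp(theta S); the sign of S then decides which of the two exponential terms is at least 1. *)
Lemma deviation_indicator_le (I : finType) (x : I -> R) (lam L a : R) :
  let S := \sum_i x i in
  let g theta := \prod_i (expR (theta * x i) * (`|x i| <= L)%R%:R) in
  0 <= lam ->
  (a < `|S|)%R%:R <= expR (- (lam * a)) * g lam + expR (- (lam * a)) * g (- lam)
    + \sum_i (L < `|x i|)%R%:R.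
Proof.
move=> S g lam0.
have g0 theta : 0 <= g theta by apply: prodr_ge0 => i _; rewrite mulr_ge0// expR_ge0.
have e0 : 0 <= expR (- (lam * a)) by exact: expR_ge0.
have s0 : 0 <= \sum_i (L < `|x i|)%R%:R :> R by apply: sumr_ge0.
have [aS|_] := ltP a `|S|; last by rewrite !addr_ge0// mulr_ge0.
have [/existsP[i Li]|/existsPn all] := boolP [exists i, L < `|x i|].
  have : 1 <= \sum_i (L < `|x i|)%R%:R :> R.
    by rewrite (bigD1 i)//= Li lerDl; apply: sumr_ge0.
  by move/le_trans; apply; rewrite lerDr addr_ge0// mulr_ge0.
have gE theta : g theta = expR (theta * S).
  rewrite /g /S mulr_sumr expR_sum; apply: eq_bigr => i _.
  by have := all i; rewrite -leNgt => ->; rewrite mulr1.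
rewrite !gE -!expRD; apply: ler_wpDr => //.
have [S0|S0] := leP 0 S.
  rewrite ler_wpDr ?expR_ge0// -expR0 ler_expR addrC subr_ge0 ler_wpM2l//.
  by rewrite ltW// -(ger0_norm S0).
rewrite ler_wpDl ?expR_ge0// -expR0 ler_expR mulNr -mulrN addrC subr_ge0.
by rewrite ler_wpM2l// ltW// -(ltr0_norm S0).
Qed.

(** The pointwise bound is integrated over the cell, where each product of truncated exponentials
    factorizes into the i-th power of one truncated moment generating function. *)
Lemma measure_cell_deviation n k i (lam L a : R) : 0 <= lam -> 0 < L ->
  L1 P (fun w => ((xi w)%:R - m) ^+ 2) ->
  (P (C n k i `&` X n.+1 @^-1` [set x : nat | (a < `|x%:R - i%:R * m|)%R]) <=
   P (C n k i) *
   (2 * (expR (- (lam * a)) *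
      expR (i%:R * (V * (lam ^+ 2 * expR (lam * L) + lam / L)))) +
    i%:R * mean P (fun w => (L < `|(xi w)%:R - m|)%R%:R))%R%:E)%E.
Proof.
move=> lam0 L0 L1V.
set kap := lam ^+ 2 * _ + lam / L.
set pi := mean P (fun w => (L < _)%R%:R); set B := X n.+1 @^-1` _.
have mC : measurable (C n k i) := measurable_cell model n k i.
have mB : measurable B by rewrite -[B]setTI; exact: mX.
have nl : `|lam| = lam by rewrite ger0_norm.
have nNl : `|- lam| = lam by rewrite normrN.
have [c1 /andP[c10 c1u] gc1] := truncated_mgf_le L0 nl L1V.
have [c2 /andP[c20 c2u] gc2] := truncated_mgf_le L0 nNl L1V.
pose g theta x := expR (theta * (x%:R - m)) * (`|x%:R - m| <= L)%R%:R.
have g0 theta x : 0 <= g theta x by rewrite mulr_ge0// expR_ge0.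
pose G theta w := \prod_(j < i) g theta (Xi n j w).
have G0 theta w : 0 <= G theta w by apply: prodr_ge0.
have mG theta : measurable_fun setT (fun w => (G theta w)%:E : \bar R).
  apply/measurable_EFinP; apply: measurable_prod => j _.
  exact: (measurableT_comp (f := g theta)).
pose e := expR (- (lam * a)).
have e0 : 0 <= e by exact: expR_ge0.
pose b (j : nat) w : R := (L < `|(Xi n j w)%:R - m|)%R%:R.
have mb j : measurable_fun setT (fun w => (b j w)%:E : \bar R).
  apply/measurable_EFinP.
  exact: (measurableT_comp (f := fun x : nat => (L < `|x%:R - m|)%R%:R : R)).
have mTS (h : T -> \bar R) : measurable_fun setT h -> measurable_fun (C n k i) h.
  exact: measurable_funTS.
have meG theta : measurable_fun (C n k i) (fun w => e%:E * (G theta w)%:E)%E.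
  by apply: mTS; apply: measurable_funeM.
have msb : measurable_fun (C n k i) (fun w => \sum_(j < i) (b j w)%:E)%E.
  by apply: mTS; apply: emeasurable_sum => j; exact: mb.
have intb (j : 'I_i) : (\int[P]_(w in C n k i) (b j w)%:E = P (C n k i) * pi%:E)%E.
  pose D := [set x : nat | L < `|x%:R - m|].
  have inD (Y : T -> nat) w : (w \in Y @^-1` D) = (L < `|(Y w)%:R - m|)%R.
    by apply/idP/idP => [/set_mem//|h]; rewrite mem_set.
  have -> : (fun w => (b j w)%:E : \bar R) = (fun w => (\1_(Xi n j @^-1` D) w)%:E).
    by apply/funext => w; rewrite /b indicE inD.
  have mD (Y : {RV P >-> nat}) : measurable (Y @^-1` D).
    by rewrite -[X in measurable X]setTI; exact: measurable_funPT.
  rewrite integral_indic// setIC.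
  transitivity (P (C n k i) * P (xi @^-1` D))%E.
    exact: (measure_cell_offspring model).
  congr mule.
  rewrite -[LHS](expectation_indic P)// /pi -meanE; last first.
    exact: (@L1_indic _ _ _ P xi (fun x => (L < `|x%:R - m|)%R)).
  by congr ('E_P[ _ ])%E; apply/funext => w; rewrite indicE inD.
rewrite setIC -integral_indic//.
apply: (@le_trans _ _ (\int[P]_(w in C n k i)
    (e%:E * (G lam w)%:E + e%:E * (G (- lam) w)%:E + \sum_(j < i) (b j w)%:E))%E).
  apply: ge0_le_integral => //.
  - by apply: mTS; apply/measurable_EFinP; exact: measurable_indic.
  - apply: emeasurable_funD => //; exact: emeasurable_funD.
  move=> w Cw; rewrite -!EFinM sumEFin -!EFinD lee_fin.
  have := @deviation_indicator_le 'I_i (fun j => (Xi n j w)%:R - m) lam L a lam0.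
  rewrite /= -/(G lam w) -/(G (- lam) w); apply: le_trans.
  have -> : \sum_(j < i) ((Xi n j w)%:R - m) = (X n.+1 w)%:R - i%:R * m.
    rewrite sumrB sumr_const card_ord mulr_natl -natr_sum.
    by have [_ /= <-] := Cw.
  rewrite indicE; have [/set_mem Bw|_] := boolP (w \in B); last exact: ler0n.
  by rewrite (Bw : is_true (a < `|(X n.+1 w)%:R - i%:R * m|)).
rewrite ge0_integralD//; last 3 first.
- by move=> w _; rewrite adde_ge0// mule_ge0// lee_fin.
- exact: emeasurable_funD.
- by move=> w _; apply: sume_ge0 => j _; rewrite lee_fin.
rewrite ge0_integralD//; last 2 first.
- by move=> w _; rewrite mule_ge0// lee_fin.
- by move=> w _; rewrite mule_ge0// lee_fin.
rewrite !ge0_integralZl ?lee_fin//; last 4 first.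
- exact: mTS.
- by move=> w _; rewrite lee_fin.
- exact: mTS.
- by move=> w _; rewrite lee_fin.
rewrite (@integral_cell_prod _ _ _ _ _ _ _ _ _ _ model n k i (g lam) c1 (g0 lam) gc1).
rewrite (@integral_cell_prod _ _ _ _ _ _ _ _ _ _ model n k i (g (- lam)) c2 (g0 _) gc2).
rewrite ge0_integral_sum//; last 2 first.
- by move=> j; exact: (mTS _ (mb j)).
- by move=> j w _; rewrite lee_fin.
under eq_bigr do rewrite intb.
have PC : P (C n k i) \is a fin_num by exact: fin_num_measure.
rewrite -/(C n k i) -(fineK PC) -!EFinM sumEFin -!EFinD -?EFinM lee_fin.
rewrite sumr_const card_ord -mulr_natl.
have c1i : c1 ^+ i <= expR (i%:R * (V * kap)).
  by rewrite expRM_natl lerXn2r// nnegrE expR_ge0.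
have c2i : c2 ^+ i <= expR (i%:R * (V * kap)).
  by rewrite expRM_natl lerXn2r// nnegrE expR_ge0.
have pc0 : 0 <= fine (P (C n k i)) by apply: fine_ge0.
set pc := fine _ in pc0 *; set E := expR (i%:R * _) in c1i c2i *.
rewrite (_ : _ + _ = pc * (e * c1 ^+ i + e * c2 ^+ i + i%:R * pi)); last by ring.
rewrite ler_wpM2l// lerD2r.
have : e * c1 ^+ i <= e * E by rewrite ler_wpM2l.
have : e * c2 ^+ i <= e * E by rewrite ler_wpM2l.
by rewrite -/e; lra.
Qed.

End OffspringDeviations.

(** * Ratio deviations bounded by harmonic moments *)

Section RatioDeviations.
Context {R : realType} {d : measure_display} {T : measurableType d}.
Variables (P : probability T R) (m tau : R) (xi : {RV P >-> nat})
  (phi : nat -> {RV P >-> nat}) (X0 : {RV P >-> nat})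
  (Xi Phi : nat -> nat -> {RV P >-> nat}).
Hypothesis model : cbp_model m xi phi X0 Xi Phi.
Hypothesis tau0 : 0 < tau.

Let X := popX X0 (fun n j => Xi n j) (fun n k => Phi n k).
Let N := popN X0 (fun n j => Xi n j) (fun n k => Phi n k).
Let C n k i := cell X0 Xi Phi n k i.
Let mX n : measurable_fun setT (X n) := measurable_X model n.
Let mN n : measurable_fun setT (N n) := measurable_N model n.
Let V := mean P (fun w => ((xi w)%:R - m) ^+ 2).
Let m0 : 0 < m := cbp_mean_gt0 model.

Let norm_ratio (b k c : R) : 0 < k -> `|b / k - c| * k = `|b - c * k|.
Proof.
move=> k0; rewrite -[X in _ * X = _](gtr0_norm k0) -normrM mulrBl.
by rewrite divfK// lt0r_neq0.
Qed.

Lemma L1_dom (g h : T -> R) : measurable_fun setT g ->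
  (forall w, 0 <= g w <= h w) -> L1 P h -> L1 P g.
Proof.
move=> mg gh h1; apply: (le_integrable measurableT _ _ h1) => //.
  exact/measurable_EFinP.
move=> w _ /=; have /andP[g0 gw] := gh w.
by rewrite lee_fin !ger0_norm// (le_trans g0).
Qed.

Lemma L1_ge0 (g : T -> R) : measurable_fun setT g -> (forall w, 0 <= g w) ->
  ('E_P[g] < +oo)%E -> L1 P g.
Proof.
move=> mg g0 gfin; apply/integrableP; split; first exact/measurable_EFinP.
under eq_integral do rewrite /= ger0_norm//.
by move: gfin; rewrite expectation.unlock.
Qed.

Lemma measurable_xi_fun (g : nat -> R) : measurable_fun setT (fun w => g (xi w)).
Proof. exact: (measurableT_comp (f := g)). Qed.

Section MomentBound.
Variable q : R.
Hypothesis q1 : 1 <= q.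
Hypothesis xi_moment : ('E_P[fun w => (`|(xi w)%:R - m| `^ (2 * q))%R] < +oo)%E.

Lemma L1_xi_moment : L1 P (fun w => `|(xi w)%:R - m| `^ (2 * q)).
Proof.
apply: L1_ge0 => //.
exact: (measurable_xi_fun (fun x => `|x%:R - m| `^ (2 * q))).
Qed.

Lemma L1_xi_square : L1 P (fun w => ((xi w)%:R - m) ^+ 2).
Proof.
apply: (@L1_dom _ (fun w => 1 + `|(xi w)%:R - m| `^ (2 * q))).
- exact: (measurable_xi_fun (fun x => (x%:R - m) ^+ 2)).
- move=> w; rewrite sqr_ge0 /= -[_ ^+ 2]real_normK ?num_real//.
  set y := `|_|; have y0 : 0 <= y by exact: normr_ge0.
  have [y1|y1] := leP y 1.
    by rewrite -[leLHS]addr0 lerD ?powR_ge0// exprn_ile1.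
  rewrite -[leLHS]add0r lerD// -powR_mulrn//.
  apply: ler_powR; first exact: ltW.
  by move: q1; lra.
- by apply: L1D; [exact: L1_cst|exact: L1_xi_moment].
Qed.

Let mu := mean P (fun w => `|(xi w)%:R - m| `^ (2 * q)).

Lemma xi_markov (L : R) : 0 < L ->
  mean P (fun w => (L < `|(xi w)%:R - m|)%R%:R) <= mu * L `^ (- (2 * q)).
Proof.
move=> L0; have Lq : 0 < L `^ (2 * q) by exact: powR_gt0.
rewrite powRN ler_pdivlMr// mulrC -meanZ; last first.
  exact: (@L1_indic _ _ _ P xi (fun x => (L < `|x%:R - m|)%R)).
apply: le_mean; [|exact: L1_xi_moment|].
  apply: L1Z; exact: (@L1_indic _ _ _ P xi (fun x => (L < `|x%:R - m|)%R)).
move=> w; have [Ly|_] := ltP L `|(xi w)%:R - m|; last by rewrite mulr0 powR_ge0.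
rewrite mulr1; apply: le_powR2; [|exact: ltW|exact: ltW].
by move: q1; lra.
Qed.

(* Fuk-Nagaev: truncate the offspring at level [delta K] and use the Chernoff
   bound with [lambda = (q / eps) ln K / K]. *)
Lemma offspring_deviation (eps M : R) : 0 < eps -> 0 <= M ->
  exists2 D : R, 0 <= D & forall n k i K, (0 < K)%N -> i%:R <= M * K%:R ->
    (P (C n k i `&` X n.+1 @^-1` [set x : nat | (eps * K%:R < `|x%:R - i%:R * m|)%R])
      <= P (C n k i) * (D * K%:R `^ (- q))%:E)%E.
Proof.
move=> eps0 M0; have q0 : 0 < q by move: q1; lra.
(* [delta] is tuned to give lam L = (ln K)/2. Then exp(lam L) = K^(1/2), so K lam^2 exp(lam L) = c^2
   (ln K)^2 / K^(1/2) stays bounded, while exp(- lam eps K) = K^(-q). *)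
pose c := q / eps; pose delta := eps / (2 * q).
have c0 : 0 < c by rewrite divr_gt0.
have delta0 : 0 < delta by rewrite divr_gt0// mulr_gt0.
have V0 : 0 <= V by rewrite /V mean_Rintegral; apply: Rintegral_ge0 => w _; exact: sqr_ge0.
have mu0 : 0 <= mu by rewrite /mu mean_Rintegral; apply: Rintegral_ge0 => w _; exact: powR_ge0.
pose E := expR (M * V * (16 * c ^+ 2 + c / delta)).
exists (2 * E + M * mu * delta `^ (- (2 * q))).
  apply: addr_ge0; first by rewrite mulr_ge0// expR_ge0.
  by rewrite !mulr_ge0// powR_ge0.
move=> n k i K K0 iK.
have KR : 0 < K%:R :> R by rewrite ltr0n.
have K1 : 1 <= K%:R :> R by rewrite ler1n.
pose lam := c * ln K%:R / K%:R; pose L := delta * K%:R.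
have w0 : 0 <= ln K%:R :> R by exact: ln_ge0.
have lam0 : 0 <= lam by rewrite divr_ge0// mulr_ge0// ltW.
have L0 : 0 < L by rewrite mulr_gt0.
apply: le_trans (measure_cell_deviation model n k i _ lam0 L0 L1_xi_square) _.
rewrite -/(C n k i) lee_wpmul2l// lee_fin [leRHS]mulrDl; apply: lerD.
  rewrite -[leRHS]mulrA ler_pM2l// mulrC; apply: ler_pM; rewrite ?expR_ge0//; last first.
    rewrite /powR gt_eqF// ler_expR mulNr lerN2.
    by rewrite /lam /c le_eqVlt; apply/orP; left; apply/eqP; field; rewrite !lt0r_neq0.
  rewrite ler_expR -/V.
  set w := ln K%:R in w0.
  have KE : K%:R = expR (w / 2) * expR (w / 2) :> R.
    by rewrite -expRD (_ : w / 2 + w / 2 = w) ?lnK ?posrE//; field.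
  set z := expR (w / 2) in KE.
  have z0 : 0 < z by exact: expR_gt0.
  have wz : w ^+ 2 <= 16 * z.
    have -> : z = expR (w / 4) ^+ 2 by rewrite expr2 -expRD; congr expR; field.
    have : w / 4 <= expR (w / 4) by have := expR_ge1Dx (w / 4); lra.
    have : 0 <= w / 4 by rewrite divr_ge0.
    nra.
  have wK : w <= K%:R.
    by have := expR_ge1Dx w; rewrite lnK ?posrE//; lra.
  have lamL : lam * L = w / 2.
    by rewrite /lam /L /c /delta -/w; field; rewrite !lt0r_neq0.
  rewrite lamL -/z.
  have t1 : K%:R * (lam ^+ 2 * z) <= 16 * c ^+ 2.
    have -> : K%:R * (lam ^+ 2 * z) = c ^+ 2 * (w ^+ 2 / z).
      by rewrite /lam -/w KE; field; rewrite lt0r_neq0.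
    by rewrite [leRHS]mulrC ler_pM2l ?exprn_gt0// ler_pdivrMr.
  have t2 : K%:R * (lam / L) <= c / delta.
    have -> : K%:R * (lam / L) = c / delta * (w / K%:R).
      by rewrite /lam /L -/w; field; rewrite !lt0r_neq0.
    apply: ler_piMr; first by apply: ltW; rewrite divr_gt0.
    by rewrite ler_pdivrMr// mul1r.
  have kap0 : 0 <= V * (lam ^+ 2 * z + lam / L).
    apply: mulr_ge0 => //; apply: addr_ge0; last by rewrite divr_ge0// ltW.
    by apply: mulr_ge0; [exact: sqr_ge0|exact: ltW].
  apply: (@le_trans _ _ (M * K%:R * (V * (lam ^+ 2 * z + lam / L)))).
    by rewrite ler_wpM2r.
  rewrite [leLHS](_ : _ = M * V * (K%:R * (lam ^+ 2 * z) + K%:R * (lam / L))); last by ring.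
  by rewrite ler_wpM2l ?mulr_ge0// lerD.
(* One large summand: i P(|xi - m| > L) is of order K^(1 - 2q), which is at most K^(-q) because q >=
   1. *)
apply: (@le_trans _ _ (M * K%:R * (mu * L `^ (- (2 * q))))).
  apply: ler_pM => //; last exact: xi_markov.
  by rewrite mean_Rintegral; apply: Rintegral_ge0 => w _; exact: ler0n.
rewrite /L powRM ?(ltW delta0)//.
rewrite [leLHS](_ : _ = M * mu * delta `^ (- (2 * q)) *
  (K%:R * K%:R `^ (- (2 * q)))); last by ring.
rewrite ler_wpM2l ?mulr_ge0 ?powR_ge0//.
rewrite -{1}(powRr1 (ltW KR)) -powRD_gt0//.
by apply: ler_powR => //; move: q1; lra.
Qed.

Local Notation hm Y n :=
  (mean P (fun w => (Y n w)%:R `^ (- q) * (0 < Y n w)%N%:R)).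

(** The deviations of the control functions enter only in this form, which the moment condition and
    the exponential condition can each supply. *)
Hypothesis control_tail : forall eps : R, 0 < eps -> exists2 D : R, 0 <= D &
  forall k, (0 < k)%N ->
    (P (phi k @^-1` [set i : nat | (eps < `|i%:R / k%:R - tau|)%R]) <=
     (D * k%:R `^ (- q))%:E)%E.

Let q0 : 0 < q. Proof. by move: q1; lra. Qed.

Let hm_integral (Y : nat -> T -> nat) n (D : R) : measurable_fun setT (Y n) -> 0 <= D ->
  (\int[P]_w (D * ((Y n w)%:R `^ (- q) * (0 < Y n w)%N%:R))%:E = (D * hm Y n)%:E)%E.
Proof.
move=> mY D0; rewrite -meanZ; last exact: L1_hm.
have := meanE (L1Z D (L1_hm P q0 mY)).
by rewrite expectation.unlock.
Qed.

Let hm_fun_ge0 (Y : nat -> T -> nat) n (D : R) w : 0 <= D ->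
  0 <= D * ((Y n w)%:R `^ (- q) * (0 < Y n w)%N%:R).
Proof. by move=> D0; rewrite !mulr_ge0// powR_ge0. Qed.

Let hm_fun_meas (Y : nat -> T -> nat) n (D : R) : measurable_fun setT (Y n) ->
  measurable_fun setT
    (fun w => (D * ((Y n w)%:R `^ (- q) * (0 < Y n w)%N%:R))%:E : \bar R).
Proof.
move=> mY; apply/measurable_EFinP.
exact: (measurableT_comp (f := fun k : nat => D * (k%:R `^ (- q) * (0 < k)%N%:R))).
Qed.

Lemma measure_le_hm (Y : nat -> T -> nat) n (E : set T) (D : R) :
  measurable E -> measurable_fun setT (Y n) -> 0 <= D ->
  (forall k i, (P (C n k i `&` E) <= \int[P]_(w in C n k i)
     (D * ((Y n w)%:R `^ (- q) * (0 < Y n w)%N%:R))%:E)%E) ->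
  (P E <= (D * hm Y n)%:E)%E.
Proof.
move=> mE mY D0 HE; rewrite -hm_integral//.
rewrite -[X in P X]setIT -integral_indic//.
apply: (ge0_le_integral_cell model (n := n)).
- by apply/measurable_EFinP; exact: measurable_indic.
- exact: hm_fun_meas.
- by move=> w; rewrite lee_fin.
- by move=> w; rewrite lee_fin; exact: hm_fun_ge0.
move=> k i; rewrite integral_indic//; last exact: (measurable_cell model).
by rewrite setIC; exact: HE.
Qed.

Let cell_hm_X n k i (D : R) : (0 < k)%N ->
  (\int[P]_(w in C n k i) (D * ((X n w)%:R `^ (- q) * (0 < X n w)%N%:R))%:E
   = P (C n k i) * (D * k%:R `^ (- q))%:E)%E.
Proof.
move=> k0; transitivity (\int[P]_(w in C n k i) cst (D * k%:R `^ (- q))%:E w)%E.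
  by apply: eq_integral => w /set_mem[Xk _]; rewrite (Xk : X n w = k) k0 mulr1.
by rewrite integral_cst; [exact: muleC|exact: (measurable_cell model)].
Qed.

Let cell_hm_N n k i (D : R) : (0 < i)%N ->
  (\int[P]_(w in C n k i) (D * ((N n w)%:R `^ (- q) * (0 < N n w)%N%:R))%:E
   = P (C n k i) * (D * i%:R `^ (- q))%:E)%E.
Proof.
move=> i0; transitivity (\int[P]_(w in C n k i) cst (D * i%:R `^ (- q))%:E w)%E.
  by apply: eq_integral => w /set_mem[_ Ni]; rewrite (Ni : N n w = i) i0 mulr1.
by rewrite integral_cst; [exact: muleC|exact: (measurable_cell model)].
Qed.

Let measurable_ratio (A B : T -> nat) (S : nat -> nat -> bool) :
  measurable_fun setT A -> measurable_fun setT B ->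
  measurable [set w | S (A w) (B w)].
Proof.
move=> mA mB.
rewrite -(bigcup_level [set w | S (A w) (B w)] A).
apply: bigcup_measurable => a _.
rewrite (_ : _ `&` _ = A @^-1` [set a] `&` B @^-1` [set b | S a b]); last first.
  apply/seteqP; split=> w; first by move=> [Sw /= Aa]; split=> //=; rewrite -Aa.
  by move=> [/= Aa Sb]; split=> //=; rewrite Aa.
apply: measurableI; first exact: measurable_level.
by rewrite -[X in measurable X]setTI; exact: mB.
Qed.

Let ratio_measurable (c eps : R) (A B : T -> nat) :
  measurable_fun setT A -> measurable_fun setT B ->
  measurable [set w | (0 < A w)%N /\ eps < `|(B w)%:R / (A w)%:R - c|].
Proof.
move=> mA mB.
have := measurable_ratio (fun a b => (0 < a)%N && (eps < `|b%:R / a%:R - c|)) mA mB.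
congr measurable; apply/seteqP; split=> w /=; first by move=> /andP[].
by move=> [-> ->].
Qed.

Lemma J1_bound (eps : R) : 0 < eps -> exists2 D : R, 0 <= D &
  forall n, (Jdev P m tau X N J1 eps n <= (D * hm N n)%:E)%E.
Proof.
move=> eps0; have [D D0 HD] := offspring_deviation eps0 ler01.
exists D => // n; apply: measure_le_hm => //; first exact: ratio_measurable.
move=> k i; have [i0|] := posnP i.
  rewrite (_ : _ `&` _ = set0).
    by rewrite measure0; apply: integral_ge0 => w _; rewrite lee_fin; exact: hm_fun_ge0.
  apply/seteqP; split=> // w [[_ Ni] [N0 _]].
  by move: N0; rewrite (Ni : N n w = i) i0.
move=> i0; rewrite cell_hm_N//; apply: le_trans (HD n k i i i0 _); last by rewrite mul1r.
have iR : 0 < i%:R :> R by rewrite ltr0n.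
apply: le_measure; rewrite ?inE.
- apply: measurableI; [exact: (measurable_cell model)|exact: ratio_measurable].
- apply: measurableI; first exact: (measurable_cell model).
  by rewrite -[X in measurable X]setTI; exact: mX.
move=> w [Cw [_ /= dev]]; split=> //=; move: dev; have [_ Ni] := Cw.
rewrite (Ni : N n w = i).
by rewrite -(ltr_pM2r iR) norm_ratio// (mulrC m).
Qed.

Lemma J2_bound (eps : R) : 0 < eps -> exists2 D : R, 0 <= D &
  forall n, (Jdev P m tau X N J2 eps n <= (D * hm X n)%:E)%E.
Proof.
move=> eps0; have [D D0 HD] := control_tail eps0.
exists D => // n; rewrite -hm_integral//.
have mE := @ratio_measurable tau eps _ _ (mX n) (mN n).
rewrite /Jdev /ratio_dev -[X in P X]setIT -integral_indic//.
apply: (ge0_le_integral_level (Z := X n)) => //.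
- by apply/measurable_EFinP; exact: measurable_indic.
- exact: hm_fun_meas.
- by move=> w; rewrite lee_fin; exact: hm_fun_ge0.
move=> w0; have [k0|] := posnP (X n w0).
  rewrite k0 integral_indic//; last exact: measurable_level.
  rewrite (_ : _ `&` _ = set0).
    by rewrite measure0; apply: integral_ge0 => w _; rewrite lee_fin; exact: hm_fun_ge0.
  apply/seteqP; split=> // w [[Xw _] Xw0].
  by move: Xw; rewrite (Xw0 : X n w = 0%N).
move: (X n w0) => k k0; have mk : measurable (X n @^-1` [set k]) by exact: measurable_level.
rewrite integral_indic// setIC.
rewrite [leRHS](_ : _ = \int[P]_(w in X n @^-1` [set k]) cst (D * k%:R `^ (- q))%:E w)%E;
  last by apply: eq_integral => w /set_mem Xk; rewrite (Xk : X n w = k) k0 mulr1.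
rewrite integral_cst// muleC.
apply: (@le_trans _ _ (P (X n @^-1` [set k]) *
    P (phi k @^-1` [set i : nat | (eps < `|i%:R / k%:R - tau|)%R]))%E); last first.
  by rewrite lee_wpmul2l// HD.
rewrite -(measure_X_control model) le_measure ?inE//.
- exact: measurableI.
- apply: measurableI => //.
  by rewrite -[X in measurable X]setTI; exact: measurable_funPT.
by move=> w [/= <- [_ dev]].
Qed.

(** On a cell, X_(n+1) - m tau k = (X_(n+1) - m i) + m (i - tau k). Outside the control deviation
    [E2] the second term is at most (eps/2) k, so the first exceeds (eps/2) k. The offspring bound
    is applied with K = k, since i may be small, even 0. *)
Lemma J3_bound (eps : R) : 0 < eps -> exists2 D : R, 0 <= D &
  forall n, (Jdev P m tau X N J3 eps n <= (D * hm X n)%:E)%E.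
Proof.
move=> eps0; have eps2 : 0 < eps / 2 by rewrite divr_gt0.
(* The first term limits the control error to eps/2; the second yields N_n <= 2 tau X_n off [E2],
   the linear bound that [offspring_deviation] asks for. *)
pose e' := Num.min (eps / (2 * m)) tau.
have e'0 : 0 < e' by rewrite lt_min tau0 andbT divr_gt0// mulr_gt0.
have [e'm e't] : e' <= eps / (2 * m) /\ e' <= tau.
  by rewrite /e' !ge_min !lexx orbT.
have [D1 D10 H1] := J2_bound e'0.
have tt0 : 0 <= 2 * tau by rewrite mulr_ge0// ltW.
have [D2 D20 H2] := offspring_deviation eps2 tt0.
exists (D1 + D2); first exact: addr_ge0.
move=> n; pose E2 := [set w | (0 < X n w)%N /\ e' < `|(N n w)%:R / (X n w)%:R - tau|].
pose E3 := [set w | (0 < X n w)%N /\ eps < `|(X n.+1 w)%:R / (X n w)%:R - m * tau|].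
have mE2 : measurable E2 by exact: ratio_measurable.
have mE3 : measurable E3 by exact: ratio_measurable.
rewrite mulrDl EFinD; apply: (@le_trans _ _ (P E2 + P (E3 `\` E2))%E).
  rewrite -measureU//; last 2 first.
  - exact: measurableD.
  - by rewrite setDE setICA setICr setI0.
  rewrite /Jdev /ratio_dev -/E3; apply: le_measure; rewrite ?inE//.
    by apply: measurableU => //; exact: measurableD.
  by move=> w E3w; have [E2w|nE2w] := pselect (E2 w); [left|right; split].
apply: leeD; first exact: H1.
apply: measure_le_hm => //; first exact: measurableD.
move=> k i; have [k0|] := posnP k.
  rewrite (_ : _ `&` _ = set0).
    by rewrite measure0; apply: integral_ge0 => w _; rewrite lee_fin; exact: hm_fun_ge0.
  apply/seteqP; split=> // w [[Xk _] [[X0w _] _]].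
  by move: X0w; rewrite (Xk : X n w = k) k0.
move=> k0; rewrite cell_hm_X//.
have kR : 0 < k%:R :> R by rewrite ltr0n.
have [dev|small] := ltP e' `|i%:R / k%:R - tau|.
  rewrite (_ : _ `&` _ = set0).
    by rewrite measure0 mule_ge0// lee_fin mulr_ge0// powR_ge0.
  apply/seteqP; split=> // w [[Xk Nk] [_ nE2]]; apply: nE2.
  by rewrite /E2 /= (Xk : X n w = k) (Nk : N n w = i).
have small' : `|i%:R - tau * k%:R| <= e' * k%:R.
  by rewrite -norm_ratio// ler_pM2r.
have ik : i%:R <= 2 * tau * k%:R.
  have : e' * k%:R <= tau * k%:R by rewrite ler_pM2r.
  by move: small'; rewrite ler_norml => /andP[_]; lra.
apply: le_trans (H2 n k i k k0 ik).
apply: le_measure; rewrite ?inE.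
- apply: measurableI; [exact: (measurable_cell model)|exact: measurableD].
- apply: measurableI; first exact: (measurable_cell model).
  by rewrite -[X in measurable X]setTI; exact: mX.
move=> w [Cw [[_ dev] _]]; split=> //.
suff : eps / 2 * k%:R < `|(X n.+1 w)%:R - i%:R * m| by [].
have {}dev : eps * k%:R < `|(X n.+1 w)%:R - m * tau * k%:R|.
  by rewrite -norm_ratio// ltr_pM2r//; have [Xk _] := Cw; rewrite -(Xk : X n w = k).
have : `|i%:R * m - m * tau * k%:R| <= eps / 2 * k%:R.
  rewrite (_ : _ - _ = m * (i%:R - tau * k%:R)); last by ring.
  rewrite normrM (gtr0_norm m0) -ler_pdivlMl// (le_trans small')//.
  rewrite mulrA ler_pM2r// (le_trans e'm)// le_eqVlt; apply/orP; left; apply/eqP.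
  by field; rewrite lt0r_neq0.
have := ler_normD ((X n.+1 w)%:R - i%:R * m) (i%:R * m - m * tau * k%:R).
by rewrite addrA subrK; move: dev; lra.
Qed.

Lemma Jdev_bound j (eps : R) : 0 < eps -> exists2 D : R, 0 <= D &
  forall n, (Jdev P m tau X N j eps n <= (D * (hm X n + hm N n))%:E)%E.
Proof.
move=> eps0.
have hm0 (Y : nat -> T -> nat) n : 0 <= hm Y n.
  rewrite mean_Rintegral; apply: Rintegral_ge0 => w _.
  by rewrite mulr_ge0// powR_ge0.
case: j.
- have [D D0 H] := J1_bound eps0; exists D => // n.
  by rewrite (le_trans (H n))// lee_fin ler_wpM2l// lerDr.
- have [D D0 H] := J2_bound eps0; exists D => // n.
  by rewrite (le_trans (H n))// lee_fin ler_wpM2l// lerDl.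
- have [D D0 H] := J3_bound eps0; exists D => // n.
  by rewrite (le_trans (H n))// lee_fin ler_wpM2l// lerDl.
Qed.

End MomentBound.
End RatioDeviations.

(** * Upper and lower limits; powers against exponentials *)

Section LimSup.
Context {R : realType}.

Lemma limn_esup_lty (u : (\bar R)^nat) (c : R) :
  (\forall n \near \oo, (u n <= c%:E)%E) -> (limn_esup u < +oo)%E.
Proof.
move=> uc; apply: (@le_lt_trans _ _ c%:E); last exact: ltry.
apply: ereal_inf_le; exists (ereal_sup (u @` [set n | (u n <= c%:E)%E])).
  by exists [set n | (u n <= c%:E)%E].
by apply: ge_ereal_sup => _ [n un <-].
Qed.

Lemma limn_einf_gt0 (u : (\bar R)^nat) (c : R) : 0 < c ->
  (\forall n \near \oo, (c%:E <= u n)%E) -> (0 < limn_einf u)%E.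
Proof.
move=> c0 uc; apply: (@lt_le_trans _ _ c%:E); first by rewrite lte_fin.
rewrite /limn_einf leeNr.
apply: ereal_inf_le; exists (ereal_sup ((\- u)%E @` [set n | (c%:E <= u n)%E])).
  by exists [set n | (c%:E <= u n)%E].
by apply: ge_ereal_sup => _ [n un <-]; rewrite leeN2.
Qed.

(** The inequality z <= exp z at z = t y / p, raised to the power p. *)
Lemma powR_le_expR (p t y : R) : 0 < p -> 0 < t -> 0 <= y ->
  y `^ p <= (p / t) `^ p * expR (t * y).
Proof.
move=> p0 t0 y0; have pt : 0 < p / t by rewrite divr_gt0.
have -> : y = (p / t) * (t / p * y) by field; rewrite !lt0r_neq0.
rewrite powRM; [|exact: ltW|by rewrite mulr_ge0// divr_ge0// ltW].
rewrite ler_pM2l ?powR_gt0//.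
have -> : expR (t * (p / t * (t / p * y))) = expR (t / p * y) `^ p.
  rewrite /powR gt_eqF ?expR_gt0// expRK; congr expR.
  by field; rewrite !lt0r_neq0.
apply: le_powR2; [exact: ltW|by rewrite mulr_ge0// divr_ge0// ltW|].
by apply: le_trans (expR_ge1Dx _); rewrite lerDr.
Qed.

End LimSup.

(** * Control deviations from moments *)

Section ControlTails.
Context {R : realType} {d : measure_display} {T : measurableType d}.
Variables (P : probability T R) (tau : R) (phi : nat -> {RV P >-> nat}).

Definition control_tail (q : R) : Prop := forall eps : R, 0 < eps ->
  exists2 D : R, 0 <= D & forall k, (0 < k)%N ->
    (P (phi k @^-1` [set i : nat | (eps < `|i%:R / k%:R - tau|)%R]) <=
     (D * k%:R `^ (- q))%:E)%E.

Lemma measurable_preimage_nat (Y : {RV P >-> nat}) (B : set nat) :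
  measurable (Y @^-1` B).
Proof. by rewrite -[X in measurable X]setTI; exact: measurable_funPT. Qed.

Lemma chernoff_nat (Y : {RV P >-> nat}) (B : set nat) (g : nat -> R) (c : R) :
  0 <= c -> (forall x, 0 <= g x) -> (forall x, B x -> c <= g x) ->
  (c%:E * P (Y @^-1` B) <= 'E_P[fun w => (g (Y w))%R])%E.
Proof.
move=> c0 g0 gB; rewrite expectation.unlock.
have mB := measurable_preimage_nat Y B.
rewrite -[X in P X]setIT -integral_indic// -ge0_integralZl ?lee_fin//; last first.
  by apply/measurable_EFinP; exact: measurable_indic.
apply: ge0_le_integral => //.
- by move=> w _; rewrite -EFinM lee_fin mulr_ge0.
- by apply: measurable_funeM; apply/measurable_EFinP; exact: measurable_indic.
- apply/measurable_EFinP; exact: (measurableT_comp (f := g)).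
move=> w _; rewrite -EFinM lee_fin indicE.
have [/set_mem Bw|_] := boolP (w \in Y @^-1` B); last by rewrite mulr0.
by rewrite mulr1; exact: gB.
Qed.

(** Markov's inequality at order p: a moment of order k^(p/2) against (eps k)^p leaves k^(-p/2). *)
Lemma moment_control_tail (p : R) : 2 <= p ->
  (ereal_sup [set ((k%:R `^ (- (p / 2)))%:E *
                   'E_P[fun w => (`|(phi k w)%:R - tau * k%:R| `^ p)%R])%E |
              k in [set k : nat | (1 <= k)%N]] < +oo)%E ->
  control_tail (p / 2).
Proof.
move=> p2; set E := ereal_sup _ => Efin eps eps0.
have [D D0 HD] : exists2 D : R, 0 <= D & (E <= D%:E)%E.
  move: Efin; case: E => [r _|//|_]; last by exists 0; rewrite ?leNye.
  by exists `|r|; rewrite ?normr_ge0// lee_fin ler_norm.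
have epsp : 0 < eps `^ p by exact: powR_gt0.
exists (D / eps `^ p); first by rewrite divr_ge0// ltW.
move=> k k0; have kR : 0 < k%:R :> R by rewrite ltr0n.
set B := [set i : nat | _].
have kq0 : 0 < k%:R `^ (- (p / 2)) :> R by exact: powR_gt0.
have kq0' : 0 < k%:R `^ (p / 2) :> R by exact: powR_gt0.
have epsk : 0 <= eps * k%:R by rewrite mulr_ge0// ltW.
have mk : (((eps * k%:R) `^ p)%:E * P (phi k @^-1` B) <=
    'E_P[fun w => (`|(phi k w)%:R - tau * k%:R| `^ p)%R])%E.
  apply: (@chernoff_nat _ _ (fun i => `|i%:R - tau * k%:R| `^ p)).
  - exact: powR_ge0.
  - by move=> x; exact: powR_ge0.
  move=> i Bi; apply: le_powR2 => //; first by lra.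
  rewrite -ler_pdivlMr// (le_trans (ltW Bi))//.
  rewrite -{3}(gtr0_norm kR) -normrV ?unitfE ?lt0r_neq0// -normrM mulrBl.
  by rewrite mulfK// lt0r_neq0.
have : ((k%:R `^ (- (p / 2)))%:E * (((eps * k%:R) `^ p)%:E * P (phi k @^-1` B))
    <= D%:E)%E.
  apply: (le_trans _ HD); apply: (le_trans (lee_wpmul2l _ mk)).
    by rewrite lee_fin ltW.
  by apply: ereal_sup_ubound; exists k.
have Pfin : P (phi k @^-1` B) \is a fin_num.
  by apply: fin_num_measure; exact: measurable_preimage_nat.
rewrite -(fineK Pfin) -!EFinM !lee_fin => H.
set pr := fine _ in H *.
rewrite powRM ?(ltW eps0)// in H.
have kk : k%:R `^ p = k%:R `^ (p / 2) * k%:R `^ (p / 2) :> R.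
  by rewrite -powRD_gt0//; congr (_ `^ _); field.
rewrite mulrAC ler_pdivlMr// powRN ler_pdivlMr//.
move: H; rewrite kk powRN.
rewrite [X in X <= D -> _](_ : _ = pr * eps `^ p * k%:R `^ (p / 2))//.
by field; rewrite lt0r_neq0.
Qed.

End ControlTails.

(** * Consequences of the exponential condition *)

Section ExponentialMoments.
Context {R : realType} {d : measure_display} {T : measurableType d}.
Variables (P : probability T R) (m tau : R) (xi : {RV P >-> nat})
  (phi : nat -> {RV P >-> nat}).
Hypothesis ade : ADE tau xi phi.

Lemma exponential_xi_moment (p : R) : 0 <= m -> 0 < p ->
  ('E_P[fun w => (`|(xi w)%:R - m| `^ p)%R] < +oo)%E.
Proof.
move=> m0 p0; have /nbhs_ballP[rho /= rho0 H] := ADE_mgf ade.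
pose t := rho / 2; have t0 : 0 < t by rewrite divr_gt0.
have Mt : ('M_P (fun w => (xi w)%:R) t < +oo)%E.
  apply: H; rewrite /ball /= sub0r normrN gtr0_norm// /t.
  by rewrite ltr_pdivrMr// ltr_pMr// ltr1n.
pose A := (p / t) `^ p * expR (t * m).
have A0 : 0 <= A by rewrite mulr_ge0 ?powR_ge0 ?expR_ge0.
have mexp : measurable_fun setT (fun w => (expR ((xi w)%:R * t))%:E : \bar R).
  apply/measurable_EFinP.
  exact: (measurableT_comp (f := fun x : nat => expR (x%:R * t))).
apply: (@le_lt_trans _ _ (A%:E * 'M_P (fun w => (xi w)%:R) t)%E); last first.
  by rewrite lte_mul_pinfty.
rewrite /mmt_gen_fun expectation.unlock -ge0_integralZl ?lee_fin//; last first.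
  by move=> w _; rewrite lee_fin expR_ge0.
apply: ge0_le_integral => //.
- apply/measurable_EFinP.
  exact: (measurableT_comp (f := fun x : nat => `|x%:R - m| `^ p)).
- exact: measurable_funeM.
move=> w _; rewrite -EFinM lee_fin /=.
apply: (@le_trans _ _ (((xi w)%:R + m) `^ p)).
  apply: le_powR2; [exact: ltW|exact: normr_ge0|].
  by rewrite (le_trans (ler_normB _ _))// normr_nat ger0_norm.
apply: (le_trans (powR_le_expR p0 t0 _)); first by rewrite addr_ge0.
have -> : expR (t * ((xi w)%:R + m)) = expR (t * m) * expR ((xi w)%:R * t).
  by rewrite -expRD; congr expR; ring.
by rewrite mulrA.
Qed.

Let L (t : R) := fine (Lambda phi t).

Lemma Lambda0 : L 0 = 0.
Proof.
rewrite /L /Lambda (_ : scaled_cgf phi 0 = fun=> 0%E) ?lim_cst//.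
apply/funext => k; rewrite /scaled_cgf /mmt_gen_fun.
rewrite (_ : _ \o _ = fun=> 1); last by apply/funext => w /=; rewrite mulr0 expR0.
by rewrite expectation_cst lne_EFin// ln1 mule0.
Qed.

(** The difference quotient at 0, where Lambda vanishes and has slope tau. One step [h] serves both
    tilts s = 1 and s = -1, one for each side of the deviation. *)
Lemma Lambda_slope (delta : R) : 0 < delta -> exists2 h : R, 0 < h &
  forall s : R, `|s| = 1 ->
    [/\ cvgn (scaled_cgf phi (s * h)), Lambda phi (s * h) \is a fin_num &
        L (s * h) <= h * (s * tau + delta)].
Proof.
move=> delta0; have [lo [hi [lo0 hi0 H]]] := ADE_cgf ade.
have lh0 : lo < 0 < hi by rewrite lo0.
have [_ _ dL] := H 0 lh0.
have := ADE_tau ade; rewrite derive1E => dtau.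
have cvL : h^-1 *: (L (h *: 1 + 0) - L 0) @[h --> 0^'] --> tau.
  by rewrite -dtau; exact: dL.
move/cvgrPdist_lt: cvL => /(_ _ delta0)[rho /= rho0 Hr].
pose h := Num.min (rho / 2) (Num.min (hi / 2) (- lo / 2)).
have h0 : 0 < h by rewrite !lt_min !divr_gt0// oppr_gt0.
have [hr hhi hlo] : [/\ h <= rho / 2, h <= hi / 2 & h <= - lo / 2].
  by rewrite /h !ge_min !lexx !orbT.
exists h => // s s1.
have /andP[s_ge s_le] : - 1 <= s <= 1 by rewrite -ler_norml s1.
have lsh : lo < s * h < hi by apply/andP; split; nra.
have [cv fin _] := H _ lsh; split=> //.
have s0 : s != 0 by rewrite -normr_gt0 s1.
have sh0 : s * h != 0 by rewrite mulf_neq0// lt0r_neq0.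
have := Hr (s * h); rewrite /= sub0r normrN normrM s1 mul1r gtr0_norm//.
move=> /(_ _ sh0); rewrite Lambda0 subr0 scaler1 addr0 => Hd.
have /Hd : h < rho by move: hr rho0; lra.
rewrite /GRing.scale /= ltr_norml => /andP[Hl Hu].
have ss : s * s = 1 by rewrite -expr2 -[s ^+ 2]real_normK ?num_real// s1 expr1n.
have e1 : L (s * h) = s * h * ((s * h)^-1 * L (s * h)) by rewrite mulrA mulfV// mul1r.
rewrite e1; set z := _^-1 * _ in Hl Hu *.
have sz : s * z <= s * tau + delta.
  have : s * (z - tau) <= `|s| * `|z - tau| by rewrite -normrM ler_norm.
  have : `|z - tau| <= delta by rewrite ler_norml; apply/andP; split; lra.
  by rewrite s1; lra.
have : h * (s * z) <= h * (s * tau + delta) by rewrite ler_pM2l.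
lra.
Qed.

Lemma control_mgf_le (eta b : R) :
  cvgn (scaled_cgf phi eta) -> Lambda phi eta \is a fin_num -> L eta < b ->
  \forall k \near \oo,
    ('M_P (fun w => (phi k w)%:R) eta <= (expR (b * k%:R))%:E)%E.
Proof.
move=> cv fin Lb.
have : scaled_cgf phi eta @ \oo --> (L eta)%:E by rewrite /L fineK.
move=> /fine_cvgP[nfin cvL].
have d0 : 0 < b - L eta by rewrite subr_gt0.
have /cvgrPdist_lt /(_ _ d0) nd := cvL.
near=> k.
have k0 : (0 < k)%N by near: k; exists 1%N.
have kR : 0 < k%:R :> R by rewrite ltr0n.
have kfin : scaled_cgf phi eta k \is a fin_num by near: k.
have kd : `|L eta - fine (scaled_cgf phi eta k)| < b - L eta by near: k.
have : (scaled_cgf phi eta k <= b%:E)%E.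
  rewrite -(fineK kfin) lee_fin.
  by move: kd; rewrite ltr_norml => /andP[]; lra.
rewrite /scaled_cgf lee_pdivrMl// -EFinM.
case: ('M_P _ _)%E => [r||] //=; last by move=> _; exact: leNye.
have [r0 _|r0] := leP r 0; first by rewrite lee_fin (le_trans r0)// expR_ge0.
by rewrite !lee_fin -[X in _ -> X <= _]lnK ?posrE// ler_expR mulrC.
Unshelve. all: by end_near.
Qed.

(** Chernoff's bound with tilt s h. Of the margin eps, a quarter pays for the slope of Lambda, a
    quarter for the convergence of the scaled cumulants, and half is left as the rate. *)
Lemma exponential_one_sided (eps : R) : 0 < eps -> exists2 h : R, 0 < h &
  forall s : R, `|s| = 1 -> \forall k \near \oo,
    (P (phi k @^-1` [set i : nat | (eps * k%:R < s * (i%:R - tau * k%:R))%R])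
      <= (expR (- (h * k%:R)))%:E)%E.
Proof.
move=> eps0; have eps4 : 0 < eps / 4 by rewrite divr_gt0.
have [h h0 H] := Lambda_slope eps4.
exists (h * (eps / 2)); first by rewrite mulr_gt0// divr_gt0.
move=> s s1; have [cv fin Ls] := H s s1.
have Lb : L (s * h) < h * (s * tau + eps / 2).
  apply: (le_lt_trans Ls); rewrite ltr_pM2l//; lra.
have near_mgf := control_mgf_le cv fin Lb.
near=> k.
have Mk : ('M_P (fun w => (phi k w)%:R) (s * h) <=
    (expR (h * (s * tau + eps / 2) * k%:R))%:E)%E by near: k.
set B := [set i : nat | _].
have Pfin : P (phi k @^-1` B) \is a fin_num.
  by apply: fin_num_measure; exact: measurable_preimage_nat.
have := @chernoff_nat _ _ _ P (phi k) B (fun i => expR (i%:R * (s * h)))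
  (expR (h * (s * tau + eps) * k%:R)) (expR_ge0 _).
move=> /(_ (fun x => expR_ge0 _)) HB.
have {HB} : ((expR (h * (s * tau + eps) * k%:R))%:E * P (phi k @^-1` B) <=
    (expR (h * (s * tau + eps / 2) * k%:R))%:E)%E.
  apply: le_trans Mk; apply: HB => i Bi; rewrite ler_expR.
  have : h * (eps * k%:R) <= h * (s * (i%:R - tau * k%:R)) by rewrite ler_pM2l// ltW.
  lra.
rewrite -(fineK Pfin) -EFinM !lee_fin mulrC -ler_pdivlMr ?expR_gt0//.
move/le_trans; apply; rewrite -expRN -expRD ler_expR.
by rewrite le_eqVlt; apply/orP; left; apply/eqP; field.
Unshelve. all: by end_near.
Qed.

Lemma exponential_control_tail (q : R) : 0 < q -> control_tail tau phi q.
Proof.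
move=> q0 eps eps0; have [h h0 H] := exponential_one_sided eps0.
have n1 : `|1| = 1 :> R by rewrite normr1.
have nN1 : `|-1| = 1 :> R by rewrite normrN1.
have [k0 _ Hk] : \forall k \near \oo,
    (P (phi k @^-1` [set i : nat | (eps < `|i%:R / k%:R - tau|)%R]) <=
      (2 * expR (- (h * k%:R)))%:E)%E.
  have near1 := H 1 n1; have nearN1 := H (-1) nN1.
  near=> k.
  have k_gt0 : (0 < k)%N by near: k; exists 1%N.
  have kR : 0 < k%:R :> R by rewrite ltr0n.
  have P1 : (P (phi k @^-1` [set i : nat |
      (eps * k%:R < 1 * (i%:R - tau * k%:R))%R]) <= (expR (- (h * k%:R)))%:E)%E.
    by near: k.
  have P2 : (P (phi k @^-1` [set i : nat |
      (eps * k%:R < -1 * (i%:R - tau * k%:R))%R]) <= (expR (- (h * k%:R)))%:E)%E.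
    by near: k.
  move: P1 P2; set e := expR _; set B1 := [set i : nat | _].
  set B2 := [set i : nat | _] => P1 P2.
  apply: (@le_trans _ _ (P (phi k @^-1` B1 `|` phi k @^-1` B2))).
    apply: le_measure; rewrite ?inE.
    - exact: measurable_preimage_nat.
    - by apply: measurableU; exact: measurable_preimage_nat.
    move=> w /= dev.
    have {}dev : eps * k%:R < `|(phi k w)%:R - tau * k%:R|.
      have -> : (phi k w)%:R - tau * k%:R = ((phi k w)%:R / k%:R - tau) * k%:R.
        by rewrite mulrBl divfK// lt0r_neq0.
      by rewrite normrM (gtr0_norm kR) ltr_pM2r.
    have [S0|S0] := leP 0 ((phi k w)%:R - tau * k%:R).
      by left; rewrite /B1 /= mul1r -(ger0_norm S0).
    by right; rewrite /B2 /= mulN1r -(ltr0_norm S0).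
  apply: (le_trans (measureU2 _ _ _)); try exact: measurable_preimage_nat.
  have -> : 2 * e = e + e by ring.
  rewrite EFinD; exact: leeD.
have qh : 0 < (q / h) `^ q by rewrite powR_gt0// divr_gt0.
(* The first term dominates the exponential bound for k >= k0; for smaller k, k0^q k^(-q) >= 1
   bounds any probability. *)
exists (2 * (q / h) `^ q + k0%:R `^ q).
  by rewrite addr_ge0 ?powR_ge0// mulr_ge0// ltW.
move=> k k_gt0; have kR : 0 < k%:R :> R by rewrite ltr0n.
have kq : 0 < k%:R `^ q :> R by exact: powR_gt0.
have [k0k|kk0] := leqP k0 k.
  apply: (le_trans (Hk k k0k)); rewrite lee_fin powRN ler_pdivlMr//.
  have le1 := powR_le_expR q0 h0 (ltW kR).
  apply: (@le_trans _ _ (2 * (q / h) `^ q)); last by rewrite lerDl powR_ge0.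
  rewrite -mulrA ler_pM2l// expRN mulrC ler_pdivrMr ?expR_gt0//.
apply: (le_trans (probability_le1 P _)); first exact: measurable_preimage_nat.
rewrite lee_fin powRN ler_pdivlMr// mul1r.
apply: (@le_trans _ _ (k0%:R `^ q)); last by rewrite lerDr mulr_ge0// ltW.
by apply: le_powR2; [exact: ltW|exact: ltW|rewrite ler_nat ltnW].
Unshelve. all: by end_near.
Qed.

End ExponentialMoments.

(** * Assembly of the estimates *)

Section Assembly.
Context {R : realType} {d : measure_display} {T : measurableType d}.
Variables (P : probability T R) (sigma : R).
Hypothesis sigma0 : 0 < sigma.

Lemma b_cr_gt0 (r : R) : \forall n \near \oo, 0 < b_cr sigma r n.
Proof.
(* From 2 on, because ln 1 = 0 makes the normalization vanish at n = 1 when r = sigma. *)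
exists 2%N => // n /= n2; have nR : 0 < n%:R :> R by rewrite ltr0n (leq_trans _ n2).
rewrite /b_cr; case: ifP => _; first exact: powR_gt0.
case: ifP => _; last exact: powR_gt0.
by rewrite mulr_gt0 ?powR_gt0// ln_gt0// ltr1n.
Qed.

Lemma laplace_hm_upper (Y : nat -> T -> nat) (r : R) :
  (forall n, measurable_fun setT (Y n)) -> laplace_bounds P sigma Y -> 0 < r ->
  exists2 C, 0 < C & \forall n \near \oo,
    mean P (fun w => (Y n w)%:R `^ (- r) * (0 < Y n w)%N%:R) <= C * b_cr sigma r n.
Proof.
move=> mY lY r0; have [C C0 tail] := laplace_tail mY lY.
exact: (hm_upper mY C0 tail r0).
Qed.

Lemma laplace_hm_lower (Y : nat -> T -> nat) (r : R) :
  (forall n, measurable_fun setT (Y n)) -> laplace_bounds P sigma Y -> 0 < r ->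
  exists2 c, 0 < c & \forall n \near \oo,
    c * b_cr sigma r n <= mean P (fun w => (Y n w)%:R `^ (- r) * (0 < Y n w)%N%:R).
Proof.
move=> mY lY r0; have [C C0 tail] := laplace_tail mY lY.
have [B [D [K0 [B1 D0 K00 win]]]] := laplace_window sigma0 mY C0 lY tail.
exact: (hm_lower sigma0 mY B1 D0 K00 win r0).
Qed.

Lemma harmonic_ratio_bounds (Y : nat -> T -> nat) (r : R) :
  (forall n, measurable_fun setT (Y n)) -> laplace_bounds P sigma Y -> 0 < r ->
  let ratio := fun n : nat =>
    (harmonic_moment P r (Y n) * (b_cr sigma r n)^-1%:E)%E in
  [/\ (0 < limn_einf ratio)%E, (limn_einf ratio <= limn_esup ratio)%E
    & (limn_esup ratio < +oo)%E].
Proof.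
move=> mY lY r0 ratio; have b0 := b_cr_gt0 r.
split; [|exact: limn_einf_sup|].
- have [c c0 lo] := laplace_hm_lower mY lY r0.
  apply: (@limn_einf_gt0 _ _ c c0); near=> n.
  have bn : 0 < b_cr sigma r n by near: n.
  rewrite /ratio harmonic_momentE// -EFinM lee_fin ler_pdivlMr//.
  by near: n.
- have [C C0 up] := laplace_hm_upper mY lY r0.
  apply: (@limn_esup_lty _ _ C); near=> n.
  have bn : 0 < b_cr sigma r n by near: n.
  rewrite /ratio harmonic_momentE// -EFinM lee_fin ler_pdivrMr//.
  by near: n.
Unshelve. all: by end_near.
Qed.

End Assembly.

(** The common end of both deviation statements: each condition supplies a moment of xi of order 2q
    and a control tail of order q. *)
Lemma Jdev_le_b_cr (R : realType) (d : measure_display) (T : measurableType d)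
    (P : probability T R) (m tau sigma : R) (xi : {RV P >-> nat})
    (phi : nat -> {RV P >-> nat}) (X0 : {RV P >-> nat})
    (Xi Phi : nat -> nat -> {RV P >-> nat}) (l dl : edge -> R -> R)
    (q eps : R) (j : deviation) :
  cbp_model m xi phi X0 Xi Phi -> AD0 phi tau l dl -> ADC m tau xi l dl sigma ->
  1 <= q -> ('E_P[fun w => (`|(xi w)%:R - m| `^ (2 * q))%R] < +oo)%E ->
  control_tail tau phi q -> 0 < eps ->
  exists C : R, \forall n \near \oo,
    (Jdev P m tau (popX X0 (fun n j => Xi n j) (fun n k => Phi n k))
      (popN X0 (fun n j => Xi n j) (fun n k => Phi n k)) j eps n
      <= (C * b_cr sigma q n)%:E)%E.
Proof.
move=> model ad0 adc q1 xi_moment tails eps0.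
have sigma0 := ADC_sigma_gt0 adc; have tau0 := AD0_tau_gt0 ad0.
have q0 : 0 < q by exact: lt_le_trans q1.
have [D D0 HJ] := Jdev_bound model tau0 q1 xi_moment tails j eps0.
have [CX _ upX] := laplace_hm_upper (measurable_X model)
  (laplace_X model ad0 adc) q0.
have [CN _ upN] := laplace_hm_upper (measurable_N model)
  (laplace_N model ad0 adc) q0.
exists (D * (CX + CN)); near=> n.
apply: (le_trans (HJ n)); rewrite lee_fin -mulrA ler_wpM2l// mulrDl.
by apply: lerD; near: n.
Unshelve. all: by end_near.
Qed.

Theorem theorem2p9 (R : realType) (d : measure_display) (T : measurableType d)
    (P : probability T R) (m tau sigma : R) (xi : {RV P >-> nat})
    (phi : nat -> {RV P >-> nat}) (X0 : {RV P >-> nat})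
    (Xi Phi : nat -> nat -> {RV P >-> nat}) (l dl : edge -> R -> R) :
  let X := popX X0 (fun n j => Xi n j) (fun n k => Phi n k) in
  let N := popN X0 (fun n j => Xi n j) (fun n k => Phi n k) in
  let J := Jdev P m tau X N in
  cbp_model m xi phi X0 Xi Phi ->
  AD0 phi tau l dl ->
  ADC m tau xi l dl sigma ->
  [/\ forall Y : nat -> T -> nat, Y = X \/ Y = N ->
      forall r : R, 0 < r ->
        let ratio := fun n : nat =>
          (harmonic_moment P r (Y n) * (b_cr sigma r n)^-1%:E)%E in
        [/\ (0 < limn_einf ratio)%E,
            (limn_einf ratio <= limn_esup ratio)%E
          & (limn_esup ratio < +oo)%E],
      forall p : R, 2 <= p ->
        ('E_P[fun w => (`|(xi w)%:R - m| `^ p)%R] < +oo)%E ->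
        (ereal_sup [set ((k%:R `^ (- (p / 2)))%:E *
                         'E_P[fun w => (`|(phi k w)%:R - tau * k%:R| `^ p)%R])%E |
                    k in [set k : nat | (1 <= k)%N]] < +oo)%E ->
        forall (eps : R) (j : deviation), 0 < eps ->
          (limn_esup (fun n => J j eps n * (b_cr sigma (p / 2) n)^-1%:E)
             < +oo)%E
    & ADE tau xi phi ->
      forall (eps : R) (j : deviation), 0 < eps ->
        (limn_esup (fun n => (n%:R `^ sigma)%:E * J j eps n) < +oo)%E].
Proof.
move=> X N J model ad0 adc.
have sigma0 := ADC_sigma_gt0 adc.
split.
- move=> Y YXN r r0; apply: harmonic_ratio_bounds => //.
  + by case: YXN => -> n; [exact: (measurable_X model)|exact: (measurable_N model)].
  + by case: YXN => ->; [exact: (laplace_X model ad0 adc)|exact: (laplace_N model ad0 adc)].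
- move=> p p2 xi_moment control_moment eps j eps0.
  have q1 : 1 <= p / 2 by rewrite ler_pdivlMr// mul1r.
  have p2E : 2 * (p / 2) = p by field.
  have xi_moment' : ('E_P[fun w => (`|(xi w)%:R - m| `^ (2 * (p / 2)))%R] < +oo)%E.
    by rewrite p2E.
  have tails := moment_control_tail p2 control_moment.
  have [C HC] := Jdev_le_b_cr j model ad0 adc q1 xi_moment' tails eps0.
  have b0 := @b_cr_gt0 R sigma (p / 2).
  apply: (@limn_esup_lty _ _ C); near=> n.
  have bn : 0 < b_cr sigma (p / 2) n by near: n.
  rewrite lee_pdivrMr// -EFinM.
  by near: n.
- move=> ade eps j eps0.
  (* Any exponent above sigma puts [b_cr] in the regime n^(-sigma), and the offspring bound wants an
     exponent of at least 1; sigma + 1 does both. *)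
  have q0 : 0 < sigma + 1 by rewrite addr_gt0.
  have q1 : 1 <= sigma + 1 by rewrite lerDr ltW.
  have m0 : 0 <= m := ltW (cbp_mean_gt0 model).
  have xi_moment := exponential_xi_moment ade m0 (mulr_gt0 (ltr0n R 2) q0).
  have tails := exponential_control_tail ade q0.
  have [C HC] := Jdev_le_b_cr j model ad0 adc q1 xi_moment tails eps0.
  apply: (@limn_esup_lty _ _ C); near=> n.
  have n0 : (0 < n)%N by near: n; exists 1%N.
  have ns : 0 < n%:R `^ sigma :> R by rewrite powR_gt0// ltr0n.
  have : (J j eps n <= (C * b_cr sigma (sigma + 1) n)%:E)%E by near: n.
  rewrite /b_cr ltrDl ltr01 powRN => HJ.
  by rewrite muleC -lee_pdivlMr// -EFinM.
Unshelve. all: by end_near.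
Qed.
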